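(* Let $J_0,J_1:\mathbb{R}^n\to\mathbb{R}$ be twice continuously differentiable with locally Lipschitz continuous Hessians, $J=(J_0,J_1)$. Let $\lambda_0\in[0,1]$, let $x_0\in\mathbb{R}^n$ fulfill the strict second order optimality condition with respect to $J_{\lambda_0}$, and let $x_{0,k}\to x_0$ as $k\to\infty$. Let $x(\lambda)$ be the solution of $\dot x(\lambda)=f(\lambda,x(\lambda))$, $x(\lambda_0)=x_0$, on its maximal interval $(\lambda_l',\lambda_u')$. Then: (i) Let $\varepsilon>0$. For $k$ sufficiently large, the solution $x_k(\lambda)$ of $\dot x_k(\lambda)=f(\lambda,x_k(\lambda))$ with initial condition $x_k(\lambda_0)=x_{0,k}$ exists on some maximal interval $(\lambda_{l,k}',\lambda_{u,k}')\subseteq[0,1]$, and for all $\lambda$ in this interval $x_k(\lambda)$ is $\varepsilon$-critical with respect to $J_\lambda$ and hence (for $\lambda\in(0,1)$) $\varepsilon'$-Pareto critical with $\varepsilon'=\frac{\varepsilon}{\min\{\lambda,1-\lambda\}}$. (ii) Let $I=[\lambda_l,\lambda_u]\subset(\lambda_l',\lambda_u')$ be a compact interval containing $\lambda_0$. Let $\Lambda(I)=\inf_{\lambda\in I}\Lambda(\lambda,x(\lambda))$, $L_H(I,\delta)=\sup_{\lambda\in I}L_H(x(\lambda),\delta)$ and $C_i(\delta,I)=\sup_{\lambda\in I}C_i(x(\lambda),\delta)$, $i=1,2$. Let $0<\delta<\Lambda(I)/L_H(I,\delta)$ (with $\Lambda(I)/0=\infty$), which is always possible, and set $$L_f(\delta,I)=2\left(\frac{C_2(\delta,I)}{\Lambda(I)-\delta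 L_H(I,\delta)}+\left(\frac{1}{\Lambda(I)-\delta L_H(I,\delta)}\right)^2L_H(I,\delta)\,C_1(\delta,I)\right).$$ Then, for $k$ sufficiently large, $x_k(\lambda)$ exists for $\lambda\in[\lambda_l,\lambda_u]$ and $$\|x(\cdot)-x_k(\cdot)\|_{C(I,\mathbb{R}^n)}\le\|x_0-x_{0,k}\|\,e^{L_f(\delta,I)\max\{\lambda_0-\lambda_l,\lambda_u-\lambda_0\}}.$$ Hence, for $\lambda\in I$, $x_k(\lambda)$ converges to the locally $J_\lambda$-optimal and locally Pareto optimal point $x(\lambda)$ with the same rate as $x_{0,k}$ converges to the locally $J_{\lambda_0}$-optimal and locally Pareto optimal point $x_0$. (iii) Let, in addition, $f_l$ ($l\in\mathbb{N}$) be locally Lipschitz functions on the domain of $f$, with values in $\mathbb{R}^n$, such that $f-f_l\to0$ uniformly on compact sets as $l\to\infty$. Then, for $I$ and $\delta$ as in (ii) and $k,l$ sufficiently large, the solution $x_{k;l}(\lambda)$ of $\dot x_{k;l}(\lambda)=f_l(\lambda,x_{k;l}(\lambda))$ with initial condition $x_{k;l}(\lambda_0)=x_{0,k}$ exists on $I$ and $$\|x(\cdot)-x_{k;l}(\cdot)\|_{C(I,\mathbb{R}^n)}\le\|x_0-x_{0,k}\|\,e^{L_f(\delta,I)\max\{\lambda_0-\lambda_l,\lambda_u-\lambda_0\}}+\frac{1}{L_f(\delta,I)}\left(e^{L_f(\delta,I)\max\{\lambda_0-\lambda_l,\lambda_u-\lambda_0\}}-1\right)\|f_l-f\|_{C(\overline{\mathcal{U}(I,\delta)},\mathbb{R}^n)},$$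 where $\mathcal{U}(I,\delta)=\bigcup_{\lambda\in I}B_\delta(x(\lambda))$.
   Context: For $\lambda\in[0,1]$, $J_\lambda=(1-\lambda)J_0+\lambda J_1$; $\nabla_x$ and $\nabla_x^2$ denote gradient and Hessian in $x$. $\Lambda(\lambda,x)$ is the smallest eigenvalue of $\nabla_x^2J_\lambda(x)$. $\|\cdot\|$ is the Euclidean norm for vectors and the spectral norm for matrices; $B_\delta(x)$ is the open ball of radius $\delta$ centered at $x$. $L_H(x,\delta)$ is the (smallest) common Lipschitz constant of the Hessians on $B_\delta(x)$: $\|\nabla_x^2J_i(x')-\nabla_x^2J_i(x'')\|\le L_H(x,\delta)\|x'-x''\|$ for $x',x''\in B_\delta(x)$, $i=0,1$. $C_1(x,\delta)=\max_{i\in\{0,1\}}\sup_{x'\in B_\delta(x)}\|\nabla_xJ_i(x')\|$ and $C_2(x,\delta)=\max_{i\in\{0,1\}}\sup_{x'\in B_\delta(x)}\|\nabla_x^2J_i(x')\|$. The function $f$ is defined on the set of $(\lambda,x)\in[0,1]\times\mathbb{R}^n$ for which $\nabla_x^2J_\lambda(x)$ is invertible, by $$f(\lambda,x)=\left(\nabla_x^2J_\lambda(x)\right)^{-1}\left(\nabla_xJ_0(x)-\nabla_xJ_1(x)\right).$$ The maximal interval of a solution $y(\lambda)$ of $\dot y=f(\lambda,y)$ started at $\lambda_0$ at a point $y_0$ with $\Lambda(\lambda_0,y_0)>0$ is the largest interval in $[0,1]$ containing $\lambda_0$, open (except that it includes the endpoint $\lambda_0$ if $\lambda_0\in\{0,1\}$),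 on which the solution exists with $\Lambda(\lambda,y(\lambda))>0$. $\|\cdot\|_{C(I,\mathbb{R}^n)}$ is the maximum norm on $I$. $\|f_l-f\|_{C(\overline{\mathcal{U}(I,\delta)},\mathbb{R}^n)}$ is the supremum (in $[0,\infty]$) of $\|f_l(\lambda,x)-f(\lambda,x)\|$ over $\lambda\in I$ and $x\in\overline{\mathcal{U}(I,\delta)}$ with $(\lambda,x)$ in the domain of $f$. A point $x$ fulfills the strict second order optimality condition with respect to $J_\lambda$ if $\nabla_xJ_\lambda(x)=0$ and $\nabla_x^2J_\lambda(x)$ is strictly positive definite. A point $x$ is $\varepsilon$-critical with respect to $J_\lambda$ if $\|\nabla_xJ_\lambda(x)\|\le\varepsilon$. A point $x$ is $\varepsilon$-Pareto critical if there is no $d\in\mathbb{R}^n$ such that $\nabla_xJ_i(x)^\top d\le-\varepsilon\|d\|$ and $\nabla_xJ_j(x)^\top d<0$ for some $i,j\in\{0,1\}$ with $i\ne j$. A point $x$ is locally $J_\lambda$-optimal if $J_\lambda(x)\le J_\lambda(x')$ for all $x'$ in some open neighborhood of $x$. A point $x'$ dominates $x$ if $J_i(x')\le J_i(x)$ for $i=0,1$ with strict inequality for at least one $i$; $x$ is locally Pareto optimal if some open neighborhood of $x$ contains no point dominating $x$. *)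

(* Defs.v *)
From HB Require Import structures.
From mathcomp Require Import all_boot all_order all_algebra.
From mathcomp Require Import all_classical all_reals all_analysis.

Set Implicit Arguments.
Unset Strict Implicit.
Unset Printing Implicit Defensive.

Import Order.TTheory GRing.Theory Num.Theory.
Import numFieldNormedType.Exports.

Local Open Scope classical_set_scope.
Local Open Scope ring_scope.

(* Points of R^n are column vectors.  The norm `|_| that the library puts on
   matrices is the maximum norm; it induces the usual topology (so limits,
   differentiability, closures and compactness are the standard ones), but
   quantitative statements use the Euclidean norm [enorm] and the spectral norm
   [specnorm] below. *)

Section Euclidean.
Context {R : realType} {n : nat}.
Implicit Types (u v x : 'cV[R]_n) (A : 'M[R]_n).

Definition dotv u v : R := \sum_(i < n) u i 0 * v i 0.

Definition enorm u : R := Num.sqrt (dotv u u).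

Definition eball x (delta : R) : set 'cV[R]_n :=
  [set y | enorm (y - x) < delta].

Definition specnorm A : R :=
  sup [set enorm (A *m v) | v in [set v | enorm v <= 1]].

Definition posdef A : Prop := forall v, v != 0 -> 0 < dotv v (A *m v).

(* For symmetric A and 0 < n the set is finite and nonempty. *)
Definition min_eigenvalue A : R := inf [set a | eigenvalue A a].

Definition grad (g : 'cV[R]_n -> R) x : 'cV[R]_n :=
  \col_i 'D_(delta_mx i 0) g x.

Definition hess (g : 'cV[R]_n -> R) x : 'M[R]_n :=
  \matrix_(i, j) 'D_(delta_mx j 0) (fun y => grad g y i 0) x.

Definition twice_continuously_differentiable (g : 'cV[R]_n -> R) : Prop :=
  [/\ forall x, differentiable g x,
      forall x, differentiable (grad g) x
    & continuous (hess g)].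

(* Maximum norm on I of a function, in [0, +oo]. *)
Definition supnorm (I : set R) (g : R -> 'cV[R]_n) : \bar R :=
  ereal_sup [set (enorm (g t))%:E | t in I].

End Euclidean.

(* Stated with the norms of the library; on finite-dimensional spaces the
   property does not depend on the choice of the norms. *)
Definition locally_lipschitz (R : realType) (V W : normedModType R)
    (D : set V) (g : V -> W) : Prop :=
  forall p, D p -> exists (L : R) (U : set V),
    nbhs p U /\ L.-lipschitz_(D `&` U) g.

Section ODE.
Context {R : realType} {n : nat}.

(* y solves y' = g(t, y), y(t0) = y0, on the interval D, with the graph of y in
   the domain [dom] of g.  The derivative is taken relative to D, i.e. it is
   one-sided at an endpoint belonging to D. *)
Definition ode_solution (g : R * 'cV[R]_n -> 'cV[R]_n)
    (dom : set (R * 'cV[R]_n)) (D : set R) (t0 : R) (y0 : 'cV[R]_n)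
    (y : R -> 'cV[R]_n) : Prop :=
  [/\ D t0, y t0 = y0 &
      forall t, D t -> dom (t, y t) /\
        (s - t)^-1 *: (y s - y t) @[s --> within D t^'] --> g (t, y t)].

(* The interval with endpoints a < b around t0: open, except that it contains
   t0, which adds a point only if t0 is 0 or 1. *)
Definition interval_around (t0 a b : R) : set R := `]a, b[ `|` [set t0].

Definition admissible_ends (t0 a b : R) : Prop :=
  [/\ 0 <= a, b <= 1, a < b &
      [\/ a < t0 < b, (t0 = 0 /\ a = 0) | (t0 = 1 /\ b = 1)]].

End ODE.

Section Biobjective.
Context {R : realType} {n : nat}.
Variable J : 'I_2 -> 'cV[R]_n -> R.
Implicit Types (t delta eps : R) (x : 'cV[R]_n) (I : set R).

Definition Jw t x : R := (1 - t) * J 0 x + t * J 1 x.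

Definition Lambda t x : R := min_eigenvalue (hess (Jw t) x).

Definition rhs_dom : set (R * 'cV[R]_n) :=
  [set p | 0 <= p.1 <= 1 /\ hess (Jw p.1) p.2 \in unitmx].

Definition rhs (p : R * 'cV[R]_n) : 'cV[R]_n :=
  invmx (hess (Jw p.1) p.2) *m (grad (J 0) p.2 - grad (J 1) p.2).

Definition positive_solution (t0 : R) (y0 : 'cV[R]_n) (a b : R)
    (y : R -> 'cV[R]_n) : Prop :=
  [/\ admissible_ends t0 a b,
      ode_solution rhs rhs_dom (interval_around t0 a b) t0 y0 y &
      forall t, interval_around t0 a b t -> 0 < Lambda t (y t)].

(* y is the solution through (t0, y0) and a, b are the endpoints of its maximal
   interval. The values of y outside that interval are irrelevant. *)
Definition maximal_solution (t0 : R) (y0 : 'cV[R]_n) (a b : R)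
    (y : R -> 'cV[R]_n) : Prop :=
  positive_solution t0 y0 a b y /\
  forall a' b' z, positive_solution t0 y0 a' b' z -> a <= a' /\ b' <= b.

Definition strict_second_order t x : Prop :=
  grad (Jw t) x = 0 /\ posdef (hess (Jw t) x).

Definition eps_critical eps t x : Prop := enorm (grad (Jw t) x) <= eps.

Definition eps_Pareto_critical eps x : Prop :=
  ~ exists (d : 'cV[R]_n) (i j : 'I_2),
      [/\ i != j, dotv (grad (J i) x) d <= - eps * enorm d
        & dotv (grad (J j) x) d < 0].

Definition locally_optimal t x : Prop :=
  \forall x' \near x, Jw t x <= Jw t x'.

Definition dominates x' x : Prop :=
  (forall i, J i x' <= J i x) /\ (exists i, J i x' < J i x).

Definition locally_Pareto_optimal x : Prop :=
  \forall x' \near x, ~ dominates x' x.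

(* If the J i are twice continuously differentiable with locally Lipschitz
   Hessians, the sets below whose infimum or supremum is taken over a ball
   eball x delta, or over the points x t for t in a compact interval I on which
   x is continuous, are nonempty and bounded for delta > 0, so that [inf] and
   [sup] in R are the genuine ones. *)
Definition L_H x delta : R :=
  inf [set L | 0 <= L /\ forall i x' x'',
         eball x delta x' -> eball x delta x'' ->
         specnorm (hess (J i) x' - hess (J i) x'') <= L * enorm (x' - x'')].

Definition C_1 x delta : R :=
  Num.max (sup [set enorm (grad (J 0) x') | x' in eball x delta])
          (sup [set enorm (grad (J 1) x') | x' in eball x delta]).

Definition C_2 x delta : R :=
  Num.max (sup [set specnorm (hess (J 0) x') | x' in eball x delta])
          (sup [set specnorm (hess (J 1) x') | x' in eball x delta]).

Section Curve.
Variables (x : R -> 'cV[R]_n) (I : set R).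

Definition LambdaI : R := inf [set Lambda t (x t) | t in I].

Definition L_HI delta : R := sup [set L_H (x t) delta | t in I].

Definition C_1I delta : R := sup [set C_1 (x t) delta | t in I].

Definition C_2I delta : R := sup [set C_2 (x t) delta | t in I].

(* 0 < delta < LambdaI / L_HI delta, the quotient being +oo if L_HI delta = 0;
   note that L_HI depends on delta. *)
Definition admissible_radius delta : Prop :=
  0 < delta /\ (L_HI delta != 0 -> delta < LambdaI / L_HI delta).

Definition L_f delta : R :=
  2 * (C_2I delta / (LambdaI - delta * L_HI delta)
       + (LambdaI - delta * L_HI delta)^-1 ^+ 2 * L_HI delta * C_1I delta).

Definition tube delta : set 'cV[R]_n :=
  \bigcup_(t in I) eball (x t) delta.

Definition rhs_error (g : R * 'cV[R]_n -> 'cV[R]_n) delta : \bar R :=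
  ereal_sup [set (enorm (g p - rhs p))%:E | p in
    [set p | [/\ I p.1, closure (tube delta) p.2 & rhs_dom p]]].

End Curve.
End Biobjective.

(* Main.v *)
(* The equation x' = f (lambda, x) makes the gradient of J_lambda constant along
   x; hence solutions starting near a critical point stay nearly critical, and
   x(lambda) stays a strict local minimum as long as the Hessian is positive
   definite.  On the delta-tube around the curve the smallest eigenvalue is at
   least Lambda(I) - delta L_H, which yields
   |f (lambda, y) - f (lambda, x(lambda))| <= L_f |y - x(lambda)|.  Gronwall's
   inequality then confines a solution of a perturbed equation to the tube and
   bounds its distance to x.  Solutions in the tube are obtained by Picard
   iteration, from a vector field modified outside of the tube; the maximal
   solution is the union of all solutions. *)

Require Import Defs.
From HB Require Import structures.
From mathcomp Require Import all_boot all_order all_algebra.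
From mathcomp Require Import all_classical all_reals all_analysis.
From mathcomp Require Import ring lra.
Import Order.TTheory GRing.Theory Num.Theory.
Import numFieldNormedType.Exports.
Local Open Scope classical_set_scope.
Local Open Scope ring_scope.

(** * Euclidean and spectral norms *)

Section EuclideanTheory.
Set Implicit Arguments.
Unset Strict Implicit.
Context {R : realType} {n : nat}.
Implicit Types (u v w : 'cV[R]_n) (A B : 'M[R]_n).

(** Two norms run through the proof. Limits, compactness and Picard iteration use the maximum norm,
    whose balls are boxes with a nonexpansive coordinatewise projection; the stated estimates are
    Euclidean. Since [enorm u] is at most n times the maximum norm of [u], a maximum-norm tube of
    radius r with n r < delta lies in the Euclidean delta-tube.

    Two Lipschitz estimates of f are kept apart. [L_f] compares f at a point only with f at the
    centre x(lambda) for the same lambda, which is all that Gronwall's inequality asks for; its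
    factor 2 comes from estimating the two gradients separately. Picard iteration compares arbitrary
    points of the tube, also at different lambda, but there any constant will do.

    A maximal interval is open up to [lambda_0], so covering the compact I requires nearby solutions
    on a slightly larger interval. Finally, Gronwall's inequality is used between any two times, in
    both directions: going back to [lambda_0] bounds the distance from below, which turns
    convergence into convergence with the same rate. *)

Lemma dotvC u v : dotv u v = dotv v u.
Proof. by apply: eq_bigr => i _; rewrite mulrC. Qed.

Lemma dotvDl u v w : dotv (u + v) w = dotv u w + dotv v w.
Proof. by rewrite -big_split/=; apply: eq_bigr => i _; rewrite !mxE mulrDl. Qed.

Lemma dotvZl (c : R) u v : dotv (c *: u) v = c * dotv u v.
Proof. by rewrite mulr_sumr; apply: eq_bigr => i _; rewrite !mxE mulrA. Qed.

Lemma dotvDr u v w : dotv u (v + w) = dotv u v + dotv u w.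
Proof. by rewrite dotvC dotvDl !(dotvC u). Qed.

Lemma dotvZr (c : R) u v : dotv u (c *: v) = c * dotv u v.
Proof. by rewrite dotvC dotvZl dotvC. Qed.

Lemma dotvNl u v : dotv (- u) v = - dotv u v.
Proof. by rewrite -scaleN1r dotvZl mulN1r. Qed.

Lemma dotvNr u v : dotv u (- v) = - dotv u v.
Proof. by rewrite -scaleN1r dotvZr mulN1r. Qed.

Lemma dotv0l u : dotv 0 u = 0.
Proof. by rewrite -(scale0r 0) dotvZl mul0r. Qed.

Lemma dotv_ge0 u : 0 <= dotv u u.
Proof. by apply: sumr_ge0 => i _; rewrite -expr2 sqr_ge0. Qed.

Lemma dotv_mulmx A u v : dotv u (A *m v) = dotv (A^T *m u) v.
Proof.
rewrite /dotv; under eq_bigr do rewrite mxE mulr_sumr.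
rewrite exchange_big; apply: eq_bigr => j _ /=.
by rewrite !mxE mulr_suml; apply: eq_bigr => i _; rewrite mxE mulrAC mulrA [RHS]mulrC mulrA mulrAC.
Qed.

Lemma enorm_ge0 u : 0 <= enorm u.
Proof. exact: sqrtr_ge0. Qed.

Lemma enorm_sqr u : enorm u ^+ 2 = dotv u u.
Proof. by rewrite sqr_sqrtr ?dotv_ge0. Qed.

Lemma enormN u : enorm (- u) = enorm u.
Proof. by rewrite /enorm dotvNl dotvNr opprK. Qed.

Lemma enorm_distC u v : enorm (u - v) = enorm (v - u).
Proof. by rewrite -enormN opprB. Qed.

Lemma enormZ (c : R) u : enorm (c *: u) = `|c| * enorm u.
Proof. by rewrite /enorm dotvZl dotvZr mulrA -expr2 sqrtrM ?sqr_ge0// sqrtr_sqr. Qed.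

Lemma enorm0 : enorm (0 : 'cV[R]_n) = 0.
Proof. by rewrite /enorm dotv0l sqrtr0. Qed.

Lemma coord_le_enorm u i : `|u i 0| <= enorm u.
Proof.
rewrite -sqrtr_sqr ler_wsqrtr// /dotv (bigD1 i)//= -expr2 lerDl.
by apply: sumr_ge0 => j _; rewrite -expr2 sqr_ge0.
Qed.

Lemma enorm_eq0 u : (enorm u == 0) = (u == 0).
Proof.
apply/eqP/eqP => [u0|->]; last exact: enorm0.
by apply/colP => i; apply/eqP; rewrite mxE -normr_le0 -u0 coord_le_enorm.
Qed.

Lemma enorm_gt0 u : (0 < enorm u) = (u != 0).
Proof. by rewrite lt_def enorm_eq0 enorm_ge0 andbT. Qed.

(** The square of the norm of |v| u - |u| v is 2 |u| |v| (|u| |v| - <u, v>). *)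
Lemma dotv_CS u v : dotv u v <= enorm u * enorm v.
Proof.
have [->|v0] := eqVneq v 0; first by rewrite dotvC dotv0l enorm0 mulr0.
have [->|u0] := eqVneq u 0; first by rewrite dotv0l enorm0 mul0r.
rewrite -enorm_gt0 in v0; rewrite -enorm_gt0 in u0.
have /= := dotv_ge0 (enorm v *: u - enorm u *: v).
rewrite dotvDl !dotvDr !dotvNl !dotvNr !dotvZl !dotvZr -!enorm_sqr (dotvC v u) => H.
rewrite -(ler_pM2l (mulr_gt0 u0 v0)); move: H.
by move: (enorm u) (enorm v) u0 v0 => p q p0 q0 ?; nra.
Qed.

Lemma enormD u v : enorm (u + v) <= enorm u + enorm v.
Proof.
rewrite -(@ler_pXn2r _ 2)// ?nnegrE ?addr_ge0 ?enorm_ge0//.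
rewrite enorm_sqr dotvDl !dotvDr -!enorm_sqr (dotvC v u) sqrrD.
by have := dotv_CS u v; nra.
Qed.

Lemma enormB u v : enorm (u - v) <= enorm u + enorm v.
Proof. by rewrite -(enormN v) enormD. Qed.

Lemma enorm_distD w u v : enorm (u - v) <= enorm (u - w) + enorm (w - v).
Proof. by rewrite (le_trans _ (enormD _ _))// addrA subrK. Qed.

Lemma mx_norm_le m p (A : 'M[R]_(m, p)) (c : R) : 0 <= c ->
  (forall i j, `|A i j| <= c) -> `|A| <= c.
Proof.
move=> c0 Ac; rewrite [`|A|]mx_normrE; apply/bigmax_leP; split=> // -[i j] _ /=.
Qed.

Lemma coord_le_mx_norm m p (A : 'M[R]_(m, p)) i j : `|A i j| <= `|A|.
Proof. by rewrite [`|A|]mx_normrE; apply/(le_trans _ (le_bigmax _ _ (i, j))). Qed.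

Lemma norm_le_enorm u : `|u| <= enorm u.
Proof.
by apply: mx_norm_le => [|i j]; rewrite ?enorm_ge0// ord1 coord_le_enorm.
Qed.

Lemma enorm_le_norm u : enorm u <= n%:R * `|u|.
Proof.
rewrite -(@ler_pXn2r _ 2)// ?nnegrE ?mulr_ge0 ?enorm_ge0//.
rewrite enorm_sqr (@le_trans _ _ (\sum_(i < n) `|u| ^+ 2))//.
  apply: ler_sum => i _; rewrite -expr2 -real_normK ?num_real// ler_pXn2r ?nnegrE//.
  exact: coord_le_mx_norm.
rewrite sumr_const card_ord exprMn -[leLHS]mulr_natl ler_wpM2r ?sqr_ge0//.
case: (n) => [|m]; first by rewrite expr0n.
by rewrite expr2 ler_peMr// ler1n.
Qed.

Lemma ler_dist_enorm u v : `|enorm u - enorm v| <= enorm (u - v).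
Proof.
rewrite ler_norml; have := enormD (u - v) v; have := enormD (v - u) u.
by rewrite !subrK (enorm_distC v u) => ? ?; lra.
Qed.

Lemma enorm_continuous : continuous (@enorm R n).
Proof.
move=> u; apply/(@cvgrPdist_lt _ _ _ (nbhs u)) => e e0.
(* [n.+1] in place of [n] keeps the radius meaningful in dimension 0. *)
apply/(@nbhs_normP _ _ u); exists (e / n.+1%:R) => [|v uv] /=; first by rewrite divr_gt0.
rewrite (le_lt_trans (ler_dist_enorm _ _))// (le_lt_trans (enorm_le_norm _))//.
rewrite (@le_lt_trans _ _ (n.+1%:R * `|u - v|))//.
  by rewrite ler_wpM2r// ler_nat.
by rewrite mulrC -ltr_pdivlMr.
Qed.

(** Crude, but it shows that the supremum defining [specnorm] is finite, and later it transfers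
    continuity of Hessians to the spectral norm. *)
Lemma enorm_mulmx_ub A u : enorm (A *m u) <= n%:R * (n%:R * `|A|) * enorm u.
Proof.
rewrite (le_trans (enorm_le_norm _))// -mulrA ler_wpM2l//.
apply: mx_norm_le => [|i j]; first by rewrite !mulr_ge0 ?enorm_ge0.
rewrite mxE (le_trans (ler_norm_sum _ _ _))//.
rewrite (@le_trans _ _ (\sum_(k < n) `|A| * enorm u))//.
  apply: ler_sum => k _; rewrite normrM ler_pM// ?coord_le_mx_norm//.
  by rewrite ord1 coord_le_enorm.
by rewrite sumr_const card_ord -[leLHS]mulr_natl mulrA.
Qed.

Let specset A : set R := [set enorm (A *m v) | v in [set v | enorm v <= 1]].

Let specset_has_sup A : has_sup (specset A).
Proof.
split; first by exists (enorm (A *m 0)); exists 0 => //=; rewrite enorm0.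
exists (n%:R * (n%:R * `|A|)) => _ [v /= v1 <-].
rewrite (le_trans (enorm_mulmx_ub _ _))// ler_piMr// !mulr_ge0.
Qed.

Lemma enorm_mulmx A u : enorm (A *m u) <= specnorm A * enorm u.
Proof.
have [->|u0] := eqVneq u 0; first by rewrite mulmx0 !enorm0 mulr0.
rewrite -enorm_gt0 in u0.
rewrite -ler_pdivrMr// mulrC -(ger0_norm (enorm_ge0 u)) -normfV.
rewrite -enormZ scalemxAr; apply: ub_le_sup; first by have [] := specset_has_sup A.
by exists ((enorm u)^-1 *: u) => //=; rewrite enormZ normfV ger0_norm ?enorm_ge0// mulVf ?gt_eqF.
Qed.

Lemma specnorm_le A (c : R) : 0 <= c ->
  (forall u, enorm (A *m u) <= c * enorm u) -> specnorm A <= c.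
Proof.
move=> c0 Ac; apply: ge_sup; first by have [] := specset_has_sup A.
by move=> _ [v /= v1 <-]; rewrite (le_trans (Ac v))// ler_piMr.
Qed.

Lemma specnorm_ge0 A : 0 <= specnorm A.
Proof.
rewrite (@le_trans _ _ (enorm (A *m 0)))// ?enorm_ge0//.
apply: ub_le_sup; first by have [] := specset_has_sup A.
by exists 0 => //=; rewrite enorm0.
Qed.

Lemma specnorm_le_norm A : specnorm A <= n%:R * (n%:R * `|A|).
Proof. by apply: specnorm_le => [|u]; rewrite ?mulr_ge0 ?enorm_mulmx_ub. Qed.

Lemma specnormD A B : specnorm (A + B) <= specnorm A + specnorm B.
Proof.
apply: specnorm_le => [|u]; first by rewrite addr_ge0 ?specnorm_ge0.
by rewrite mulmxDl (le_trans (enormD _ _))// mulrDl lerD ?enorm_mulmx.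
Qed.

Lemma specnormZ (c : R) A : specnorm (c *: A) <= `|c| * specnorm A.
Proof.
apply: specnorm_le => [|u]; first by rewrite mulr_ge0 ?specnorm_ge0.
by rewrite -scalemxAl enormZ -mulrA ler_wpM2l ?enorm_mulmx.
Qed.

Lemma specnormN A : specnorm (- A) = specnorm A.
Proof.
by apply/eqP; rewrite eq_le; apply/andP; split; apply: specnorm_le => [|u];
  rewrite ?specnorm_ge0// ?mulNmx ?enormN ?enorm_mulmx// -enormN -mulNmx enorm_mulmx.
Qed.

End EuclideanTheory.

(** * Matrix-valued limits and the Rayleigh quotient *)

Section MatrixTopology.
Set Implicit Arguments.
Unset Strict Implicit.
Context {R : realType}.

Lemma lip_continuous (V W : normedModType R) (f : V -> W) (k : R) :
  (forall u v, `|f u - f v| <= k * `|u - v|) -> continuous f.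
Proof.
move=> fk u; apply/cvgrPdist_lt => e e0; apply/nbhs_normP.
exists (e / (`|k| + 1)) => [|v uv] /=; first by rewrite divr_gt0// ltr_wpDl.
rewrite (le_lt_trans (fk _ _))// (@le_lt_trans _ _ ((`|k| + 1) * `|u - v|))//.
  by rewrite ler_wpM2r// (le_trans (ler_norm _))// lerDl.
by rewrite mulrC -ltr_pdivlMr// ltr_wpDl.
Qed.

Lemma cvg_mxP (T : Type) (F : set_system T) (FF : Filter F) m p
    (f : T -> 'M[R]_(m, p)) (l : 'M[R]_(m, p)) :
  (forall i j, f t i j @[t --> F] --> l i j) -> f @ F --> l.
Proof.
move=> fl; apply/(@cvgrPdist_le _ _ _ (f @ F)) => e e0.
have H (k : 'I_m * 'I_p) : \forall t \near F, `|l k.1 k.2 - f t k.1 k.2| <= e.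
  by have /cvgrPdist_le := fl k.1 k.2; apply.
have /= := @filter_forall _ _ _ _ FF H; apply: filterS => t Ht.
by apply: mx_norm_le => [|i j]; [exact: ltW|rewrite !mxE; exact: (Ht (i, j))].
Qed.

Lemma cvg_coord (T : Type) (F : set_system T) (FF : Filter F) m p
    (f : T -> 'M[R]_(m, p)) (l : 'M[R]_(m, p)) i j :
  f @ F --> l -> f t i j @[t --> F] --> l i j.
Proof.
move=> fl; apply: (@cvg_comp _ _ _ f (fun M : 'M[R]_(m, p) => M i j) _ _ _ fl).
exact: coord_continuous.
Qed.

Lemma cvg_mulmx (T : Type) (F : set_system T) (FF : Filter F) m p q
    (f : T -> 'M[R]_(m, p)) (g : T -> 'M[R]_(p, q)) (A : 'M[R]_(m, p)) (B : 'M[R]_(p, q)) :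
  f @ F --> A -> g @ F --> B -> f t *m g t @[t --> F] --> A *m B.
Proof.
move=> fA gB; apply: cvg_mxP => i j; rewrite mxE.
under eq_cvg do rewrite mxE.
apply: cvg_big => [x|k _]; first exact: add_continuous.
 apply: cvgM; exact: cvg_coord.
Qed.

Lemma cvg_dotv (T : Type) (F : set_system T) (FF : Filter F) n
    (f g : T -> 'cV[R]_n) (u v : 'cV[R]_n) :
  f @ F --> u -> g @ F --> v -> dotv (f t) (g t) @[t --> F] --> dotv u v.
Proof.
move=> fu gv; apply: cvg_big => [x|k _]; first exact: add_continuous.
 apply: cvgM; exact: cvg_coord.
Qed.

(** Heine-Borel for row vectors, carried over to columns by transposition, an isometry for the
    maximum norm. *)
Lemma cV_compact n (A : set 'cV[R]_n) (c : R) :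
  (forall v, A v -> `|v| <= c) -> closed A -> compact A.
Proof.
move=> Ac clA.
have trN p q (v : 'M[R]_(p, q)) : `|v^T| = `|v|.
  have le p' q' (v' : 'M[R]_(p', q')) : `|v'^T| <= `|v'|.
    by apply: mx_norm_le => // i j; rewrite mxE coord_le_mx_norm.
  by apply/eqP; rewrite eq_le le/=; have := le _ _ v^T; rewrite trmxK.
have trC p q : continuous (@trmx R p q).
  apply: (@lip_continuous 'M[R]_(p, q) 'M[R]_(q, p) _ 1) => u v.
  by rewrite mul1r -linearB/= trN.
have -> : A = trmx @` (trmx @^-1` A : set 'rV[R]_n).
  apply/seteqP; split=> [v Av|_ [v Av <-]//].
  by exists v^T; rewrite /= ?trmxK.
apply: continuous_compact; first exact/continuous_subspaceT/trC.
apply: bounded_closed_compact.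
  exists c; split=> [|M cM v Av]; first exact: num_real.
  by have := Ac _ Av; rewrite trN => /le_trans; apply; exact: ltW.
by apply: closed_comp => // v _; exact: trC.
Qed.

Lemma closed_norm_le (V : normedModType R) (u : V) (r : R) :
  closed [set v | `|v - u| <= r].
Proof.
have -> : [set v | `|v - u| <= r] = (fun v : V => `|v - u|) @^-1` [set x | x <= r] by [].
apply: closed_comp; last exact: closed_le.
move=> v _; apply: cvg_norm; apply: cvgB; [exact: cvg_id|exact: cvg_cst].
Qed.

Lemma cV_closed_ball_compact n (u : 'cV[R]_n) (r : R) :
  compact [set v : 'cV[R]_n | `|v - u| <= r].
Proof.
apply: (@cV_compact _ _ (r + `|u|)); last exact: closed_norm_le.
by move=> v /= vu; rewrite -(subrK u v) (le_trans (ler_normD _ _))// lerD2r.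
Qed.

End MatrixTopology.

(** * The smallest eigenvalue of a symmetric matrix *)

Section Rayleigh.
Set Implicit Arguments.
Unset Strict Implicit.
Context {R : realType} {n : nat}.
Implicit Types (A : 'M[R]_n) (u v : 'cV[R]_n).

(** [v] minimises the nonnegative form u -> <u, A u>, so its gradient 2 A v vanishes. The proof
    tests the form at v + s A v for a small negative s. *)
Lemma psd_kernel A v : A^T = A -> (forall u, 0 <= dotv u (A *m u)) ->
  dotv v (A *m v) = 0 -> A *m v = 0.
Proof.
move=> At Apsd v0; apply/eqP; rewrite -enorm_eq0 -sqrf_eq0 enorm_sqr.
set w := A *m v; set q := dotv w (A *m w).
have q0 : 0 <= q by exact: Apsd.
have H s : 0 <= 2 * s * dotv w w + s ^+ 2 * q.
  have := Apsd (v + s *: w).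
  rewrite mulmxDr -scalemxAr dotvDl !dotvDr v0 !dotvZl !dotvZr -/w -/q.
  rewrite (dotv_mulmx A v w) At -/w; lra.
have d0 := dotv_ge0 w; apply/eqP; move: (dotv w w) d0 H => d d0 H.
(* The denominator is [q + 1] because [q] may be 0. With r = 1 / (q + 1) the value of the form is -
   d^2 r (1 + r), which forces d = 0. *)
have := H (- d / (q + 1)).
have q1 : 0 < (q + 1)^-1 by rewrite invr_gt0 ltr_wpDl.
have qq : q * (q + 1)^-1 = 1 - (q + 1)^-1.
  by field; rewrite gt_eqF// ltr_wpDl.
set r := (q + 1)^-1 in q1 qq *.
have -> : 2 * (- d * r) * d + (- d * r) ^+ 2 * q = - (d ^+ 2 * r * (2 - q * r)) by ring.
rewrite qq oppr_ge0 => h.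
have d2 : d ^+ 2 * (r * (1 + r)) <= 0 by move: h; congr (_ <= _); ring.
have : d ^+ 2 <= 0 by rewrite -(pmulr_lle0 _ (mulr_gt0 q1 (addr_gt0 ltr01 q1))) mulrC; move: d2; rewrite mulrC.
by rewrite real_exprn_even_le0 ?num_real//= => /eqP.
Qed.

(** A minimiser v of the form on the unit sphere, with minimum a, makes A - a positive semidefinite
    with <v, (A - a) v> = 0; by [psd_kernel] it is an eigenvector. *)
Lemma rayleigh_min A : A^T = A -> (0 < n)%N ->
  exists2 a, eigenvalue A a & forall v, a * dotv v v <= dotv v (A *m v).
Proof.
move=> At n0.
pose S := [set v : 'cV[R]_n | enorm v = 1].
have S0 : S !=set0.
  exists (delta_mx (Ordinal n0) 0); rewrite /S/= /enorm /dotv.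
  rewrite (bigD1 (Ordinal n0))//= big1 => [|i ine].
    by rewrite !mxE !eqxx mulr1 addr0 sqrtr1.
  by rewrite !mxE (negPf ine)/= mul0r.
have Sc : compact S.
  apply: (@cV_compact _ _ _ 1) => [v <-|]; first exact: norm_le_enorm.
  have -> : S = @enorm R n @^-1` [set 1] by [].
  by apply: closed_comp => [v _|]; [exact: enorm_continuous|exact: closed_eq].
pose q v := dotv v (A *m v).
have qc : continuous q.
  move=> v; apply: (@cvg_dotv _ _ _ (nbhs_filter v)); first exact: cvg_id.
  by apply: (@cvg_mulmx _ _ _ (nbhs_filter v)); [exact: cvg_cst|exact: cvg_id].
have [v vS vmin] := compact_EVT_min S0 Sc (continuous_subspaceT qc).
rewrite inE /S/= in vS.
have qZ (c : R) u : q (c *: u) = c ^+ 2 * q u.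
  by rewrite /q -scalemxAr dotvZl dotvZr mulrA.
have Ray u : q v * dotv u u <= q u.
  have [->|u0] := eqVneq u 0; first by rewrite dotv0l mulr0 /q dotv0l.
  rewrite -enorm_gt0 in u0; rewrite -enorm_sqr.
  have : q v <= q ((enorm u)^-1 *: u).
    by apply: vmin; rewrite inE /S/= enormZ normfV ger0_norm ?enorm_ge0// mulVf ?gt_eqF.
  by rewrite qZ exprVn mulrC ler_pdivlMr ?exprn_gt0.
exists (q v) => //.
have Bt : (A - (q v)%:M)^T = A - (q v)%:M by rewrite linearB/= tr_scalar_mx At.
have Bq u : dotv u ((A - (q v)%:M) *m u) = q u - q v * dotv u u.
  by rewrite mulmxBl mul_scalar_mx dotvDr dotvNr dotvZr.
have : (A - (q v)%:M) *m v = 0.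
  apply: psd_kernel Bt _ _ => [u|]; first by rewrite Bq subr_ge0.
  by rewrite Bq -enorm_sqr vS expr1n mulr1 subrr.
move=> /(congr1 trmx); rewrite trmx_mul Bt trmx0 mulmxBr mul_mx_scalar => /eqP.
rewrite subr_eq0 => /eqP vA; apply/eigenvalueP; exists v^T => //.
rewrite -trmx0 (inj_eq trmx_inj) -enorm_eq0 vS; exact: oner_neq0.
Qed.

(** From here on the smallest eigenvalue is handled through lower bounds of the quadratic form,
    which behave well under perturbation. *)
Lemma min_eigenvalueP A : A^T = A -> (0 < n)%N -> forall c,
  (c <= min_eigenvalue A) <-> (forall v, c * dotv v v <= dotv v (A *m v)).
Proof.
move=> At n0 c.
(* [eigenvalue] speaks of row vectors multiplied from the left; symmetry turns them into columns. *)
have eigE a : eigenvalue A a -> exists2 v : 'cV[R]_n, v != 0 & A *m v = a *: v.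
  move=> /eigenvalueP[u uA u0]; exists u^T; first by rewrite -trmx0 (inj_eq trmx_inj).
  by rewrite -{1}At -trmx_mul uA linearZ.
have eig_ge a d : (forall v, d * dotv v v <= dotv v (A *m v)) -> eigenvalue A a -> d <= a.
  move=> dA /eigE[v v0 Av]; have := dA v; rewrite Av dotvZr ler_pM2r//.
  by rewrite -enorm_sqr exprn_gt0// enorm_gt0.
have [a aA aR] := rayleigh_min At n0.
have -> : min_eigenvalue A = a.
  apply/eqP; rewrite eq_le; apply/andP; split.
    by apply: ge_inf => //; exists a => b; exact: eig_ge.
  by apply: lb_le_inf; [exists a|move=> b; exact: eig_ge].
split=> [ca v|H]; last exact: eig_ge H aA.
by rewrite (le_trans _ (aR v))// ler_wpM2r// dotv_ge0.
Qed.

Lemma enorm_mulmx_ge A c v : (forall v, c * dotv v v <= dotv v (A *m v)) ->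
  c * enorm v <= enorm (A *m v).
Proof.
move=> cA; have [->|v0] := eqVneq v 0; first by rewrite mulmx0 !enorm0 mulr0.
rewrite -enorm_gt0 in v0; rewrite -(ler_pM2l v0) (le_trans _ (dotv_CS _ _))//.
by rewrite (le_trans _ (cA v))// -enorm_sqr expr2 mulrCA mulrA.
Qed.

Lemma coercive_unitmx A c : 0 < c -> (forall v, c * dotv v v <= dotv v (A *m v)) ->
  A \in unitmx.
Proof.
move=> c0 cA; rewrite -unitmx_tr -row_free_unit -kermx_eq0; apply/eqP/row_matrixP => i.
rewrite row0; set r := row i _.
have rA : r *m A^T = 0 by apply/sub_kermxP; exact: row_sub.
have Ar : A *m r^T = 0 by rewrite -[A]trmxK -trmx_mul rA trmx0.
have := enorm_mulmx_ge r^T cA; rewrite Ar enorm0 pmulr_rle0// => r0.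
apply: trmx_inj; rewrite trmx0; apply/eqP; rewrite -enorm_eq0 eq_le r0.
exact: enorm_ge0.
Qed.

Lemma posdefP A : A^T = A -> (0 < n)%N -> posdef A <-> 0 < min_eigenvalue A.
Proof.
move=> At n0; split=> [pA|m0 v v0].
  have [a aA aR] := rayleigh_min At n0.
  have /eigenvalueP[u uA u0] := aA.
  apply: (@lt_le_trans _ _ a); last by apply/(min_eigenvalueP At n0).
  have v0 : u^T != 0 by rewrite -trmx0 (inj_eq trmx_inj).
  have := pA _ v0; rewrite -{1}At -trmx_mul uA linearZ/= dotvZr pmulr_lgt0//.
  by rewrite -enorm_sqr exprn_gt0// enorm_gt0.
have /(min_eigenvalueP At n0) := lexx (min_eigenvalue A).
move=> /(_ v); apply: lt_le_trans.
by rewrite mulr_gt0// -enorm_sqr exprn_gt0// enorm_gt0.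
Qed.

End Rayleigh.

(** * Gronwall inequality *)

Section Curves.
Set Implicit Arguments.
Unset Strict Implicit.
Context {R : realType}.

Lemma is_deriveP (V : normedModType R) (w : R -> V) (t : R) (d : V) :
  is_derive t 1 w d <-> (h^-1 *: (w (h + t) - w t) @[h --> 0^'] --> d).
Proof.
have E : (fun h => h^-1 *: ((w \o shift t) (h *: 1) - w t)) =
    (fun h => h^-1 *: (w (h + t) - w t)).
  by apply/funext => h; rewrite /= [h *: 1]mulr1.
split=> [[dw <-]|wd]; first by rewrite -E; exact: dw.
split; first by rewrite /derivable E; apply/cvg_ex; exists d.
by rewrite /derive E; apply/cvg_lim.
Qed.

Lemma is_derive_coord m p (w : R -> 'M[R]_(m, p)) (t : R) (d : 'M[R]_(m, p)) i j :
  is_derive t 1 w d -> is_derive t 1 (fun s => w s i j) (d i j).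
Proof.
move=> /is_deriveP wd; apply/is_deriveP.
have := @cvg_coord R _ _ (dnbhs_filter _) _ _ _ _ i j wd.
by apply: cvg_trans; apply: near_eq_cvg; near=> h; rewrite !mxE.
Unshelve. all: by end_near. Qed.

Lemma is_derive_mx m p (w : R -> 'M[R]_(m, p)) (t : R) (d : 'M[R]_(m, p)) :
  (forall i j, is_derive t 1 (fun s => w s i j) (d i j)) -> is_derive t 1 w d.
Proof.
move=> wd; apply/is_deriveP; apply: cvg_mxP => i j.
have /is_deriveP := wd i j.
by apply: cvg_trans; apply: near_eq_cvg; near=> h; rewrite !mxE.
Unshelve. all: by end_near. Qed.

Lemma is_derive_dotv n (v w : R -> 'cV[R]_n) (t : R) (dv dw : 'cV[R]_n) :
  is_derive t 1 v dv -> is_derive t 1 w dw ->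
  is_derive t 1 (fun s => dotv (v s) (w s)) (dotv (v t) dw + dotv dv (w t)).
Proof.
move=> hv hw.
have -> : (fun s => dotv (v s) (w s)) =
    \sum_(i < n) ((fun s => v s i 0) * (fun s => w s i 0)).
  by apply/funext => s; rewrite fct_sumE.
have H i : is_derive t 1 ((fun s => v s i 0) * (fun s => w s i 0))
    (v t i 0 * dw i 0 + dv i 0 * w t i 0).
  have := is_derive_coord i 0 hv; have := is_derive_coord i 0 hw => ? ?.
  by apply: is_derive_eq; rewrite ![_ *: _]mulrC; congr (_ + _); rewrite mulrC.
apply: is_derive_eq; rewrite -big_split/=; apply: eq_bigr => i _.
by [].
Qed.

(** Continuity on the subspace [D] in pointwise form, as it comes out of the relative difference
    quotients in [ode_solution]. *)
Definition wcont (V : normedModType R) (D : set R) (w : R -> V) :=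
  forall t, D t -> w s @[s --> within D (nbhs t)] --> w t.

Lemma wcontP (V : normedModType R) (D : set R) (w : R -> V) :
  wcont D w <-> {within D, continuous w}.
Proof.
by split=> ?; exact/subspace_continuousP.
Qed.

Lemma wcont_sub (V : normedModType R) (D D' : set R) (w : R -> V) :
  D' `<=` D -> wcont D w -> wcont D' w.
Proof.
move=> sub wc t Dt; apply: cvg_trans (wc t (sub _ Dt)).
apply: cvg_app => A DA; apply: (@filterS _ _ (nbhs_filter t) _ _ _ DA) => s + /sub.
by apply.
Qed.

Lemma wcont_comp (V W : normedModType R) (D : set R) (w : R -> V) (f : V -> W) :
  wcont D w -> continuous f -> wcont D (f \o w).
Proof. by move=> wc fc t Dt; apply: cvg_comp (wc t Dt) (fc _). Qed.

(** Derivatives are taken in the open interval only, so that solutions with one-sided derivatives at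
    the endpoints are covered. *)
Lemma nonincreasing_itv (f f' : R -> R) (a b : R) : a <= b ->
  wcont `[a, b] f -> (forall t, a < t < b -> is_derive t 1 f (f' t)) ->
  (forall t, a < t < b -> f' t <= 0) -> f b <= f a.
Proof.
move=> ab /wcontP fc fd f0.
have [->//|ab'] := eqVneq a b.
have fd' t : t \in `]a, b[%R -> is_derive t 1 f (f' t) by rewrite in_itv; exact: fd.
have ltab : a < b by rewrite lt_neqAle ab'.
have [d dab H] := MVT ltab fd' fc.
rewrite in_itv/= in dab; rewrite -subr_le0 H.
by rewrite mulr_le0_ge0 ?subr_ge0// f0.
Qed.

End Curves.

Section Gronwall.
Set Implicit Arguments.
Unset Strict Implicit.
Context {R : realType} {n : nat}.
Implicit Types (w : R -> 'cV[R]_n) (L eta : R).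

(** The value at time [d] of the solution of u' = L u + eta, u(0) = c. *)
Definition gbound L eta (c d : R) : R :=
  c * expR (L * d) + (expR (L * d) - 1) / L * eta.

Lemma gbound_le L eta c d d' : 0 < L -> 0 <= eta -> 0 <= c -> d <= d' ->
  gbound L eta c d <= gbound L eta c d'.
Proof.
move=> L0 eta0 c0 dd'; have e : expR (L * d) <= expR (L * d') by rewrite ler_expR ler_pM2l.
by rewrite lerD ?ler_wpM2l// ler_wpM2r// ler_pM2r ?invr_gt0// lerB.
Qed.

(* [enorm] is replaced by the differentiable [u := sqrt (|w|^2 + e^2)], which
   satisfies u' <= L u + eta; then (u + eta / L) exp (- L t) does not increase. *)
Let gronwall_fwd w w' L eta (a b : R) : a <= b -> 0 < L -> 0 <= eta ->
  wcont `[a, b] w -> (forall t, a < t < b -> is_derive t 1 w (w' t)) ->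
  (forall t, a < t < b -> enorm (w' t) <= L * enorm (w t) + eta) ->
  enorm (w b) <= gbound L eta (enorm (w a)) (b - a).
Proof.
move=> ab L0 eta0 wc wd wle; apply/ler_addgt0Pr => _ /posnumP[e0].
(* Scaled so that replacing [enorm] by its regularisation costs [e0] at time [b]. *)
set e := e0%:num / expR (L * (b - a)).
have epos : 0 < e by rewrite divr_gt0 ?expR_gt0.
pose p t := dotv (w t) (w t) + e ^+ 2.
have p0 t : 0 < p t by rewrite ltr_wpDl ?dotv_ge0// exprn_gt0.
pose u t := Num.sqrt (p t).
have u0 t : 0 < u t by rewrite sqrtr_gt0.
have wu t : enorm (w t) <= u t by rewrite ler_wsqrtr// lerDl sqr_ge0.
pose f t := (u t + eta / L) * expR (- L * t).
pose u' t := (u t)^-1 * dotv (w t) (w' t).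
pose f' t := (u' t - L * (u t + eta / L)) * expR (- L * t).
have ud t : a < t < b -> is_derive t 1 u (u' t).
  move=> tab; have hd := is_derive_dotv (wd _ tab) (wd _ tab).
  have pd : is_derive t 1 p (2 * dotv (w t) (w' t)).
    by apply: is_derive_eq; rewrite addr0 (dotvC (w' t)); lra.
  have sd := is_derive1_sqrt (p0 t).
  rewrite /u (_ : (fun s => _) = Num.sqrt \o p)//.
  have := is_derive1_comp sd pd; move=> ?; apply: is_derive_eq; rewrite /u' /u.
  have h : Num.sqrt (p t) != 0 by rewrite gt_eqF// u0.
  by field.
have : f b <= f a.
  apply: (@nonincreasing_itv _ f f') => //.
  - move=> t tab; apply: cvgM.
      apply: cvgD; last exact: cvg_cst.
      apply: cvg_comp; last exact: sqrt_continuous.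
      apply: cvgD; last exact: cvg_cst.
      by apply: cvg_dotv; exact: wc.
    apply: cvg_comp; last exact: continuous_expR.
    apply: cvgM; first exact: cvg_cst.
    exact: cvg_within_filter.
  - move=> t tab; have := ud _ tab => ?.
    have ed : is_derive t 1 (fun s => expR (- L * s)) (- L * expR (- L * t)).
      have md : is_derive t 1 (fun s => - L * s) (- L).
        by apply: is_derive_eq; rewrite [_ *: _]mulr1.
      rewrite (_ : (fun s => _) = expR \o (fun s => - L * s))//.
      have := is_derive1_comp (is_derive_expR (- L * t)) md => ?.
      by apply: is_derive_eq; rewrite mulrC.
    rewrite (_ : f = (u + cst (eta / L)) * (fun s => expR (- L * s)))//.
    by apply: is_derive_eq; rewrite /f' /= /GRing.scale/= !fctE; ring.
  move=> t tab; rewrite /f' pmulr_lle0 ?expR_gt0// subr_le0.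
  rewrite mulrDr [L * (_ / _)]mulrCA divff ?gt_eqF// mulr1.
  rewrite /u' mulrC ler_pdivrMr// (le_trans (dotv_CS _ _))//.
  rewrite mulrC ler_pM ?enorm_ge0//.
  by rewrite (le_trans (wle _ tab))// lerD2r ler_pM2l.
rewrite /f -ler_pdivlMr ?expR_gt0// -mulrA -expRN -expRD.
rewrite (_ : - L * a - (- L * b) = L * (b - a)); last by ring.
rewrite -lerBrDr => h; rewrite (le_trans (wu b))// (le_trans h)// /gbound.
have ua : u a <= enorm (w a) + e.
  rewrite -(@ler_pXn2r _ 2)// ?nnegrE ?addr_ge0 ?enorm_ge0 ?(ltW epos) ?(ltW (u0 a))//.
  rewrite sqr_sqrtr ?(ltW (p0 a))// /p sqrrD enorm_sqr lerD2r lerDl mulrn_wge0//.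
  by rewrite mulr_ge0 ?enorm_ge0 ?(ltW epos).
have ee : e * expR (L * (b - a)) = e0%:num by rewrite divfK// gt_eqF ?expR_gt0.
rewrite -ee; have := ler_wpM2r (ltW (expR_gt0 (L * (b - a)))) ua.
move: (expR _) => E H; rewrite mulrDl.
have -> : (E - 1) / L * eta = eta / L * E - eta / L by ring.
lra.
Qed.

(** Time reversal: the hypothesis bounds the norm of the derivative and is therefore insensitive to
    its sign. *)
Let gronwall_bwd w w' L eta (a b : R) : a <= b -> 0 < L -> 0 <= eta ->
  wcont `[a, b] w -> (forall t, a < t < b -> is_derive t 1 w (w' t)) ->
  (forall t, a < t < b -> enorm (w' t) <= L * enorm (w t) + eta) ->
  enorm (w a) <= gbound L eta (enorm (w b)) (b - a).
Proof.
move=> ab L0 eta0 wc wd wle.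
have := @gronwall_fwd (w \o -%R) (fun t => - w' (- t)) L eta (- b) (- a).
rewrite /= !opprK lerN2 addrC; apply=> //.
- move=> t; rewrite /= in_itv/= => tab.
  have tab' : `[a, b]%classic (- t) by rewrite /= in_itv/= lerNr lerNl andbC.
  apply: cvg_comp (wc _ tab').
  move=> A [e e0 H]; exists e => // s /= st; rewrite in_itv/= => sab.
  apply: H; first by rewrite /= -opprD normrN.
  by rewrite /= in_itv/= lerNr lerNl andbC.
- move=> t tab; have tab' : a < - t < b by rewrite ltrNr ltrNl andbC.
  have wd' := wd _ tab'.
  apply/is_deriveP; have /is_deriveP := wd'.
  move=> H; rewrite -(scaleN1r (w' _)).
  rewrite (_ : (fun h => _) = (fun h : R => -1 *: ((- h)^-1 *: (w (- h - t) - w (- t))))); last first.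
    by apply/funext => h /=; rewrite scaleN1r invrN scaleNr opprK opprD.
  apply: cvgZr; refine (@cvg_comp _ _ _ (-%R) (fun h : R => h^-1 *: (w (h - t) - w (- t))) _ _ _ _ H).
  move=> A [e e0 H']; exists e => // s /= st s0; apply: H'.
    by move: st; rewrite /= !sub0r !normrN.
  by rewrite oppr_eq0.
- move=> t tab; rewrite enormN; apply: wle.
  by rewrite ltrNr ltrNl andbC.
Qed.

Lemma gronwall w w' L eta (a b s t : R) : 0 < L -> 0 <= eta ->
  wcont `[a, b] w -> (forall t, a < t < b -> is_derive t 1 w (w' t)) ->
  (forall t, a < t < b -> enorm (w' t) <= L * enorm (w t) + eta) ->
  a <= s <= b -> a <= t <= b ->
  enorm (w t) <= gbound L eta (enorm (w s)) `|t - s|.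
Proof.
move=> L0 eta0 wc wd wle /andP[a_s sb] /andP[a_t tb].
have [st|ts] := leP s t.
  rewrite ger0_norm ?subr_ge0//; apply: (@gronwall_fwd w w') => //.
  - by apply: wcont_sub wc => z /=; rewrite !in_itv/=; lra.
  - by move=> z zst; apply: wd; lra.
  - by move=> z zst; apply: wle; lra.
rewrite distrC gtr0_norm ?subr_gt0//; apply: (@gronwall_bwd w w') => //; first exact: ltW.
- by apply: wcont_sub wc => z /=; rewrite !in_itv/=; lra.
- by move=> z zst; apply: wd; lra.
- by move=> z zst; apply: wle; lra.
Qed.

(* The differential inequality is only assumed while |w| <= r: at a point closest
   to s with |w| >= r it would give |w| < r. *)
Lemma gronwall_tube w w' L eta (r a b s t : R) : 0 < L -> 0 <= eta ->
  wcont `[a, b] w -> (forall t, a < t < b -> is_derive t 1 w (w' t)) ->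
  (forall t, a < t < b -> enorm (w t) <= r ->
     enorm (w' t) <= L * enorm (w t) + eta) ->
  gbound L eta (enorm (w s)) (Num.max (s - a) (b - s)) < r ->
  a <= s <= b -> a <= t <= b -> enorm (w t) < r.
Proof.
move=> L0 eta0 wc wd wle small sab tab; rewrite ltNge; apply/negP => rt.
pose S := [set z | a <= z <= b /\ r <= enorm (w z)].
have distle z : a <= z <= b -> `|z - s| <= Num.max (s - a) (b - s).
  by move=> ?; rewrite le_max; case: (leP s z) => ?; [rewrite ger0_norm|rewrite ltr0_norm]; lra.
have absurd z p q : a <= p -> q <= b -> p <= s <= q -> p <= z <= q -> r <= enorm (w z) ->
    (forall y, p < y < q -> enorm (w y) < r) -> False.
  move=> ap qb sp zp rz H.
  have : enorm (w z) <= gbound L eta (enorm (w s)) `|z - s|.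
    apply: (@gronwall w w' L eta p q) => //.
    - by apply: wcont_sub wc => y /=; rewrite !in_itv/=; lra.
    - by move=> y yst; apply: wd; lra.
    - by move=> y yst; apply: wle; [lra|exact/ltW/H].
  apply/negP; rewrite -ltNge (lt_le_trans _ rz)// (le_lt_trans _ small)//.
  by apply: gbound_le; rewrite ?enorm_ge0// distle//; lra.
have cont : {within `[a, b], continuous (fun t => enorm (w t))}.
  by apply/wcontP; apply: (wcont_comp wc); exact: enorm_continuous.
have Scomp : compact S.
  rewrite (_ : S = `[a, b]%classic `&` (fun t => enorm (w t)) @^-1` [set x | r <= x]); last first.
    by apply/seteqP; split=> z /=; rewrite /S/= in_itv.
  apply: (@subclosed_compact _ _ `[a, b]); [|exact: segment_compact|by move=> ? []].
  rewrite closed_setSI; last exact: interval_closed.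
  by move/continuous_closedP: cont; apply; exact: closed_ge.
pose d z := `|z - s|.
have dcont : continuous d by move=> z; apply: cvg_norm; apply: cvgB; [exact: cvg_id|exact: cvg_cst].
have [z zS zmin] := compact_EVT_min (ex_intro _ t (conj tab rt) : S !=set0) Scomp (continuous_subspaceT dcont).
rewrite inE in zS; case: zS => zab rz.
have [sz|zs] := leP s z.
  apply: (absurd z s z) => //; try lra.
  move=> y yz; rewrite ltNge; apply/negP => ry.
  have : d z <= d y by apply: zmin; rewrite inE; split=> //; lra.
  by rewrite /d !ger0_norm; lra.
apply: (absurd z z s) => //; try lra.
move=> y yz; rewrite ltNge; apply/negP => ry.
have : d z <= d y by apply: zmin; rewrite inE; split=> //; lra.
by rewrite /d !ler0_norm; lra.
Qed.

End Gronwall.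

(** * Picard iteration *)

Section Antiderivative.
Set Implicit Arguments.
Unset Strict Implicit.
Context {R : realType}.

Lemma is_derive_continuous (V : normedModType R) (w : R -> V) (t : R) (d : V) :
  is_derive t 1 w d -> {for t, continuous w}.
Proof. by move=> [/derivable1_diffP wd _]; exact: differentiable_continuous. Qed.

Lemma antiderivative (h : R -> R) (t0 l u : R) : continuous h -> l <= t0 <= u ->
  exists2 P : R -> R, P t0 = 0 & forall t, l <= t <= u -> is_derive t 1 P (h t).
Proof.
move=> hc t0lu.
(* Integrating from [l - 1] makes [l] an interior point, so the derivative there is two-sided. *)
pose Q x : R := (\int[@lebesgue_measure R]_(t in [set` `[(l - 1), x]]) h t)%R.
have Qd t : l <= t <= u -> is_derive t 1 Q (h t).
  move=> tlu.
  have tu1 : t < u + 1 by lra.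
  have l1t : l - 1 < t by lra.
  have hi : (@lebesgue_measure R).-integrable `[(l - 1), (u + 1)] (EFin \o h).
    apply: continuous_compact_integrable; first exact: segment_compact.
    exact: continuous_subspaceT.
  have [dQ Q'] := @continuous_FTC1_closed R h (l - 1) t (u + 1) tu1 hi l1t (hc t).
  by split => //; rewrite -derive1E.
exists (fun t => Q t - Q t0) => [|t tlu]; first by rewrite subrr.
have ? := Qd _ tlu.
rewrite (_ : (fun t => _) = Q - cst (Q t0))//.
by apply: is_derive_eq; rewrite subr0.
Qed.

Lemma antiderivative_cV n (h : R -> 'cV[R]_n) (t0 l u : R) : continuous h ->
  l <= t0 <= u ->
  exists P : R -> 'cV[R]_n,
    P t0 = 0 /\ forall t, l <= t <= u -> is_derive t 1 P (h t).
Proof.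
move=> hc t0lu.
have H (i : 'I_n) : exists P : R -> R, P t0 = 0 /\
    forall t, l <= t <= u -> is_derive t 1 P (h t i 0).
  have [|P P0 Pd] := @antiderivative (fun t => h t i 0) t0 l u _ t0lu; last by exists P.
  by move=> t; apply: (@cvg_coord R _ _ (nbhs_filter t)); exact: hc.
have [P PP] := choice H.
exists (fun t => \col_i P i t); split.
  by apply/colP => i; rewrite !mxE; have [] := PP i.
move=> t tlu; apply: is_derive_mx => i j; rewrite ord1.
rewrite (_ : (fun s => _) = P i); last by apply/funext => s; rewrite mxE.
by have [_] := PP i; apply.
Qed.

End Antiderivative.

Section Picard.
Set Implicit Arguments.
Unset Strict Implicit.
Context {R : realType}.

(* The nested intervals [u k - 2 c / 2^k, u k + 2 c / 2^k] have a common point. *)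
Lemma geometric_limit (u : nat -> R) (c : R) :
  (forall k, `|u k.+1 - u k| <= c * 2^-1 ^+ k) ->
  exists v, forall k, `|u k - v| <= 2 * c * 2^-1 ^+ k.
Proof.
move=> uc.
have step k j : `|u (k + j)%N - u k| <= 2 * c * 2^-1 ^+ k - 2 * c * 2^-1 ^+ (k + j).
  elim: j => [|j IH]; first by rewrite addn0 !subrr normr0.
  rewrite addnS exprS; have := uc (k + j)%N.
  move: IH; move: (2^-1 ^+ (k + j)) (2^-1 ^+ k) (u (k + j)%N) (u (k + j).+1) (u k).
  move=> p q x y z; rewrite !ler_norml => /andP[? ?] /andP[? ?]; apply/andP; split; lra.
have c0 k : 0 <= 2 * c * 2^-1 ^+ k.
  have := le_trans (normr_ge0 _) (uc k); rewrite -mulrA; lra.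
pose S := [set u k - 2 * c * 2^-1 ^+ k | k in [set: nat]].
have dist k j : `|u k - u j| <= 2 * c * 2^-1 ^+ k + 2 * c * 2^-1 ^+ j.
  have [kj|/ltnW jk] := leqP k j.
    have := step k (j - k)%N; rewrite subnKC// distrC.
    by have := c0 j; have := c0 k; lra.
  have := step j (k - j)%N; rewrite subnKC//.
  by have := c0 j; have := c0 k; lra.
have Sub k : ubound S (u k + 2 * c * 2^-1 ^+ k).
  by move=> _ [j _ <-]; have := dist k j; rewrite ler_norml => /andP[]; lra.
exists (sup S) => k; rewrite ler_norml; apply/andP; split.
  have : sup S <= u k + 2 * c * 2^-1 ^+ k by apply: ge_sup; [exists (u 0%N - 2 * c * 2^-1 ^+ 0), 0%N|exact: Sub].
  lra.
have : u k - 2 * c * 2^-1 ^+ k <= sup S.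
  by apply: ub_le_sup; [exists (u 0%N + 2 * c * 2^-1 ^+ 0); exact: Sub|exists k].
lra.
Qed.

Lemma geometric_limit_cV n (u : nat -> 'cV[R]_n) (c : R) : 0 <= c ->
  (forall k, `|u k.+1 - u k| <= c * 2^-1 ^+ k) ->
  exists v, forall k, `|u k - v| <= 2 * c * 2^-1 ^+ k.
Proof.
move=> c0 uc.
have H (i : 'I_n) : exists v, forall k, `|u k i 0 - v| <= 2 * c * 2^-1 ^+ k.
  apply: geometric_limit => k; rewrite (le_trans _ (uc k))//.
  by rewrite (le_trans _ (coord_le_mx_norm _ i 0))// !mxE.
have [v vP] := choice H; exists (\col_i v i) => k.
apply: mx_norm_le => [|i j]; first by rewrite !mulr_ge0 ?exprn_ge0 ?invr_ge0.
by rewrite !mxE ord1.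
Qed.

Lemma geometric_eq0 (x c : R) : (forall k, `|x| <= c * 2^-1 ^+ k) -> x = 0.
Proof.
move=> xc; apply/eqP; rewrite -normr_le0; apply/ler_addgt0Pr => e e0; rewrite add0r.
have [k kc] : exists k, `|c| / e < k%:R.
  by have := archi_boundP (divr_ge0 (normr_ge0 c) (ltW e0)) => ?; eexists; eassumption.
rewrite (le_trans (xc k))// exprVn ler_pdivrMr ?exprn_gt0//.
rewrite (le_trans (ler_norm c))// ltW// -ltr_pdivrMl// mulrC (lt_le_trans kc)//.
by rewrite -natrX ler_nat ltnW// ltn_expl.
Qed.

(** Integration halves a bound in the norm weighted by exp (2 L |t - t0|): the integral of L exp (2
    L s) is at most exp (2 L s) / 2. With this weight the Picard operator contracts with ratio 1/2
    on an interval of any length. *)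
Let weighted_bound1 (D d : R -> R) (L c t0 l u : R) : 0 < L -> l <= t0 <= u ->
  D t0 = 0 -> (forall s, l <= s <= u -> is_derive s 1 D (d s)) ->
  (forall s, l <= s <= u -> `|d s| <= L * c * expR (2 * L * `|s - t0|)) ->
  forall t, l <= t <= u -> D t <= c / 2 * expR (2 * L * `|t - t0|).
Proof.
move=> L0 t0lu D0 Dd dle t tlu.
have c0 : 0 <= c.
  have := dle _ t0lu; rewrite subrr normr0 mulr0 expR0 mulr1.
  by move=> /(le_trans (normr_ge0 _)); rewrite pmulr_rge0.
have ed (a s : R) : is_derive s 1 (fun z => c / 2 * expR (a * (z - t0)))
    (c / 2 * a * expR (a * (s - t0))).
  have md : is_derive s 1 (fun z => a * (z - t0)) a.
    rewrite (_ : (fun z => _) = (a *: (id - cst t0)))//.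
    by apply: is_derive_eq; rewrite subr0 [_ *: _]mulr1.
  have H : is_derive ((fun z => a * (z - t0)) s) 1 expR (expR (a * (s - t0))).
    exact: is_derive_expR.
  have := @is_derive1_comp R expR (fun z => a * (z - t0)) s _ _ H md => ?.
  rewrite (_ : (fun z => _) = (c / 2) *: (expR \o (fun z => a * (z - t0))))//.
  by apply: is_derive_eq; rewrite [_ *: _]mulrA mulrAC.
have c2 : 0 <= c / 2 by rewrite divr_ge0.
(* The difference between [D] and its majorant, with rate a = 2 L to the right of [t0], where it
   does not increase, and a = - 2 L to the left, where it does not decrease. *)
pose f a z := D z - c / 2 * expR (a * (z - t0)).
have fd a s : l <= s <= u -> is_derive s 1 (f a) (d s - c / 2 * a * expR (a * (s - t0))).
  by move=> slu; have ? := Dd _ slu; have ? := ed a s; rewrite /f; apply: is_derive_eq.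
have fc a p q : l <= p -> q <= u -> wcont `[p, q] (f a).
  move=> lp qu s; rewrite /= in_itv/= => spq; apply: cvg_within_filter.
  by apply: is_derive_continuous (fd a s _); lra.
have [t0t|tt0] := leP t0 t.
  have : f (2 * L) t <= f (2 * L) t0.
    apply: (@nonincreasing_itv _ _ (fun s => d s - c / 2 * (2 * L) * expR (2 * L * (s - t0)))) => //.
    - by apply: fc; lra.
    - by move=> s st; apply: fd; lra.
    - move=> s st; have : l <= s <= u by lra.
      move=> /dle; rewrite [`|s - t0|]ger0_norm; last lra.
      move: (expR _) => E /(le_trans (ler_norm _)); lra.
  by rewrite /f D0 subrr mulr0 expR0 ger0_norm; lra.
have : - f (- (2 * L)) t0 <= - f (- (2 * L)) t.
  apply: (@nonincreasing_itv _ (fun z => - f (- (2 * L)) z)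
     (fun s => - (d s - c / 2 * (- (2 * L)) * expR (- (2 * L) * (s - t0))))).
  - exact: ltW.
  - by move=> s st; apply: cvgN; apply: fc st; lra.
  - move=> s st; have slu : l <= s <= u by lra.
    by have ? := fd (- (2 * L)) s slu; apply: is_derive_eq.
  - move=> s st; have : l <= s <= u by lra.
    move=> /dle; rewrite [`|s - t0|]ltr0_norm; last lra.
    rewrite (_ : - (2 * L) * (s - t0) = 2 * L * - (s - t0)); last by ring.
    by rewrite ler_norml => /andP[+ _]; move: (expR _) => E; lra.
rewrite /f D0 subrr mulr0 expR0 [`|t - t0|]ltr0_norm ?subr_lt0//.
rewrite (_ : - (2 * L) * (t - t0) = 2 * L * - (t - t0)); last by ring.
move: (expR _) => E; lra.
Qed.

Lemma weighted_bound (D d : R -> R) (L c t0 l u : R) : 0 < L -> l <= t0 <= u ->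
  D t0 = 0 -> (forall s, l <= s <= u -> is_derive s 1 D (d s)) ->
  (forall s, l <= s <= u -> `|d s| <= L * c * expR (2 * L * `|s - t0|)) ->
  forall t, l <= t <= u -> `|D t| <= c / 2 * expR (2 * L * `|t - t0|).
Proof.
move=> L0 t0lu D0 Dd dle t tlu; rewrite ler_norml lerNl.
rewrite (weighted_bound1 L0 t0lu D0 Dd dle tlu) andbT.
apply: (@weighted_bound1 (fun s => - D s) (fun s => - d s) L c t0 l u) => //.
- by rewrite D0 oppr0.
- by move=> s slu; have ? := Dd _ slu; apply: is_derive_eq.
- by move=> s slu; rewrite normrN dle.
Qed.

(** Composition with this projection onto the interval extends a function from [[l, u]] to the line
    and preserves continuity. *)
Definition clamp (l u t : R) := Num.min u (Num.max l t).

Lemma clamp_itv l u t : l <= u -> l <= clamp l u t <= u.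
Proof. by move=> lu; rewrite /clamp ge_min lexx le_min lu/= le_max lexx. Qed.

Lemma clamp_id l u t : l <= t <= u -> clamp l u t = t.
Proof. by case/andP => lt tu; rewrite /clamp (max_idPr lt) (min_idPr tu). Qed.

Lemma clamp_lip l u s t : `|clamp l u s - clamp l u t| <= `|s - t|.
Proof.
have := ler_norm (s - t); have := ler_norm (t - s); rewrite (distrC t) /clamp => ? ?.
have := normr_ge0 (s - t); rewrite ler_norml => ?; apply/andP.
by case: (leP l s) => ?; case: (leP l t) => ?; 
  case: (leP u s) => ?; case: (leP u t) => ?; case: (leP u l) => ?; split; lra.
Qed.

Lemma clamp_continuous l u : continuous (clamp l u).
Proof. by apply: (@lip_continuous R R R _ 1) => s t; rewrite mul1r clamp_lip. Qed.

(** The field is defined and Lipschitz in the state everywhere, so no domain condition interferes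
    with the iteration; such a field is supplied by [tube_existence]. *)
Lemma picard n (G : R -> 'cV[R]_n -> 'cV[R]_n) (t0 l u L M : R) (y0 : 'cV[R]_n) :
  l <= t0 <= u -> 0 < L -> 0 <= M ->
  (forall F : R -> 'cV[R]_n, continuous F -> continuous (fun s => G s (F s))) ->
  (forall s v w, `|G s v - G s w| <= L * `|v - w|) ->
  (forall s, `|G s y0| <= M) ->
  exists y, y t0 = y0 /\ forall t, l <= t <= u -> is_derive t 1 y (G t (y t)).
Proof.
move=> t0lu L0 M0 Gc GL GM.
have lu : l <= u by lra.
pose isP (h P : R -> 'cV[R]_n) :=
  P t0 = 0 /\ forall t, l <= t <= u -> is_derive t 1 P (h t).
have [prim primP] : exists prim, forall h, continuous h -> isP h (prim h).
  exists (fun h => get (isP h)) => h hc.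
  have [P PP] := antiderivative_cV hc t0lu.
  exact: (@getPex _ (isP h) (ex_intro _ P PP)).
(* The Picard operator. The clamp freezes its values outside [[l, u]], where nothing is known about
   the primitive, so that it maps continuous functions on the line to such functions. *)
pose phi (F : R -> 'cV[R]_n) t := y0 + prim (fun s => G s (F s)) (clamp l u t).
have phic F : continuous F -> continuous (phi F).
  move=> Fc t; apply: cvgD; first exact: cvg_cst.
  have [_ Pd] := primP _ (Gc _ Fc).
  apply: (@cvg_comp _ _ _ (clamp l u) _ _ _ _ (@clamp_continuous l u t)).
  by apply: is_derive_continuous (Pd _ _); exact: clamp_itv.
pose W t := expR (2 * L * `|clamp l u t - t0|).
have W0 t : 0 < W t by exact: expR_gt0.
have est F F' c : continuous F -> continuous F' ->
    (forall t, `|F t - F' t| <= c * W t) ->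
    forall t, `|phi F t - phi F' t| <= c / 2 * W t.
  move=> Fc F'c FF' t; rewrite opprD addrACA subrr add0r.
  have c0 : 0 <= c by have := le_trans (normr_ge0 _) (FF' t); rewrite pmulr_lge0.
  apply: mx_norm_le => [|i j]; first by rewrite mulr_ge0 ?divr_ge0// ltW.
  have [P0 Pd] := primP _ (Gc _ Fc); have [P'0 P'd] := primP _ (Gc _ F'c).
  rewrite ord1.
  apply: (@weighted_bound (fun s => (prim (fun s => G s (F s)) s - prim (fun s => G s (F' s)) s) i 0)
    (fun s => (G s (F s) - G s (F' s)) i 0) L c t0 l u) => //.
  - by rewrite P0 P'0 subrr mxE.
  - move=> s slu; have ? := Pd _ slu; have ? := P'd _ slu.
    by apply: (@is_derive_coord R n 1 (fun z => prim (fun s => G s (F s)) z - prim (fun s => G s (F' s)) z)); apply: is_derive_eq.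
  - move=> s slu; rewrite (le_trans (coord_le_mx_norm _ _ _))// (le_trans (GL _ _ _))//.
    by rewrite -mulrA ler_pM2l// (le_trans (FF' s))// /W clamp_id.
  - exact: clamp_itv.
pose z k := iter k phi (cst y0).
have zc k : continuous (z k).
  by elim: k => [|k IH]; [move=> t; exact: cvg_cst|exact: phic].
(* The first increment is a primitive of a function bounded by M = L (M / L), and the weight is at
   least 1; so [weighted_bound] applies with c = M / L. *)
have z01 t : `|z 1%N t - z 0%N t| <= M / L * W t.
  rewrite /z/= /phi/= addrC addKr.
  have [P0 Pd] := primP _ (Gc _ (zc 0%N)).
  apply: mx_norm_le => [|i j]; first by rewrite mulr_ge0 ?divr_ge0// ltW.
  rewrite ord1 (@le_trans _ _ (M / L / 2 * W t))//; last first.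
    by rewrite ler_pM2r// ler_pdivrMr// ler_peMr ?divr_ge0 ?(ltW L0)// ler1n.
  apply: (@weighted_bound (fun s => prim (fun s => G s y0) s i 0)
    (fun s => G s y0 i 0) L (M / L) t0 l u) => //.
  - by have := P0; rewrite /z /= => ->; rewrite mxE.
  - by move=> s slu; apply: is_derive_coord; exact: Pd.
  - move=> s slu; rewrite (le_trans (coord_le_mx_norm _ _ _))// (le_trans (GM _))//.
    rewrite mulrCA divff ?gt_eqF// mulr1 ler_peMr//.
    by rewrite -expR0 ler_expR !mulr_ge0// ltW.
  - exact: clamp_itv.
have zstep k t : `|z k.+1 t - z k t| <= M / L * 2^-1 ^+ k * W t.
  elim: k t => [|k IH] t; first by rewrite expr0 mulr1.
  rewrite exprSr mulrA; exact: (est _ _ _ (zc k.+1) (zc k) IH).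
have H t : exists v, forall k, `|z k t - v| <= 2 * (M / L * W t) * 2^-1 ^+ k.
  apply: geometric_limit_cV => [|k]; first by rewrite mulr_ge0 ?divr_ge0// ltW.
  by rewrite mulrAC.
have [y yz] := choice H.
pose Wm := expR (2 * L * (u - l)).
have WWm t : W t <= Wm.
  rewrite ler_expR ler_pM2l ?mulr_gt0//.
  have := clamp_itv t lu; rewrite ler_norml; lra.
pose C := 2 * (M / L * Wm).
have C0 : 0 <= C by rewrite !mulr_ge0 ?divr_ge0 ?expR_ge0 ?invr_ge0 ?(ltW L0).
have yC t k : `|z k t - y t| <= C * 2^-1 ^+ k.
  rewrite (le_trans (yz t k))// ler_wpM2r ?exprn_ge0 ?invr_ge0// ler_pM2l//.
  by rewrite ler_wpM2l ?divr_ge0 ?(ltW L0).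
have yc : continuous y.
  move=> t; apply/(@cvgrPdist_le _ _ _ (nbhs t)) => e e0.
  have [k kC] : exists k, C * 2^-1 ^+ k <= e / 3.
    have [k] : exists k, C / (e / 3) < k%:R.
      by eexists; apply: archi_boundP; rewrite !divr_ge0// ltW.
    exists k; rewrite exprVn ler_pdivrMr ?exprn_gt0// ltW//.
    rewrite -ltr_pdivrMl ?divr_gt0// mulrC (lt_le_trans p)//.
    by rewrite -natrX ler_nat ltnW// ltn_expl.
  have /(@cvgrPdist_le _ _ _ (nbhs t)) /(_ (e / 3)) : z k @ t --> z k t by exact: zc.
  rewrite divr_gt0// => /(_ isT); apply: filterS => s zs.
  have := yC t k; have := yC s k; move: zs.
  have -> : y t - y s = - (z k t - y t) + (z k t - z k s) + (z k s - y s).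
    by rewrite opprB !subrKA.
  move=> h1 h2 h3; rewrite (le_trans (ler_normD _ _))//.
  have := ler_normD (- (z k t - y t)) (z k t - z k s); rewrite normrN; lra.
(* The iterate [z k.+1] is geometrically close both to [y] and, by contraction, to [phi y]. *)
have yphi t : y t = phi y t.
  apply/eqP; rewrite -subr_eq0 -normr_eq0; apply/eqP.
  apply: (@geometric_eq0 _ (2 * C)) => k; rewrite normr_id.
  have h2 : `|phi (z k) t - phi y t| <= C * 2^-1 ^+ k.
    rewrite (le_trans (est _ _ (2 * (M / L) * 2^-1 ^+ k) (zc k) yc _ _))//.
      by move=> s; rewrite (le_trans (yz s k))// !mulrA mulrAC.
    rewrite (_ : _ * W t = M / L * 2^-1 ^+ k * W t); last by field; rewrite gt_eqF.
    rewrite /C mulrAC ler_wpM2r ?exprn_ge0 ?invr_ge0//.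
    have : M / L * W t <= M / L * Wm by rewrite ler_wpM2l ?divr_ge0 ?(ltW L0).
    have : 0 <= M / L * W t by rewrite !mulr_ge0 ?invr_ge0 ?(ltW L0) ?(ltW (W0 t)).
    lra.
  have h1 := yC t k.+1; rewrite exprS in h1.
  have -> : y t - phi y t = - (z k.+1 t - y t) + (phi (z k) t - phi y t).
    by rewrite opprB [z k.+1 t]/(phi (z k) t) subrKA.
  rewrite (le_trans (ler_normD _ _))// normrN.
  have : 0 <= C * 2^-1 ^+ k by rewrite mulr_ge0 ?exprn_ge0 ?invr_ge0.
  lra.
have [P0 Pd] := primP _ (Gc _ yc).
(* The witness is the primitive rather than [y]: they agree on [[l, u]], but [y] is frozen outside,
   which may destroy the two-sided derivative at the endpoints. *)
exists (fun t => y0 + prim (fun s => G s (y s)) t).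
split; first by rewrite P0 addr0.
move=> t tlu.
have -> : y0 + prim (fun s => G s (y s)) t = y t by rewrite yphi /phi clamp_id.
by have ? := Pd _ tlu; apply: is_derive_eq; rewrite add0r.
Qed.

End Picard.

(** * Solutions in a tube around a curve *)

Section LipschitzOnCompact.
Set Implicit Arguments.
Unset Strict Implicit.
Context {R : realType} {V W : normedModType R}.

Lemma lipschitzP (A : set V) (L : R) (g : V -> W) : L.-lipschitz_A g <->
  forall p q, A p -> A q -> `|g p - g q| <= L * `|p - q|.
Proof.
split=> [gL p q Ap Aq|gL [p q] [/= Ap Aq]]; last exact: gL.
by have := gL (p, q); apply.
Qed.

(** Compactness is applied to pairs of points. Near a diagonal pair the local constant works; near a
    pair of distinct points the distance is bounded below and the variation of [g] above. The
    covering argument with L tending to +oo then yields one constant for all pairs. *)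
Lemma locally_lipschitz_compact (D K : set V) (g : V -> W) :
  locally_lipschitz D g -> compact K -> K `<=` D ->
  exists2 L, 0 < L & forall p q, K p -> K q -> `|g p - g q| <= L * `|p - q|.
Proof.
move=> gD Kc KD.
have : near_covering_within (K `*` K).
  by apply/near_covering_withinP/compact_near_coveringP; exact: compact_setX.
move=> /(_ R +oo%R (fun L pq => `|g pq.1 - g pq.2| <= L * `|pq.1 - pq.2|)).
case.
- move=> [p q] [/= Kp Kq].
  have [Lp [Up [Upp /lipschitzP gp]]] := gD p (KD p Kp).
  have [Lq [Uq [Uqq /lipschitzP gq]]] := gD q (KD q Kq).
  have [pq|pq] := eqVneq p q.
    exists (Up `*` Up, [set L | Lp <= L]).
      split=> /=; last by exists Lp; split=> [|x /ltW//]; exact: num_real.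
      by exists (Up, Up) => //; rewrite -pq.
    move=> [[p' q'] L] /= [[Up' Uq'] LL] [/= Kp' Kq'].
    rewrite (le_trans (gp p' q' _ _))//; last by rewrite ler_wpM2r.
      by split=> //; exact: KD.
    by split=> //; exact: KD.
  set d := `|p - q|; have d0 : 0 < d by rewrite normr_gt0 subr_eq0.
  (* Radius [d / 4] keeps points of the two balls at distance at least [d / 2], and [C] bounds the
     variation of [g] between them, so [C / (d / 2)] is a Lipschitz constant there. *)
  pose Bp := Up `&` ball p (d / 4); pose Bq := Uq `&` ball q (d / 4).
  pose C := `|Lp| * d + `|g p - g q| + `|Lq| * d.
  have C0 : 0 <= C by rewrite !addr_ge0// mulr_ge0// ltW.
  have d4 : 0 < d / 4 by rewrite divr_gt0.
  exists (Bp `*` Bq, [set L | C / (d / 2) <= L]).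
    split=> /=; last by exists (C / (d / 2)); split=> [|x /ltW//]; exact: num_real.
    by exists (Bp, Bq) => //; split; apply: filterI => //; exact: nbhsx_ballx.
  move=> [[p' q'] L] /= [[[Up' pp'] [Uq' qq']] LL] [/= Kp' Kq'].
  move: pp' qq'; rewrite -!ball_normE/= => pp' qq'.
  have hp : `|g p - g p'| <= `|Lp| * d.
    rewrite (le_trans (gp p p' _ _))//.
    - by split; [exact: KD|exact: nbhs_singleton].
    - by split=> //; exact: KD.
    - have := ler_norm Lp; have := normr_ge0 (p - p'); have := normr_ge0 Lp; nra.
  have hq : `|g q - g q'| <= `|Lq| * d.
    rewrite (le_trans (gq q q' _ _))//.
    - by split; [exact: KD|exact: nbhs_singleton].
    - by split=> //; exact: KD.
    - have := ler_norm Lq; have := normr_ge0 (q - q'); have := normr_ge0 Lq; nra.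
  have gC : `|g p' - g q'| <= C.
    have -> : g p' - g q' = - (g p - g p') + (g p - g q) + (g q - g q').
      by rewrite opprB !subrKA.
    rewrite (le_trans (ler_normD _ _))// lerD// (le_trans (ler_normD _ _))//.
    by rewrite normrN lerD.
  have dpq : d / 2 <= `|p' - q'|.
    have : d <= `|p - p'| + `|p' - q'| + `|q - q'|.
      have -> : d = `|(p - p') + (p' - q') - (q - q')|.
        by rewrite opprB !subrKA.
      by rewrite (le_trans (ler_normB _ _))// lerD2r ler_normD.
    lra.
  rewrite (le_trans gC)// -[C](@divfK _ (d / 2)) ?gt_eqF ?divr_gt0//.
  by rewrite ler_pM ?divr_ge0 ?(ltW d0).
move=> L0 [_ HL]; exists (`|L0| + 1); first by rewrite ltr_wpDl.
move=> p q Kp Kq; apply: (HL _ _ (p, q)) => //.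
by rewrite (le_lt_trans (ler_norm _))// ltrDl.
Qed.

End LipschitzOnCompact.

Section TubeExistence.
Set Implicit Arguments.
Unset Strict Implicit.
Context {R : realType} {n : nat}.

Definition box (r : R) (v : 'cV[R]_n) : 'cV[R]_n := \col_i clamp (- r) r (v i 0).

Lemma box_lip r v w : `|box r v - box r w| <= `|v - w|.
Proof.
apply: mx_norm_le => // i j; rewrite !mxE (le_trans (clamp_lip _ _ _ _))//.
by have := coord_le_mx_norm (v - w) i 0; rewrite !mxE.
Qed.

Lemma box_le r v : 0 <= r -> `|box r v| <= r.
Proof.
move=> r0; apply: mx_norm_le => // i j; by rewrite mxE ler_norml; apply: (@clamp_itv R); lra.
Qed.

Lemma box_id r v : `|v| <= r -> box r v = v.
Proof.
move=> vr; apply/colP => i; rewrite mxE clamp_id// -ler_norml.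
by rewrite (le_trans _ vr)// coord_le_mx_norm.
Qed.

Lemma clamp_wcont (V : normedModType R) (x : R -> V) l u : l <= u ->
  wcont `[l, u] x -> continuous (fun t => x (clamp l u t)).
Proof.
move=> lu xc t; have Dt : `[l, u]%classic (clamp l u t) by rewrite /= in_itv; exact: (clamp_itv t lu).
apply: (@cvg_comp _ _ _ (clamp l u) x _ _ _ _ (xc _ Dt)).
move=> A DA; have : \forall s \near t, `[l, u]%classic (clamp l u s) -> A (clamp l u s).
  exact: (@clamp_continuous R l u t _ DA).
apply: (@filterS _ _ (nbhs_filter t)) => s; apply.
by rewrite /= in_itv; exact: (clamp_itv s lu).
Qed.

(* Outside of the tube the vector field is extended by projecting v - x t onto a
   box, which keeps it Lipschitz. *)
Lemma tube_existence (g : R * 'cV[R]_n -> 'cV[R]_n) (x : R -> 'cV[R]_n)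
    (l u t0 r L : R) (y0 : 'cV[R]_n) :
  l <= t0 <= u -> 0 <= r -> 0 < L -> wcont `[l, u] x ->
  (forall p q, l <= p.1 <= u -> `|p.2 - x p.1| <= r ->
     l <= q.1 <= u -> `|q.2 - x q.1| <= r -> `|g p - g q| <= L * `|p - q|) ->
  exists y y', y t0 = y0 /\ forall t, l <= t <= u ->
    is_derive t 1 y (y' t) /\ (`|y t - x t| <= r -> y' t = g (t, y t)).
Proof.
move=> t0lu r0 L0 xc gL; have lu : l <= u by lra.
pose X t := x (clamp l u t).
have Xc : continuous X by exact: clamp_wcont.
pose p t v := (clamp l u t, X t + box r (v - X t)).
have pT t v : l <= (p t v).1 <= u /\ `|(p t v).2 - x (p t v).1| <= r.
  by split; [exact: (clamp_itv _ lu)|rewrite /= addrC addKr box_le].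
have gLp s v t w : `|g (p s v) - g (p t w)| <= L * `|p s v - p t w|.
  by have [? ?] := pT s v; have [? ?] := pT t w; apply: gL.
pose G t v := g (p t v).
have Gc F : continuous F -> continuous (fun s => G s (F s)).
  move=> Fc t; apply/(@cvgrPdist_le _ _ _ (nbhs t)) => e e0.
  have pc : (fun s => p s (F s)) @ t --> p t (F t).
    have h1 : clamp l u s @[s --> t] --> clamp l u t by exact: clamp_continuous.
    have h2 : X s + box r (F s - X s) @[s --> t] --> X t + box r (F t - X t).
      apply: cvgD; first exact: Xc.
      apply: (@cvg_comp _ _ _ (fun s => F s - X s) (box r)).
        by apply: cvgB; [exact: Fc|exact: Xc].
      apply: (@lip_continuous _ _ _ _ 1) => v w; rewrite mul1r; exact: box_lip.
    exact: (cvg_pair h1 h2).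
  have /(@cvgrPdist_le _ _ _ (nbhs t)) /(_ (e / L)) := pc.
  rewrite divr_gt0// => /(_ isT); apply: filterS => s ps.
  by rewrite (le_trans (gLp _ _ _ _))// mulrC -ler_pdivlMr.
have GL s v w : `|G s v - G s w| <= L * `|v - w|.
  rewrite (le_trans (gLp _ _ _ _))// ler_pM2l// /p.
  rewrite prod_normE/= subrr normr0 opprD addrACA subrr add0r.
  rewrite ge_max normr_ge0/= (le_trans (box_lip _ _ _))//.
  by rewrite opprD opprK addrACA addNr addr0.
have [M M0 GM] : exists2 M, 0 <= M & forall s, `|G s y0| <= M.
  have cc : {within `[l, u], continuous (fun s => `|G s y0|)}.
    apply: continuous_subspaceT => s; apply: cvg_norm.
    by apply: (Gc (cst y0)) => ?; exact: cvg_cst.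
  have [c _ cmax] := EVT_max lu cc.
  exists `|G c y0| => // s.
  have /cmax : clamp l u s \in `[l, u]%R by rewrite in_itv; exact: (clamp_itv _ lu).
  by rewrite /G /p /X [clamp l u (clamp l u s)]clamp_id//; exact: (clamp_itv _ lu).
have [y [yt0 yd]] := picard t0lu L0 M0 Gc GL GM.
exists y, (fun t => G t (y t)); split=> // t tlu; split; first exact: yd.
move=> yx; rewrite /G /p /X clamp_id// box_id//.
by rewrite addrC subrK.
Qed.

End TubeExistence.

(** * Gradients and Hessians *)

Section HessianCalculus.
Set Implicit Arguments.
Unset Strict Implicit.
Context {R : realType} {n : nat}.
Implicit Types (g : 'cV[R]_n -> R) (u v x : 'cV[R]_n).

(** Weyl's inequality in terms of quadratic forms: <v, (A - B) v> is at most d |v|^2. *)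
Lemma coercive_perturb (A B : 'M[R]_n) (c d : R) :
  (forall v, c * dotv v v <= dotv v (A *m v)) -> specnorm (A - B) <= d ->
  forall v, (c - d) * dotv v v <= dotv v (B *m v).
Proof.
move=> cA ABd v.
have -> : B = A - (A - B) by rewrite opprB addrC subrK.
rewrite mulmxBl dotvDr dotvNr mulrBl lerB//.
rewrite (le_trans (dotv_CS _ _))// -enorm_sqr expr2 mulrCA ler_wpM2l ?enorm_ge0//.
by rewrite (le_trans (enorm_mulmx _ _))// ler_wpM2r ?enorm_ge0.
Qed.

Lemma derive_coord p (f : 'cV[R]_n -> 'cV[R]_p) x v j : differentiable f x ->
  'D_v (fun y => f y j 0) x = 'd f x v j 0.
Proof.
move=> df; have dv : derivable f x v by exact: diff_derivable.
rewrite -deriveE//; apply/cvg_lim => //.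
have := @cvg_coord R _ _ (dnbhs_filter _) _ _ _ _ j 0 dv.
by apply: cvg_trans; apply: near_eq_cvg; near=> h; rewrite /= !mxE.
Unshelve. all: by end_near. Qed.

Lemma diffE_coord (W : normedModType R) (f : 'cV[R]_n -> W) x v :
  'd f x v = \sum_(i < n) v i 0 *: 'd f x (delta_mx i 0).
Proof.
rewrite {1}(matrix_sum_delta v) linear_sum; apply: eq_bigr => i _.
by rewrite big_ord1 linearZ.
Qed.

Lemma diff_grad g x v : differentiable g x -> 'd g x v = dotv (grad g x) v.
Proof.
move=> dg; rewrite diffE_coord; apply: eq_bigr => i _.
by rewrite mxE deriveE// mulrC.
Qed.

Lemma diff_hess g x v : differentiable (grad g) x ->
  'd (grad g) x v = hess g x *m v.
Proof.
move=> dg; apply/colP => i; rewrite diffE_coord summxE mxE; apply: eq_bigr => j _.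
by rewrite !mxE derive_coord// mulrC.
Qed.

Lemma is_derive_comp_diff (V W : normedModType R) (f : V -> W) (w : R -> V) (t : R) (d : V) :
  is_derive t 1 w d -> differentiable f (w t) ->
  is_derive t 1 (fun s => f (w s)) ('d f (w t) d).
Proof.
move=> [dw <-] df; have dw' : differentiable w t by exact/derivable1_diffP.
have dfw : differentiable (f \o w) t by exact: differentiable_comp.
split; first exact/derivable1_diffP.
by rewrite -[LHS]/('D_1 (f \o w) t) deriveE// diff_comp//= deriveE.
Qed.

Lemma is_derive_line u v (t : R) : is_derive t 1 (fun s : R => u + s *: v) v.
Proof.
apply/is_deriveP.
rewrite (_ : (fun h => _) = (fun h => (h^-1 * h) *: v)); last first.
  apply/funext => h; rewrite [u + (h + t) *: v]addrC opprD addrA addrK.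
  by rewrite -scalerBl addrK scalerA.
apply: (@cvg_trans _ (nbhs v)) => //.
apply: cvg_near_cst; near=> h.
rewrite mulVf ?scale1r//; near: h; exact: nbhs_dnbhs_neq.
Unshelve. all: by end_near. Qed.

Lemma mvt_total (f f' : R -> R) (h : R) : 0 < h ->
  (forall s : R, is_derive s 1 f (f' s)) ->
  exists2 s, 0 < s < h & f h - f 0 = h * f' s.
Proof.
move=> h0 fd.
have fc : {within `[0, h], continuous f}.
  by apply: continuous_subspaceT => s; exact: is_derive_continuous (fd s).
have [s s0h E] := MVT h0 (fun s _ => fd s) fc.
by exists s; rewrite ?E ?subr0 1?mulrC//; rewrite in_itv/= in s0h.
Qed.

Lemma is_derive_grad_line g u v (s : R) : (forall y, differentiable g y) ->
  is_derive s 1 (fun z : R => g (u + z *: v)) (dotv (grad g (u + s *: v)) v).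
Proof.
move=> dg; rewrite -diff_grad//.
apply: (@is_derive_comp_diff _ _ g (fun z : R => u + z *: v)) => //.
exact: is_derive_line.
Qed.

Lemma is_derive_hess_line g u v (s : R) : (forall y, differentiable (grad g) y) ->
  is_derive s 1 (fun z : R => grad g (u + z *: v)) (hess g (u + s *: v) *m v).
Proof.
move=> dg; rewrite -diff_hess//.
apply: (@is_derive_comp_diff _ _ (grad g) (fun z : R => u + z *: v)) => //.
exact: is_derive_line.
Qed.

Lemma dotv_delta v i : dotv v (delta_mx i 0) = v i 0.
Proof.
rewrite /dotv (bigD1 i)//= !mxE !eqxx mulr1 big1 ?addr0// => j ji.
by rewrite !mxE (negPf ji) mulr0.
Qed.

(* The left-hand side is symmetric in i and j; this gives the symmetry of the Hessian. *)
Lemma second_difference g x (h : R) i j :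
  (forall y, differentiable g y) -> (forall y, differentiable (grad g) y) -> 0 < h ->
  exists2 y, `|y - x| <= 2 * h &
   g (x + h *: delta_mx j 0 + h *: delta_mx i 0) - g (x + h *: delta_mx i 0)
   - (g (x + h *: delta_mx j 0) - g x) = h * (h * hess g y i j).
Proof.
move=> dg dgg h0; set ei := delta_mx i 0; set ej := delta_mx j 0.
have fd (s : R) : is_derive s 1
    (fun z : R => g (x + h *: ej + z *: ei) - g (x + z *: ei))
    (grad g (x + h *: ej + s *: ei) i 0 - grad g (x + s *: ei) i 0).
  have := is_derive_grad_line (x + h *: ej) ei s dg.
  have := is_derive_grad_line x ei s dg; rewrite !dotv_delta => ? ?.
  exact: is_deriveB.
have [s s0h] := mvt_total h0 fd; rewrite scale0r !addr0 => ->.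
have gd (t : R) : is_derive t 1 (fun z : R => grad g (x + s *: ei + z *: ej) i 0)
    (hess g (x + s *: ei + t *: ej) i j).
  have := is_derive_coord i 0 (is_derive_hess_line (x + s *: ei) ej t dgg).
  by rewrite /ej -colE mxE.
have [t t0h] := mvt_total h0 gd; rewrite scale0r addr0 addrAC => ->.
exists (x + s *: ei + t *: ej) => //.
rewrite -[x + _ + _]addrA [x + _]addrC addrK (le_trans (ler_normD _ _))// !normrZ.
have e1 k : `|delta_mx k 0 : 'cV[R]_n| <= 1.
  apply: mx_norm_le => // a b; by rewrite mxE; case: (_ && _); rewrite ?normr1 ?normr0.
have := e1 i; have := e1 j; rewrite -/ei -/ej => ? ?.
have : `|s| = s by rewrite gtr0_norm; lra.
have : `|t| = t by rewrite gtr0_norm; lra.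
move=> -> ->; have := normr_ge0 ei; have := normr_ge0 ej; nra.
Qed.

(** Schwarz's theorem. The same second difference is h^2 times an (i, j) entry of the Hessian at one
    point and h^2 times a (j, i) entry at another; both points tend to [x] with h, where the Hessian
    is continuous. *)
Lemma hess_sym g x : twice_continuously_differentiable g ->
  (hess g x)^T = hess g x.
Proof.
move=> [dg dgg hc]; apply/matrixP => i j; rewrite mxE.
apply/eqP; rewrite -subr_eq0 -normr_le0; apply/ler_addgt0Pr => e e0; rewrite add0r.
have /(@cvgrPdist_le _ _ _ (nbhs x)) /(_ (e / 2)) := hc x.
rewrite divr_gt0// => /(_ isT) /(@nbhs_normP _ _ x)[d /= d0 Hd].
(* The intermediate points lie within 2 h of [x], hence within [d]. *)
have h0 : 0 < d / 3 by rewrite divr_gt0.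
have [y yx Ey] := second_difference x i j dg dgg h0.
have [z zx Ez] := second_difference x j i dg dgg h0.
have E : hess g y i j = hess g z j i.
  apply: (mulfI (lt0r_neq0 h0)); apply: (mulfI (lt0r_neq0 h0)); rewrite -Ey -Ez.
  by rewrite [x + _ + _]addrAC; ring.
have Hy : `|hess g x - hess g y| <= e / 2 by apply: Hd; rewrite /= distrC; lra.
have Hz : `|hess g x - hess g z| <= e / 2 by apply: Hd; rewrite /= distrC; lra.
move: (hess g x) (hess g y) (hess g z) E Hy Hz => A B C E Hy Hz.
have := le_trans (coord_le_mx_norm _ i j) Hy.
have := le_trans (coord_le_mx_norm _ j i) Hz.
rewrite !mxE E ler_norml ler_norml => /andP[? ?] /andP[? ?].
by rewrite ler_norml; apply/andP; split; lra.
Qed.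

(** Two mean value theorems: the increment is <grad g (x + s v), v>, and since the gradient vanishes
    at [x] this is s <v, hess g (x + t v) v> for some 0 < t < s. *)
Lemma taylor2_gt0 g x v : twice_continuously_differentiable g -> grad g x = 0 ->
  (forall s : R, 0 < s < 1 -> 0 < dotv v (hess g (x + s *: v) *m v)) ->
  g x < g (x + v).
Proof.
move=> [dg dgg hc] gx0 H.
have [s s01] := mvt_total (@ltr01 R) (fun s => is_derive_grad_line x v s dg).
rewrite scale1r scale0r addr0 mul1r -subr_gt0 => ->.
have s0 : 0 < s by lra.
have fd (t : R) : is_derive t 1 (fun z : R => dotv v (grad g (x + z *: v)))
    (dotv v (hess g (x + t *: v) *m v)).
  have hd := is_derive_hess_line x v t dgg.
  have hv : is_derive t 1 (fun=> v) (0 : 'cV[R]_n) by exact: is_derive_cst.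
  by have := is_derive_dotv hv hd; rewrite dotv0l addr0.
have [t t0s] := mvt_total s0 fd.
rewrite scale0r addr0 gx0 [dotv v 0]dotvC dotv0l subr0 dotvC => ->.
by rewrite mulr_gt0// H//; lra.
Qed.

(** By continuity the Hessian keeps half of its smallest eigenvalue on a ball, and segments from the
    centre stay in the ball. *)
Lemma strict_local_min g x : (0 < n)%N -> twice_continuously_differentiable g ->
  grad g x = 0 -> posdef (hess g x) ->
  \forall y \near x, y != x -> g x < g y.
Proof.
move=> n0 gC2 gx0 /(posdefP (hess_sym x gC2) n0) m0.
set m := min_eigenvalue _ in m0.
have [_ _ hc] := gC2.
pose N : R := n%:R * n%:R + 1.
have N0 : 0 < N by rewrite ltr_wpDl// mulr_ge0.
have /(@cvgrPdist_le _ _ _ (nbhs x)) /(_ (m / 2 / N)) := hc x.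
rewrite !divr_gt0// => /(_ isT) /(@nbhs_normP _ _ x)[d /= d0 Hd].
apply/(@nbhs_normP _ _ x); exists d => // y /= xy yx.
have -> : y = x + (y - x) by rewrite addrC subrK.
apply: taylor2_gt0 => // s s01.
have Hs : specnorm (hess g x - hess g (x + s *: (y - x))) <= m / 2.
  rewrite (le_trans (specnorm_le_norm _))// mulrA.
  have /Hd h : `|x - (x + s *: (y - x))| < d.
    rewrite opprD addrA subrr add0r normrN normrZ distrC gtr0_norm; last lra.
    have := normr_ge0 (x - y); nra.
  have : n%:R * n%:R * `|hess g x - hess g (x + s *: (y - x))| <= N * (m / 2 / N).
    by rewrite ler_pM// ?mulr_ge0// lerDl.
  by rewrite [N * _]mulrC divfK ?gt_eqF.
have H := (min_eigenvalueP (hess_sym x gC2) n0 m).1 (lexx _).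
have := coercive_perturb H Hs (y - x); apply: lt_le_trans.
rewrite mulr_gt0//; first by lra.
by rewrite -enorm_sqr exprn_gt0// enorm_gt0 subr_eq0.
Qed.

End HessianCalculus.

(** * Solutions relative to an interval *)

Section ODEBasics.
Set Implicit Arguments.
Unset Strict Implicit.
Context {R : realType} {n : nat}.
Implicit Types (g : R * 'cV[R]_n -> 'cV[R]_n) (y : R -> 'cV[R]_n) (D : set R) (t : R) (c : 'cV[R]_n).

(** This lemma and the next translate between ordinary derivatives and the quotients relative to [D]
    of [ode_solution]: one direction holds at every point, the other in the interior of [D]. *)
Lemma is_derive_quotient y (t : R) (d : 'cV[R]_n) D : is_derive t 1 y d ->
  (s - t)^-1 *: (y s - y t) @[s --> within D t^'] --> d.
Proof.
move=> /is_deriveP yd.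
have H : (s - t) @[s --> within D t^'] --> (0 : R)^'.
  move=> A [e /= e0 H]; exists e => // s /= st snt Ds.
  apply: H; first by rewrite /= sub0r normrN distrC.
  by rewrite subr_eq0.
have := @cvg_comp _ _ _ (fun s => s - t) (fun h => h^-1 *: (y (h + t) - y t)) _ _ _ H yd.
apply: cvg_trans; apply: near_eq_cvg; apply: nearW => s /=; by rewrite subrK.
Unshelve. all: by end_near. Qed.

Lemma quotient_is_derive y (t : R) (d : 'cV[R]_n) D : nbhs t D ->
  (s - t)^-1 *: (y s - y t) @[s --> within D t^'] --> d -> is_derive t 1 y d.
Proof.
move=> [e /= e0 tD] yd; apply/is_deriveP.
have H : (h + t) @[h --> (0 : R)^'] --> within D t^'.
  move=> A [e' /= e'0 H]; exists (Num.min e e'); first by rewrite /= lt_min e0.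
  move=> h /=; rewrite sub0r normrN lt_min => /andP[he he'] h0.
  apply: H; first by rewrite /= opprD addrCA subrr addr0 normrN.
    by rewrite -subr_eq0 addrK.
  by apply: tD; rewrite /= opprD addrCA subrr addr0 normrN.
have := @cvg_comp _ _ _ (fun h => h + t) (fun s => (s - t)^-1 *: (y s - y t)) _ _ _ H yd.
by apply: cvg_trans; apply: near_eq_cvg; apply: nearW => h /=; rewrite addrK.
Unshelve. all: by end_near. Qed.

Lemma quotient_wcont y (t : R) (d : 'cV[R]_n) D :
  (s - t)^-1 *: (y s - y t) @[s --> within D t^'] --> d ->
  y s @[s --> within D (nbhs t)] --> y t.
Proof.
move=> yd.
have H : y s @[s --> within D t^'] --> y t.
  have h1 : (s - t) @[s --> within D t^'] --> (0 : R).
    apply: cvg_within_filter; apply: cvg_within_filter.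
    have : (s - t) @[s --> t] --> t - t by apply: cvgB; [exact: cvg_id|exact: cvg_cst].
    by rewrite subrr.
  have FF : Filter (within D t^') by exact: within_filter.
  have h2 : (s - t) *: ((s - t)^-1 *: (y s - y t)) + y t @[s --> within D t^'] --> 0 *: d + y t.
    by apply: cvgD; [apply: cvgZ|apply: cvg_cst].
  move: h2; rewrite scale0r add0r; apply: cvg_trans.
  apply: near_eq_cvg.
  exists 1 => //= s _ st _; rewrite scalerA mulfV ?subr_eq0// scale1r.
  by rewrite subrK.
move=> A yA; have [e /= e0 HA] := H A yA; exists e => // s /= st Ds.
have [->|snt] := eqVneq s t; first exact: (nbhs_singleton yA).
exact: HA.
Qed.

Lemma ode_wcont g dom D t0 c y : ode_solution g dom D t0 c y -> wcont D y.
Proof. by move=> [_ _ yD] t /yD[_]; exact: quotient_wcont. Qed.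

Lemma ode_is_derive g dom D t0 c y (t : R) : ode_solution g dom D t0 c y ->
  nbhs t D -> is_derive t 1 y (g (t, y t)).
Proof.
move=> [_ _ yD] tD; have [_] := yD _ (nbhs_singleton tD).
exact: quotient_is_derive.
Qed.

Lemma ode_sub g dom D D' t0 c y : D' `<=` D -> D' t0 ->
  ode_solution g dom D t0 c y -> ode_solution g dom D' t0 c y.
Proof.
move=> sub D't0 [Dt0 yt0 yD]; split=> // t D't; have [domt yt] := yD _ (sub _ D't).
split=> //; apply: cvg_trans yt; apply: cvg_app.
by move=> A; rewrite /within; apply: (@filterS _ _ (dnbhs_filter t)) => s + /sub.
Qed.

Lemma itv_nbhs (a b t : R) : a < t < b -> nbhs t `[a, b]%classic.
Proof.
move=> tab; exists (Num.min (t - a) (b - t)).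
  by rewrite /= lt_min; apply/andP; split; lra.
move=> s /=; rewrite lt_min in_itv/= !ltr_norml; lra.
Qed.

Lemma constant_itv (w : R -> 'cV[R]_n) (a b : R) : a <= b -> wcont `[a, b] w ->
  (forall t, a < t < b -> is_derive t 1 w 0) -> w a = w b.
Proof.
move=> ab wc wd; apply/colP => i.
have wci : wcont `[a, b] (fun t => w t i 0).
  move=> t tab; apply: (@cvg_coord R _ _ (within_filter _ _)); exact: wc.
have wdi t : a < t < b -> is_derive t 1 (fun s => w s i 0) 0.
  by move=> /wd h; have := is_derive_coord i 0 h; rewrite mxE.
apply/eqP; rewrite eq_le; apply/andP; split; last first.
  by apply: (@nonincreasing_itv _ (fun t => w t i 0) (cst 0)).
rewrite -lerN2; apply: (@nonincreasing_itv _ (fun t => - w t i 0) (cst 0)) => //.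
  by move=> t tab; apply: cvgN; exact: wci.
by move=> t tab; have ? := wdi t tab; apply: is_derive_eq; rewrite oppr0.
Qed.

End ODEBasics.

(** * The right-hand side f *)

Section Scalarization.
Set Implicit Arguments.
Unset Strict Implicit.
Context {R : realType} {n : nat}.
Implicit Types (x y z v : 'cV[R]_n) (t : R) (p q : R * 'cV[R]_n).

(** The mean value theorem holds for scalar functions only, so the gradient is projected onto the
    increment [w] itself; this loses nothing, as <w, w> = |w|^2. *)
Lemma enorm_grad_diff (g : 'cV[R]_n -> R) y z (c : R) :
  (forall x, differentiable (grad g) x) ->
  (forall s : R, 0 < s < 1 -> specnorm (hess g (z + s *: (y - z))) <= c) ->
  enorm (grad g y - grad g z) <= c * enorm (y - z).
Proof.
move=> dg hc; set w := grad g y - grad g z.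
have [->|w0] := eqVneq w 0.
  rewrite enorm0 mulr_ge0 ?enorm_ge0//.
  have /hc : 0 < (2^-1 : R) < 1 by apply/andP; split; lra.
  by apply: le_trans; exact: specnorm_ge0.
rewrite -enorm_gt0 in w0; rewrite -(ler_pM2l w0) -expr2 enorm_sqr.
have fd (t : R) : is_derive t 1 (fun s : R => dotv w (grad g (z + s *: (y - z))))
    (dotv w (hess g (z + t *: (y - z)) *m (y - z))).
  have hd := is_derive_hess_line z (y - z) t dg.
  have hw : is_derive t 1 (fun=> w) (0 : 'cV[R]_n) by exact: is_derive_cst.
  by have := is_derive_dotv hw hd; rewrite dotv0l addr0.
have [s s01] := mvt_total (@ltr01 R) fd.
rewrite scale1r scale0r addr0 mul1r [z + (y - z)]addrC subrK -dotvNr -dotvDr => ->.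
rewrite (le_trans (dotv_CS _ _))// ler_pM2l// (le_trans (enorm_mulmx _ _))//.
by rewrite ler_wpM2r ?enorm_ge0// hc.
Qed.

Lemma grad_coord_differentiable (g : 'cV[R]_n -> R) y i : differentiable (grad g) y ->
  differentiable (fun z => grad g z i 0) y.
Proof.
move=> dg; apply: (@differentiable_comp _ _ _ _ (grad g) (fun M : 'cV[R]_n => M i 0)) => //.
exact: differentiable_coord.
Qed.

Lemma derive_lincomb (f0 f1 : 'cV[R]_n -> R) (a b : R) x v :
  derivable f0 x v -> derivable f1 x v ->
  'D_v (fun y => a * f0 y + b * f1 y) x = a * 'D_v f0 x + b * 'D_v f1 x.
Proof.
move=> d0 d1; apply: derive_val.
exact: (is_deriveD (is_deriveZ a (derivableP d0)) (is_deriveZ b (derivableP d1))).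
Qed.

Lemma enorm_invmx (A : 'M[R]_n) (m : R) v : 0 < m ->
  (forall u, m * dotv u u <= dotv u (A *m u)) -> enorm (invmx A *m v) <= m^-1 * enorm v.
Proof.
move=> m0 cA; rewrite mulrC ler_pdivlMr// mulrC.
by rewrite -{2}(mulKVmx (coercive_unitmx m0 cA) v) enorm_mulmx_ge.
Qed.

(* invmx A v - invmx B w = invmx A (v - w - (A - B) (invmx B w)) *)
Lemma enorm_invmx_diff (A B : 'M[R]_n) (m : R) v w : 0 < m ->
  (forall u, m * dotv u u <= dotv u (A *m u)) -> B \in unitmx ->
  enorm (invmx A *m v - invmx B *m w) <=
    m^-1 * (enorm (v - w) + specnorm (A - B) * enorm (invmx B *m w)).
Proof.
move=> m0 cA Bu; have Au := coercive_unitmx m0 cA; set z := invmx B *m w.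
have -> : invmx A *m v - z = invmx A *m (v - w - (A - B) *m z).
  rewrite mulmxBl {2}/z mulKVmx// opprB addrA subrK.
  by rewrite mulmxBr mulKmx.
rewrite (le_trans (enorm_invmx _ m0 cA))// ler_wpM2l ?invr_ge0 ?(ltW m0)//.
by rewrite (le_trans (enormB _ _))// lerD2l enorm_mulmx.
Qed.

Lemma min_eigenvalue_lip (A B : 'M[R]_n) : (0 < n)%N -> A^T = A -> B^T = B ->
  min_eigenvalue A - specnorm (A - B) <= min_eigenvalue B.
Proof.
move=> n0 At Bt; apply/(min_eigenvalueP Bt n0).
by apply: coercive_perturb (lexx _); exact/(min_eigenvalueP At n0).
Qed.

Lemma min_eigenvalue_le_specnorm (A : 'M[R]_n) : (0 < n)%N -> A^T = A ->
  min_eigenvalue A <= specnorm A.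
Proof.
move=> n0 At; have := (min_eigenvalueP At n0 _).1 (lexx _).
set v := delta_mx (Ordinal n0) 0 : 'cV[R]_n => H.
have v0 : 0 < enorm v.
  rewrite enorm_gt0; apply/eqP => /colP/(_ (Ordinal n0)); rewrite !mxE !eqxx.
  by move/eqP; rewrite oner_eq0.
have := enorm_mulmx_ge v H => /le_trans /(_ (enorm_mulmx A v)).
by rewrite ler_pM2r.
Qed.

Variable J : 'I_2 -> 'cV[R]_n -> R.
Hypothesis J_C2 : forall i, twice_continuously_differentiable (J i).
Let dJ i x : differentiable (J i) x. Proof. by have [] := J_C2 i. Qed.
Let dgJ i x : differentiable (grad (J i)) x. Proof. by have [] := J_C2 i. Qed.

Lemma grad_Jw t x : grad (Jw J t) x = (1 - t) *: grad (J 0) x + t *: grad (J 1) x.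
Proof.
apply/colP => i; rewrite !mxE -derive_lincomb//; exact: diff_derivable.
Qed.

Lemma grad_JwE t : grad (Jw J t) = (1 - t) *: grad (J 0) + t *: grad (J 1).
Proof. by apply/funext => x; rewrite grad_Jw. Qed.

Lemma hess_Jw t x : hess (Jw J t) x = (1 - t) *: hess (J 0) x + t *: hess (J 1) x.
Proof.
have dw : differentiable (grad (Jw J t)) x.
  by rewrite grad_JwE; apply: differentiableD; exact: differentiableZ.
apply/matrixP => i j.
have hE g : hess g x i j = 'D_(delta_mx j 0) (fun y => grad g y i 0) x by rewrite mxE.
have E k1 k2 (a b : R) (u w : 'M[R]_(k1, k2)) k l :
  (a *: u + b *: w) k l = a * u k l + b * w k l by rewrite !mxE.
have d0 : derivable (fun y => grad (J 0) y i 0) x (delta_mx j 0).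
  exact/diff_derivable/grad_coord_differentiable.
have d1 : derivable (fun y => grad (J 1) y i 0) x (delta_mx j 0).
  exact/diff_derivable/grad_coord_differentiable.
apply: etrans (hE _) _; apply: etrans _ (esym (E _ _ _ _ _ _ i j)).
have -> : (fun y => grad (Jw J t) y i 0) =
    (fun y => (1 - t) * grad (J 0) y i 0 + t * grad (J 1) y i 0).
  by apply/funext => y; rewrite grad_Jw; exact: E.
apply: etrans (derive_lincomb _ _ d0 d1) _.
by congr (_ * _ + _ * _); exact: esym (hE _).
Qed.

Lemma Jw_C2 t : twice_continuously_differentiable (Jw J t).
Proof.
split=> [x|x|x].
- have -> : Jw J t = ((1 - t) *: J 0 + t *: J 1) by [].
  apply: differentiableD; apply: differentiableZ; exact: dJ.
- rewrite grad_JwE; apply: differentiableD; apply: differentiableZ; exact: dgJ.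
- rewrite (_ : hess (Jw J t) = (fun x => (1 - t) *: hess (J 0) x + t *: hess (J 1) x)); last first.
    by apply/funext => y; rewrite hess_Jw.
  have [_ _ h0] := J_C2 0; have [_ _ h1] := J_C2 1.
  by apply: (@cvgD _ _ _ _ (nbhs_filter x)); apply: (@cvgZ _ _ _ _ (nbhs_filter x));
    [exact: cvg_cst|exact: h0|exact: cvg_cst|exact: h1].
Qed.

Lemma hess_Jw_sym t x : (hess (Jw J t) x)^T = hess (Jw J t) x.
Proof. exact/hess_sym/Jw_C2. Qed.

(** The bound [m <= Lambda] in terms of the quadratic form; it gives invertibility of the Hessian
    and norm bounds on its inverse directly. *)
Definition coercive (m : R) p : Prop :=
  forall v, m * dotv v v <= dotv v (hess (Jw J p.1) p.2 *m v).

Lemma coercive_Lambda m p : (0 < n)%N -> coercive m p <-> m <= Lambda J p.1 p.2.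
Proof. by move=> n0; split=> /(min_eigenvalueP (hess_Jw_sym _ _) n0). Qed.

Lemma coercive_rhs_dom m p : 0 < m -> 0 <= p.1 <= 1 -> coercive m p -> rhs_dom J p.
Proof. by move=> m0 p01 cp; split=> //; exact: coercive_unitmx m0 cp. Qed.

Let gd p := grad (J 0) p.2 - grad (J 1) p.2.

Lemma enorm_rhs m p : 0 < m -> coercive m p -> enorm (rhs J p) <= m^-1 * enorm (gd p).
Proof. exact: enorm_invmx. Qed.

Lemma enorm_rhs_diff m p q : 0 < m -> coercive m p ->
  hess (Jw J q.1) q.2 \in unitmx ->
  enorm (rhs J p - rhs J q) <= m^-1 * (enorm (gd p - gd q) +
    specnorm (hess (Jw J p.1) p.2 - hess (Jw J q.1) q.2) * enorm (rhs J q)).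
Proof. exact: enorm_invmx_diff. Qed.

Hypothesis J_lip : forall i, locally_lipschitz setT (hess (J i)).

(** Points are measured in the maximum norm, values in the Euclidean and spectral norms. The domain
    is a ball because gradient differences are estimated along segments. *)
Definition derivatives_bound (g : 'cV[R]_n -> R) (M K : R) : Prop :=
  [/\ forall y, `|y| <= M -> enorm (grad g y) <= K,
      forall y, `|y| <= M -> specnorm (hess g y) <= K,
      forall y z, `|y| <= M -> `|z| <= M ->
        enorm (grad g y - grad g z) <= K * `|y - z| &
      forall y z, `|y| <= M -> `|z| <= M ->
        specnorm (hess g y - hess g z) <= K * `|y - z|].

Lemma norm_bound (W : normedModType R) (f : 'cV[R]_n -> W) (M : R) : continuous f ->
  exists2 K, 0 <= K & forall y, `|y| <= M -> `|f y| <= K.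
Proof.
move=> fc; pose A := [set y : 'cV[R]_n | `|y - 0| <= M].
(* The ball is empty if [M] is negative. *)
have [/set0P A0|A0] := boolP (A != set0); last first.
  exists 0 => // y yM; exfalso; move/negP: A0; apply; apply/set0P; exists y.
  by rewrite /A/= subr0.
have cc : {within A, continuous (fun y => `|f y|)}.
  apply: continuous_subspaceT => y.
  exact: (@cvg_norm _ _ _ _ (nbhs_filter y) f (f y) (fc y)).
have [c _ cP] := compact_EVT_max A0 (@cV_closed_ball_compact R n 0 M) cc.
exists `|f c| => // y yM; apply: cP; apply/mem_set; by rewrite /A/= subr0.
Qed.

Lemma exists_derivatives_bound M :
  exists2 K, 0 < K & forall i, derivatives_bound (J i) M K.
Proof.
have H i : exists2 K, 0 < K & derivatives_bound (J i) M K.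
  have [_ _ hc] := J_C2 i.
  have gc : continuous (grad (J i)) by move=> x; exact: differentiable_continuous.
  have [G G0 GP] := norm_bound M gc.
  have [H H0 HP] := norm_bound M hc.
  have Bc := @cV_closed_ball_compact R n 0 M.
  have [L L0 LP] := locally_lipschitz_compact (J_lip i) Bc (fun _ _ => I).
  pose N : R := n%:R * (n%:R * H).
  have N0 : 0 <= N by rewrite !mulr_ge0.
  have hN y : `|y| <= M -> specnorm (hess (J i) y) <= N.
    by move=> yM; rewrite (le_trans (specnorm_le_norm _))// !ler_wpM2l// HP.
  (* After the 1, which ensures positivity, the summands bound in turn the gradient, the Hessian,
     and the Lipschitz constants of the gradient and of the Hessian. *)
  exists (1 + n%:R * G + N + N * n%:R + n%:R * (n%:R * L)).
    by rewrite !ltr_wpDr ?mulr_ge0 ?(ltW L0).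
  have P1 : 0 <= n%:R * G by rewrite mulr_ge0.
  have P2 : 0 <= N * n%:R by rewrite mulr_ge0.
  have P3 : 0 <= n%:R * (n%:R * L) by rewrite !mulr_ge0 ?(ltW L0).
  split=> [y yM|y yM|y z yM zM|y z yM zM].
  - rewrite (le_trans (enorm_le_norm _))//.
    by rewrite (@le_trans _ _ (n%:R * G)) ?ler_wpM2l ?GP//; lra.
  - by have := hN _ yM; lra.
  - rewrite (@le_trans _ _ (N * enorm (y - z)))//.
      apply: enorm_grad_diff => // s s01; apply: hN.
      rewrite (_ : z + _ = s *: y + (1 - s) *: z); last first.
        by rewrite scalerBr scalerBl scale1r addrCA addrA.
      rewrite (le_trans (ler_normD _ _))// !normrZ !gtr0_norm; [|lra|lra].
      by have := normr_ge0 y; nra.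
    rewrite (@le_trans _ _ (N * n%:R * `|y - z|))//.
      by rewrite -mulrA ler_wpM2l// enorm_le_norm.
    by rewrite ler_wpM2r//; lra.
  - rewrite (le_trans (specnorm_le_norm _))//.
    rewrite (@le_trans _ _ (n%:R * (n%:R * L) * `|y - z|))//.
      by rewrite -!mulrA !ler_wpM2l// LP//= subr0.
    by rewrite ler_wpM2r//; lra.
have [K K0 KP] := H 0; have [K' K'0 KP'] := H 1.
exists (K + K') => [|i]; first by rewrite addr_gt0.
have [k kK kP] : exists2 k, k <= K + K' & derivatives_bound (J i) M k.
  case: i => [[|[|//]] i2].
    by exists K; [lra|rewrite (_ : Ordinal i2 = 0)//; exact: val_inj].
  by exists K'; [lra|rewrite (_ : Ordinal i2 = 1)//; exact: val_inj].
have [h1 h2 h3 h4] := kP.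
split=> [y /h1|y /h2|y z yM zM|y z yM zM].
- by move/le_trans; apply.
- by move/le_trans; apply.
- by rewrite (le_trans (h3 _ _ yM zM))// ler_wpM2r.
- by rewrite (le_trans (h4 _ _ yM zM))// ler_wpM2r.
Qed.

End Scalarization.

(** * Constants on a tube *)

Section TubeConstants.
Set Implicit Arguments.
Unset Strict Implicit.
Context {R : realType} {n : nat}.
Implicit Types (y z v : 'cV[R]_n) (t s : R).

(** [sup] has a default value on unbounded sets, so each use of it below comes with an explicit
    bound [K]. *)
Lemma sup_image_bounds (T : Type) (f : T -> R) (A : set T) a (K : R) : A a ->
  (forall b, A b -> f b <= K) -> f a <= sup [set f b | b in A] <= K.
Proof.
move=> Aa fK; have ub : ubound [set f b | b in A] K by move=> _ [b Ab <-]; exact: fK.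
apply/andP; split; first by apply: ub_le_sup; [exists K|exists a].
by apply: ge_sup => //; exists (f a), a.
Qed.

Lemma sup_image_ge (T : Type) (f : T -> R) (A : set T) a (K : R) : A a ->
  (forall b, A b -> f b <= K) -> f a <= sup [set f b | b in A].
Proof. by move=> Aa fK; have /andP[] := sup_image_bounds Aa fK. Qed.

Variable J : 'I_2 -> 'cV[R]_n -> R.
Hypothesis n_gt0 : (0 < n)%N.
Hypothesis J_C2 : forall i, twice_continuously_differentiable (J i).
Hypothesis J_lip : forall i, locally_lipschitz setT (hess (J i)).

Lemma ord2P (P : 'I_2 -> Prop) : P 0 -> P 1 -> forall i, P i.
Proof.
move=> P0 P1 [[|[|//]] i2].
  by rewrite (_ : Ordinal i2 = 0)//; exact: val_inj.
by rewrite (_ : Ordinal i2 = 1)//; exact: val_inj.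
Qed.

Variables (x : R -> 'cV[R]_n) (l u : R).
Hypothesis lu : l <= u.
Hypothesis xc : wcont `[l, u] x.
Hypothesis Lpos : forall t, l <= t <= u -> 0 < Lambda J t (x t).
Hypothesis l_ge0 : 0 <= l.
Hypothesis u_le1 : u <= 1.
Local Notation I := `[l, u]%classic.

Let tI t : l <= t <= u -> 0 <= t <= 1.
Proof. by case/andP => lt tu; rewrite (le_trans l_ge0 lt) (le_trans tu u_le1). Qed.

Lemma curve_bounded : exists M, forall t, l <= t <= u -> `|x t| <= M.
Proof.
have nc : {within I, continuous (fun t => `|x t|)}.
  by apply/wcontP => t It; apply: cvg_norm; exact: xc.
have [c _ cP] := EVT_max lu nc.
by exists `|x c| => t tlu; apply: cP; rewrite in_itv.
Qed.

(** Weyl's inequality makes the smallest eigenvalue Lipschitz in the matrix, and the Hessian is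
    continuous along the curve. *)
Lemma Lambda_wcont : wcont I (fun t => Lambda J t (x t)).
Proof.
move=> t It.
have FF : Filter (within I (nbhs t)) by exact: within_filter.
have hc i : hess (J i) (x s) @[s --> within I (nbhs t)] --> hess (J i) (x t).
  have [_ _ hJ] := J_C2 i.
  exact: (@cvg_comp _ _ _ x (hess (J i)) _ _ _ (xc It) (hJ (x t))).
have Ac : hess (Jw J s) (x s) @[s --> within I (nbhs t)] --> hess (Jw J t) (x t).
  have tc : s @[s --> within I (nbhs t)] --> t by apply: cvg_within_filter; exact: cvg_id.
  rewrite hess_Jw//; under eq_cvg do rewrite hess_Jw//.
  apply: cvgD; apply: cvgZ; [|exact: hc|exact: tc|exact: hc].
  by apply: cvgB; [exact: cvg_cst|exact: tc].
pose N : R := n%:R * n%:R + 1.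
have N0 : 0 < N by rewrite ltr_wpDl// mulr_ge0.
have lipN (A B : 'M[R]_n) : A^T = A -> B^T = B ->
    min_eigenvalue A - min_eigenvalue B <= N * `|A - B|.
  move=> At Bt; rewrite lerBlDr -lerBlDl (le_trans _ (min_eigenvalue_lip n_gt0 At Bt))//.
  rewrite lerB// (le_trans (specnorm_le_norm _))// mulrA ler_wpM2r//.
  by rewrite lerDl.
apply/cvgrPdist_le => e e0.
have /cvgrPdist_le /(_ (e / N)) := Ac; rewrite divr_gt0// => /(_ isT).
apply: filterS => s; rewrite ler_pdivlMr// mulrC => Ns.
have h1 := lipN _ _ (hess_Jw_sym J_C2 t (x t)) (hess_Jw_sym J_C2 s (x s)).
have h2 := lipN _ _ (hess_Jw_sym J_C2 s (x s)) (hess_Jw_sym J_C2 t (x t)).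
rewrite /Lambda; move: (hess _ (x t)) (hess _ (x s)) h1 h2 Ns => A B h1 h2 Ns.
rewrite ler_norml lerNl opprB; apply/andP; split; last exact: le_trans h1 Ns.
by rewrite (le_trans h2)// distrC.
Qed.

Lemma LambdaI_le t : l <= t <= u -> LambdaI J x I <= Lambda J t (x t).
Proof.
move=> tlu; apply: ge_inf; last by exists t => //=; rewrite in_itv.
by exists 0 => _ [s + <-]; rewrite /= in_itv/= => /Lpos/ltW.
Qed.

Lemma LambdaI_gt0 : 0 < LambdaI J x I.
Proof.
have [c] := EVT_min lu ((wcontP _ _).1 Lambda_wcont).
rewrite in_itv/= => cI cmin; apply: (lt_le_trans (Lpos cI)).
apply: lb_le_inf; first by exists (Lambda J l (x l)), l => //=; rewrite in_itv/= lexx.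
by move=> _ [s Is <-]; exact: cmin.
Qed.

Section Delta.
Variable delta : R.
Hypothesis delta_gt0 : 0 < delta.

Lemma eball_center t : eball (x t) delta (x t).
Proof. by rewrite /eball/= subrr enorm0. Qed.

(** One finite constant for the whole tube; it shows that the suprema and infima defining [L_HI],
    [C_1I] and [C_2I] are genuine. *)
Lemma tube_bound : exists2 K, 0 < K & forall t y, l <= t <= u ->
  eball (x t) delta y -> forall i,
  [/\ enorm (grad (J i) y) <= K, specnorm (hess (J i) y) <= K &
   forall z, eball (x t) delta z ->
     specnorm (hess (J i) y - hess (J i) z) <= K * enorm (y - z)].
Proof.
have [M MP] := curve_bounded.
have [K K0 KP] := exists_derivatives_bound J_C2 J_lip (M + delta).
have tubeM t y : l <= t <= u -> eball (x t) delta y -> `|y| <= M + delta.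
  move=> /MP xM yd; rewrite -(subrK (x t) y) addrC (le_trans (ler_normD _ _))//.
  by rewrite lerD// (le_trans (norm_le_enorm _))// ltW.
exists K => // t y tlu yd i; have [h1 h2 h3 h4] := KP i.
have yM := tubeM _ _ tlu yd.
split=> [||z zd]; [exact: h1|exact: h2|].
have zM := tubeM _ _ tlu zd.
by rewrite (le_trans (h4 _ _ yM zM))// ler_wpM2l ?(ltW K0)// norm_le_enorm.
Qed.

Let LHset t := [set L | 0 <= L /\ forall i x' x'',
         eball (x t) delta x' -> eball (x t) delta x'' ->
         specnorm (hess (J i) x' - hess (J i) x'') <= L * enorm (x' - x'')].

Lemma L_H_bounds : exists2 K, 0 < K &
  forall t, l <= t <= u -> 0 <= L_H J (x t) delta <= K /\ LHset t K.
Proof.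
have [K K0 KP] := tube_bound.
exists K => // t tlu.
have SK : LHset t K.
  split=> [|i y z yd zd]; first exact: ltW.
  by have [_ _] := KP t y tlu yd i; apply.
split=> //; apply/andP; split.
  by apply: lb_le_inf; [exists K|move=> ? []].
by apply: ge_inf => //; exists 0 => ? [].
Qed.

Lemma L_HI_ge0 : 0 <= L_HI J x I delta.
Proof.
have [K K0 KP] := L_H_bounds.
have Il : l <= l <= u by rewrite lexx.
have [/andP[h0 _] _] := KP l Il; apply: (le_trans h0).
apply: (@sup_image_ge _ (fun t => L_H J (x t) delta) I l K).
  by rewrite /= in_itv.
by move=> t; rewrite /= in_itv => /KP[/andP[]].
Qed.

(** The infimum in [L_H] is attained: for distinct points the difference quotient of the Hessian is
    a lower bound of all admissible constants, hence at most their infimum. *)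
Lemma hess_tube_lip t i y z : l <= t <= u -> eball (x t) delta y -> eball (x t) delta z ->
  specnorm (hess (J i) y - hess (J i) z) <= L_HI J x I delta * enorm (y - z).
Proof.
move=> tlu yd zd; have [K K0 KP] := L_H_bounds; have [_ SK] := KP t tlu.
apply: (@le_trans _ _ (L_H J (x t) delta * enorm (y - z))); last first.
  rewrite ler_wpM2r ?enorm_ge0//.
  apply: (@sup_image_ge _ (fun t => L_H J (x t) delta) I t K).
    by rewrite /= in_itv.
  by move=> s; rewrite /= in_itv => /KP[/andP[]].
have [yz|yz] := eqVneq (enorm (y - z)) 0.
  by have := SK.2 i y z yd zd; rewrite yz !mulr0.
have yz0 : 0 < enorm (y - z) by rewrite lt_def yz enorm_ge0.
rewrite -ler_pdivrMr//; apply: lb_le_inf; first by exists K.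
by move=> L [_ HL]; rewrite ler_pdivrMr// HL.
Qed.

Lemma grad_tube_le t i y : l <= t <= u -> eball (x t) delta y ->
  enorm (grad (J i) y) <= C_1I J x I delta.
Proof.
move=> tlu yd; have [K K0 KP] := tube_bound.
have gK j s : l <= s <= u -> forall y, eball (x s) delta y ->
    enorm (grad (J j) y) <= sup [set enorm (grad (J j) x') | x' in eball (x s) delta] <= K.
  move=> slu y' y'd; apply: (@sup_image_bounds _ (fun y => enorm (grad (J j) y))) => // z zd.
  by have [] := KP s z slu zd j.
have C1K s : l <= s <= u -> C_1 J (x s) delta <= K.
  move=> slu; rewrite /C_1 ge_max; apply/andP; split.
    by have /andP[] := gK 0 s slu _ (eball_center s).
  by have /andP[] := gK 1 s slu _ (eball_center s).
apply: (@le_trans _ _ (C_1 J (x t) delta)); last first.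
  apply: (@sup_image_ge _ (fun t => C_1 J (x t) delta) I t K).
    by rewrite /= in_itv.
  by move=> s; rewrite /= in_itv => /C1K.
rewrite /C_1 le_max; apply/orP; move: i; apply: ord2P.
  by left; have /andP[] := gK 0 t tlu y yd.
by right; have /andP[] := gK 1 t tlu y yd.
Qed.

Lemma hess_tube_le t i y : l <= t <= u -> eball (x t) delta y ->
  specnorm (hess (J i) y) <= C_2I J x I delta.
Proof.
move=> tlu yd; have [K K0 KP] := tube_bound.
have gK j s : l <= s <= u -> forall y, eball (x s) delta y ->
    specnorm (hess (J j) y) <= sup [set specnorm (hess (J j) x') | x' in eball (x s) delta] <= K.
  move=> slu y' y'd; apply: (@sup_image_bounds _ (fun y => specnorm (hess (J j) y))) => // z zd.
  by have [] := KP s z slu zd j.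
have C2K s : l <= s <= u -> C_2 J (x s) delta <= K.
  move=> slu; rewrite /C_2 ge_max; apply/andP; split.
    by have /andP[] := gK 0 s slu _ (eball_center s).
  by have /andP[] := gK 1 s slu _ (eball_center s).
apply: (@le_trans _ _ (C_2 J (x t) delta)); last first.
  apply: (@sup_image_ge _ (fun t => C_2 J (x t) delta) I t K).
    by rewrite /= in_itv.
  by move=> s; rewrite /= in_itv => /C2K.
rewrite /C_2 le_max; apply/orP; move: i; apply: ord2P.
  by left; have /andP[] := gK 0 t tlu y yd.
by right; have /andP[] := gK 1 t tlu y yd.
Qed.

Lemma specnorm_lincomb (A B : 'M[R]_n) t (c : R) : 0 <= t <= 1 ->
  specnorm A <= c -> specnorm B <= c -> specnorm ((1 - t) *: A + t *: B) <= c.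
Proof.
move=> t01 Ac Bc; rewrite (le_trans (specnormD _ _))//.
have := specnormZ (1 - t) A; have := specnormZ t B.
rewrite !ger0_norm; [|lra|lra].
have := specnorm_ge0 A; have := specnorm_ge0 B.
move: (specnorm A) (specnorm B) (specnorm (_ *: A)) (specnorm (_ *: B)) Ac Bc => p q p' q'.
by nra.
Qed.

Lemma hess_Jw_tube_lip t y z : l <= t <= u -> eball (x t) delta y -> eball (x t) delta z ->
  specnorm (hess (Jw J t) y - hess (Jw J t) z) <= L_HI J x I delta * enorm (y - z).
Proof.
move=> tlu yd zd; rewrite !(hess_Jw J_C2).
have -> (A B C D : 'M[R]_n) (p q : R) : p *: A + q *: B - (p *: C + q *: D) =
    p *: (A - C) + q *: (B - D) by rewrite opprD addrACA -!scalerBr.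
apply: specnorm_lincomb; first exact: tI.
  exact: (hess_tube_lip _ tlu).
exact: (hess_tube_lip _ tlu).
Qed.

(** C_2 dominates the spectral norm of a Hessian whose smallest eigenvalue is positive. This makes
    [L_f] positive, so that dividing by it is legitimate. *)
Lemma C_2I_gt0 : 0 < C_2I J x I delta.
Proof.
have Il : l <= l <= u by rewrite lexx.
apply: (lt_le_trans (Lpos Il)); rewrite /Lambda.
rewrite (le_trans (min_eigenvalue_le_specnorm n_gt0 (hess_Jw_sym J_C2 _ _)))//.
rewrite (hess_Jw J_C2); apply: specnorm_lincomb; first exact: tI.
  exact: (hess_tube_le _ Il (eball_center l)).
exact: (hess_tube_le _ Il (eball_center l)).
Qed.

Lemma C_1I_ge0 : 0 <= C_1I J x I delta.
Proof.
have Il : l <= l <= u by rewrite lexx.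
by rewrite (le_trans (enorm_ge0 _) (grad_tube_le 0 Il (eball_center l))).
Qed.

Local Notation m := (LambdaI J x I - delta * L_HI J x I delta).

(** If [L_HI] is 0, the difference is [LambdaI], positive as a minimum over a compact interval;
    otherwise the quotient condition is multiplied out. *)
Lemma admissible_radius_gt0 : admissible_radius J x I delta -> 0 < m.
Proof.
move=> [_ H]; have [L0|L0] := eqVneq (L_HI J x I delta) 0.
  by rewrite L0 mulr0 subr0 LambdaI_gt0.
have := H L0; rewrite ltr_pdivlMr ?subr_gt0// lt_def L0.
exact: L_HI_ge0.
Qed.

Lemma tube_coercive t y : l <= t <= u -> eball (x t) delta y -> coercive J m (t, y).
Proof.
move=> tlu yd.
have cx : forall v, LambdaI J x I * dotv v v <= dotv v (hess (Jw J t) (x t) *m v).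
  by apply/(@coercive_Lambda R n J J_C2 _ (t, x t) n_gt0); exact: LambdaI_le.
apply: (coercive_perturb cx).
rewrite (le_trans (hess_Jw_tube_lip tlu (eball_center t) yd))// mulrC.
by rewrite ler_wpM2r ?L_HI_ge0// enorm_distC ltW.
Qed.

Lemma L_f_gt0 : admissible_radius J x I delta -> 0 < L_f J x I delta.
Proof.
move=> /admissible_radius_gt0 m0; rewrite /L_f mulr_gt0//; apply: ltr_wpDr.
  by apply: mulr_ge0; [apply: mulr_ge0; [exact: sqr_ge0|exact: L_HI_ge0]|exact: C_1I_ge0].
by apply: divr_gt0 => //; exact: C_2I_gt0.
Qed.

(** The two terms of [L_f] are those of [enorm_rhs_diff]: the difference of grad J_0 - grad J_1 is
    at most 2 C_2 |y - x|, and the Hessian difference acts on f at the centre, which is at most 2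
    C_1 / m. *)
Lemma rhs_tube_lip t y : admissible_radius J x I delta -> l <= t <= u ->
  eball (x t) delta y ->
  enorm (rhs J (t, y) - rhs J (t, x t)) <= L_f J x I delta * enorm (y - x t).
Proof.
move=> /admissible_radius_gt0 m0 tlu yd; have xd := eball_center t.
have cx := tube_coercive tlu xd; have cy := tube_coercive tlu yd.
have hd := enorm_rhs_diff m0 cy (coercive_unitmx m0 cx).
have hx := enorm_rhs m0 cx.
have hl := hess_Jw_tube_lip tlu yd xd.
have gl i : enorm (grad (J i) y - grad (J i) (x t)) <= C_2I J x I delta * enorm (y - x t).
  apply: enorm_grad_diff => [z|s s01]; first by have [] := J_C2 i.
  apply: (hess_tube_le _ tlu); rewrite /eball/= addrC addKr enormZ gtr0_norm; last lra.
  have := enorm_ge0 (y - x t); move: yd; rewrite /eball/=; nra.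
have g1 i := grad_tube_le i tlu xd.
have vl : enorm (grad (J 0) y - grad (J 1) y - (grad (J 0) (x t) - grad (J 1) (x t)))
    <= 2 * C_2I J x I delta * enorm (y - x t).
  rewrite opprD addrACA -opprD (le_trans (enormB _ _))//.
  by rewrite -mulrA mulr_natl mulr2n; apply: lerD; exact: gl.
have vx : enorm (grad (J 0) (x t) - grad (J 1) (x t)) <= 2 * C_1I J x I delta.
  by rewrite (le_trans (enormB _ _))// mulr_natl mulr2n; apply: lerD; exact: g1.
have m0' : 0 < m^-1 by rewrite invr_gt0.
have SL : specnorm (hess (Jw J t) y - hess (Jw J t) (x t)) * enorm (rhs J (t, x t)) <=
    L_HI J x I delta * enorm (y - x t) * (m^-1 * (2 * C_1I J x I delta)).
  apply: ler_pM; [exact: specnorm_ge0|exact: enorm_ge0|exact: hl|].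
  by apply: (le_trans hx); rewrite ler_pM2l.
apply: (le_trans hd); rewrite /L_f.
apply: (@le_trans _ _ (m^-1 * (2 * C_2I J x I delta * enorm (y - x t) +
    L_HI J x I delta * enorm (y - x t) * (m^-1 * (2 * C_1I J x I delta))))).
  by rewrite ler_pM2l// lerD.
by rewrite le_eqVlt; apply/orP; left; apply/eqP; ring.
Qed.

End Delta.

(** The condition is implicit, as [L_HI] depends on [delta]. For [delta] at most 1, however, [L_HI]
    is bounded by a constant [K] valid for radius 1, and [delta] at most LambdaI / (2 K)
    suffices. *)
Lemma exists_admissible_radius : exists delta, admissible_radius J x I delta.
Proof.
have [K K0 KP] := tube_bound 1; have L0 := LambdaI_gt0.
pose d := Num.min 1 (LambdaI J x I / (2 * K)).
have d0 : 0 < d by rewrite lt_min ltr01 divr_gt0// mulr_gt0.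
have d1 : d <= 1 by rewrite ge_min lexx.
have Il : l <= l <= u by rewrite lexx.
have sub t y : eball (x t) d y -> eball (x t) 1 y by move=> /lt_le_trans; apply.
have LK : L_HI J x I d <= K.
  apply: ge_sup; first by exists (L_H J (x l) d), l => //; rewrite /= in_itv.
  move=> _ [t /= + <-]; rewrite in_itv/= => tlu.
  apply: ge_inf; first by exists 0 => ? [].
  split=> [|i y z /sub yd /sub zd]; first exact: ltW.
  by have [_ _] := KP t y tlu yd i; apply.
exists d; split=> // LH0.
have LHpos : 0 < L_HI J x I d by rewrite lt_def LH0 L_HI_ge0.
rewrite ltr_pdivlMr// (le_lt_trans (ler_wpM2l (ltW d0) LK))//.
have /(ler_wpM2r (ltW K0)) dK : d <= LambdaI J x I / (2 * K) by rewrite ge_min lexx orbT.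
rewrite (le_lt_trans dK)// invfM mulrA divfK ?gt_eqF//.
by rewrite ltr_pdivrMr// ltr_pMr// ltr1n.
Qed.

End TubeConstants.

(** * Comparison with a reference curve, and existence near it *)

Section Perturbation.
Set Implicit Arguments.
Unset Strict Implicit.
Context {R : realType} {n : nat}.
Implicit Types (v : 'cV[R]_n) (s t : R) (p q : R * 'cV[R]_n).

Variable J : 'I_2 -> 'cV[R]_n -> R.
Hypothesis n_gt0 : (0 < n)%N.
Hypothesis J_C2 : forall i, twice_continuously_differentiable (J i).
Hypothesis J_lip : forall i, locally_lipschitz setT (hess (J i)).

(** What the comparison needs of the reference curve. The equation is imposed in the interior only,
    so that the restriction of a solution to a compact subinterval qualifies. *)
Record regular_curve (l u : R) (x : R -> 'cV[R]_n) : Prop := RegularCurve {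
  rc_le : l <= u;
  rc_ge0 : 0 <= l;
  rc_le1 : u <= 1;
  rc_cont : wcont `[l, u] x;
  rc_pos : forall t, l <= t <= u -> 0 < Lambda J t (x t);
  rc_der : forall t, l < t < u -> is_derive t 1 x (rhs J (t, x t)) }.

Variables (x : R -> 'cV[R]_n) (l u : R).
Hypothesis xR : regular_curve l u x.
Variable delta : R.
Local Notation I := `[l, u]%classic.
Hypothesis adm : admissible_radius J x I delta.
Local Notation Lf := (L_f J x I delta).
Local Notation m := (LambdaI J x I - delta * L_HI J x I delta).

Lemma regular_m_gt0 : 0 < m.
Proof. by case: xR => *; apply: admissible_radius_gt0 => //; case: adm. Qed.

Lemma regular_L_f_gt0 : 0 < Lf.
Proof. by case: xR => *; apply: L_f_gt0 => //; case: adm. Qed.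

Lemma regular_coercive t v : l <= t <= u -> enorm (v - x t) < delta -> coercive J m (t, v).
Proof. by move=> tlu vd; case: xR => *; apply: tube_coercive => //; case: adm. Qed.

Lemma regular_rhs_lip t v : l <= t <= u -> enorm (v - x t) < delta ->
  enorm (rhs J (t, v) - rhs J (t, x t)) <= Lf * enorm (v - x t).
Proof. by move=> tlu vd; case: xR => *; apply: rhs_tube_lip => //; case: adm. Qed.

Section Compare.
Variables (r eta : R) (y y' : R -> 'cV[R]_n).
Hypothesis rd : r < delta.
Hypothesis eta_ge0 : 0 <= eta.
Hypothesis yc : wcont I y.
Hypothesis yd : forall t, l < t < u -> is_derive t 1 y (y' t).
Hypothesis yeta : forall t, l < t < u -> enorm (y t - x t) <= r ->
  enorm (y' t - rhs J (t, y t)) <= eta.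

Let wc : wcont I (y - x).
Proof. by move=> t It; apply: cvgB; [exact: yc|exact: (rc_cont xR)]. Qed.

Let wd t : l < t < u -> is_derive t 1 (y - x) (y' t - rhs J (t, x t)).
Proof. by move=> tlu; apply: is_deriveB; [exact: yd|exact: (rc_der xR)]. Qed.

Let wle t : l < t < u -> enorm ((y - x) t) <= r ->
  enorm (y' t - rhs J (t, x t)) <= Lf * enorm ((y - x) t) + eta.
Proof.
move=> tlu wr; have tlu' : l <= t <= u by lra.
rewrite (le_trans (enorm_distD (rhs J (t, y t)) _ _))// addrC lerD//.
  by apply: regular_rhs_lip => //; exact: (le_lt_trans wr).
exact: yeta.
Qed.

(** [y] is any curve whose derivative is within [eta] of f while it is in the tube. This covers
    exact solutions, solutions for f_l, and solutions of a field modified outside of the tube. *)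
Lemma perturbed_in_tube s t : l <= s <= u -> l <= t <= u ->
  gbound Lf eta (enorm (y s - x s)) (Num.max (s - l) (u - s)) < r ->
  enorm (y t - x t) < r.
Proof.
move=> slu tlu small.
exact: (@gronwall_tube _ _ (y - x) _ Lf eta r l u s t regular_L_f_gt0 eta_ge0 wc wd wle).
Qed.

Lemma perturbed_le s t : (forall t, l <= t <= u -> enorm (y t - x t) < r) ->
  l <= s <= u -> l <= t <= u ->
  enorm (y t - x t) <= gbound Lf eta (enorm (y s - x s)) `|t - s|.
Proof.
move=> yr slu tlu.
apply: (@gronwall _ _ (y - x) _ Lf eta l u s t regular_L_f_gt0 eta_ge0 wc wd) => //.
by move=> z zlu; apply: wle => //; apply: ltW; apply: yr; lra.
Qed.

End Compare.

(** The maximum norm matches the projection [box] behind [tube_existence]. *)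
Definition closed_tube (r : R) : set (R * 'cV[R]_n) :=
  [set p | l <= p.1 <= u /\ `|p.2 - x p.1| <= r].

(** The tube is the image of interval times ball under the shear (t, v) -> (t, x t + v), continuous
    once [x] is extended by clamping. *)
Lemma closed_tube_compact r : compact (closed_tube r).
Proof.
pose X t := x (clamp l u t).
have Xc : continuous X by apply: clamp_wcont; [exact: (rc_le xR)|exact: (rc_cont xR)].
pose phi p : R * 'cV[R]_n := (p.1, X p.1 + p.2).
have phic : continuous phi.
  move=> p; have h1 : q.1 @[q --> p] --> p.1 by exact: cvg_fst.
  have h2 : X q.1 + q.2 @[q --> p] --> X p.1 + p.2.
    apply: cvgD; last exact: cvg_snd.
    exact: (@cvg_comp _ _ _ fst X _ _ _ h1 (Xc _)).
  exact: (cvg_pair h1 h2).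
have -> : closed_tube r = phi @` (I `*` [set v | `|v - 0| <= r]).
  apply/seteqP; split=> [[t v] [/= tlu vr]|_ [[t v] [/= tI vr] <-]].
    exists (t, v - x t); first by rewrite /= in_itv subr0.
    by rewrite /phi /X/= clamp_id// addrC subrK.
  rewrite in_itv/= in tI; rewrite subr0 in vr.
  by split=> //=; rewrite /X clamp_id// addrC addKr.
apply: continuous_compact; first exact: continuous_subspaceT.
by apply: compact_setX; [exact: segment_compact|exact: cV_closed_ball_compact].
Qed.

Variable r : R.
Hypothesis r_gt0 : 0 < r.
Hypothesis r_small : n%:R * r < delta.

Lemma closed_tube_enorm p : closed_tube r p -> enorm (p.2 - x p.1) < delta.
Proof.
move=> [_ pr]; rewrite (le_lt_trans (enorm_le_norm _))// (le_lt_trans _ r_small)//.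
by rewrite ler_wpM2l.
Qed.

Lemma closed_tube_coercive p : closed_tube r p -> coercive J m p.
Proof.
move=> pT; rewrite (surjective_pairing p); apply: regular_coercive; first by case: pT.
exact: closed_tube_enorm.
Qed.

Lemma closed_tube_rhs_dom : closed_tube r `<=` rhs_dom J.
Proof.
move=> p pT; apply: coercive_rhs_dom regular_m_gt0 _ (closed_tube_coercive pT).
by case: pT => plu _; have := rc_ge0 xR; have := rc_le1 xR; lra.
Qed.

(** The estimate needed for Picard iteration: any two points, possibly with different lambda, in the
    norm of the product space. *)
Lemma rhs_closed_tube_lip : exists2 L, 0 < L &
  forall p q, closed_tube r p -> closed_tube r q ->
    `|rhs J p - rhs J q| <= L * `|p - q|.
Proof.
have [M MP] := curve_bounded (rc_le xR) (rc_cont xR).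
have [K K0 KP] := exists_derivatives_bound J_C2 J_lip (M + r).
have TM p : closed_tube r p -> `|p.2| <= M + r.
  move=> [/MP xM yr]; rewrite -(subrK (x p.1) p.2) addrC (le_trans (ler_normD _ _))//.
  by rewrite lerD.
have m0 := regular_m_gt0; set c := m in m0 *.
have c0 : 0 < c^-1 by rewrite invr_gt0.
exists (c^-1 * (2 * K + 3 * K * (c^-1 * (2 * K)))).
  by rewrite mulr_gt0// addr_gt0// ?mulr_gt0// ?mulr_gt0.
move=> p q pT qT; rewrite (le_trans (norm_le_enorm _))//.
have pd := closed_tube_coercive pT; have qd := closed_tube_coercive qT.
rewrite (le_trans (enorm_rhs_diff m0 pd (coercive_unitmx m0 qd)))//.
have p1 : `|p.1 - q.1| <= `|p - q| by rewrite [leRHS]prod_normE/= le_max lexx.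
have p2 : `|p.2 - q.2| <= `|p - q| by rewrite [leRHS]prod_normE/= le_max lexx orbT.
have pq0 : 0 <= `|p - q| by [].
have pM := TM _ pT; have qM := TM _ qT.
have [g1 h1 gl1 hl1] := KP 0; have [g2 h2 gl2 hl2] := KP 1.
have t01 : 0 <= p.1 <= 1.
  by case: pT => plu _; have := rc_ge0 xR; have := rc_le1 xR; lra.
have b1 : enorm (grad (J 0) p.2 - grad (J 1) p.2 - (grad (J 0) q.2 - grad (J 1) q.2))
    <= 2 * K * `|p - q|.
  rewrite opprD addrACA -opprD (le_trans (enormB _ _))//.
  rewrite -mulrA mulr_natl mulr2n; apply: lerD.
    by rewrite (le_trans (gl1 _ _ pM qM))// ler_pM2l.
  by rewrite (le_trans (gl2 _ _ pM qM))// ler_pM2l.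
have b2 : enorm (rhs J q) <= c^-1 * (2 * K).
  rewrite (le_trans (enorm_rhs m0 qd))// ler_pM2l// (le_trans (enormB _ _))//.
  by rewrite mulr_natl mulr2n; apply: lerD; [exact: g1|exact: g2].
have b3 : specnorm (hess (Jw J p.1) p.2 - hess (Jw J q.1) q.2) <= 3 * K * `|p - q|.
  rewrite !(hess_Jw J_C2).
  have e1 := hl1 _ _ pM qM; have e2 := hl2 _ _ pM qM.
  have e3 := h1 _ qM; have e4 := h2 _ qM.
  move: (hess (J 0) p.2) (hess (J 1) p.2) (hess (J 0) q.2) (hess (J 1) q.2) e1 e2 e3 e4.
  move=> A B C D e1 e2 e3 e4.
  (* The first part moves the point at fixed weight and costs K, the second moves the weight at a
     fixed point and costs 2 K; hence the factor 3 K. *)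
  have -> : (1 - p.1) *: A + p.1 *: B - ((1 - q.1) *: C + q.1 *: D) =
      ((1 - p.1) *: (A - C) + p.1 *: (B - D)) + (p.1 - q.1) *: (D - C).
    by apply/matrixP => i j; rewrite !mxE; ring.
  rewrite (le_trans (specnormD _ _))// (_ : 3 * K * _ = K * `|p - q| + `|p - q| * (2 * K)); last by ring.
  apply: lerD.
    apply: specnorm_lincomb => //.
      by rewrite (le_trans e1)// ler_pM2l.
    by rewrite (le_trans e2)// ler_pM2l.
  rewrite (le_trans (specnormZ _ _))//; apply: ler_pM => //; first exact: specnorm_ge0.
  rewrite (le_trans (specnormD _ _))// specnormN mulr_natl mulr2n.
  exact: lerD.
rewrite -[leRHS]mulrA ler_pM2l// mulrDl lerD//.
by rewrite mulrAC; apply: ler_pM => //; [exact: specnorm_ge0|exact: enorm_ge0].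
Qed.

(** The curve from [tube_existence] satisfies the equation only while it is in the tube. By
    [perturbed_in_tube] it never leaves the Euclidean r-tube, which lies in the maximum-norm one, so
    the modification of the field is never felt. *)
Lemma solve_near (g : R * 'cV[R]_n -> 'cV[R]_n) (L eta t0 : R) (y0 : 'cV[R]_n) :
  0 < L -> 0 <= eta -> l <= t0 <= u ->
  (forall p q, closed_tube r p -> closed_tube r q -> `|g p - g q| <= L * `|p - q|) ->
  (forall p, closed_tube r p -> enorm (g p - rhs J p) <= eta) ->
  gbound Lf eta (enorm (y0 - x t0)) (Num.max (t0 - l) (u - t0)) < r ->
  exists y, y t0 = y0 /\ forall t, l <= t <= u ->
    is_derive t 1 y (g (t, y t)) /\ closed_tube r (t, y t).
Proof.
move=> L0 eta0 t0lu gL geta small.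
have [|y [y' [yt0 yd]]] := @tube_existence R n g x l u t0 r L y0 t0lu (ltW r_gt0) L0 (rc_cont xR).
  by move=> p q ? ? ? ?; apply: gL.
have rd : r < delta.
  by rewrite (le_lt_trans _ r_small)// ler_peMl ?ler1n// ltW.
have yc : wcont I y.
  move=> t; rewrite /= in_itv => tlu; apply: cvg_within_filter.
  by have [h _] := yd _ tlu; exact: is_derive_continuous h.
have yr t : l <= t <= u -> enorm (y t - x t) < r.
  move=> tlu; apply: (@perturbed_in_tube r eta y y' rd eta0 yc _ _ t0 t) => //.
  - by move=> s slu; have slu' : l <= s <= u by [lra|]; have [] := yd _ slu'.
  - move=> s slu sr; have slu' : l <= s <= u by lra.
    have sr' : `|y s - x s| <= r by rewrite (le_trans (norm_le_enorm _)).
    by have [_ ->//] := yd _ slu'; apply: geta.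
  - by rewrite yt0.
exists y; split=> // t tlu.
have tr : `|y t - x t| <= r by rewrite (le_trans (norm_le_enorm _))// ltW// yr.
by split=> //; have [h <-] := yd t tlu.
Qed.

End Perturbation.

(** * Maximal solutions *)

Section MaximalSolutions.
Set Implicit Arguments.
Unset Strict Implicit.
Context {R : realType} {n : nat}.
Implicit Types (s t : R).

Variable J : 'I_2 -> 'cV[R]_n -> R.
Hypothesis n_gt0 : (0 < n)%N.
Hypothesis J_C2 : forall i, twice_continuously_differentiable (J i).
Hypothesis J_lip : forall i, locally_lipschitz setT (hess (J i)).

Lemma is_derive_lincomb (g0 g1 : R -> 'cV[R]_n) (d0 d1 : 'cV[R]_n) (s : R) :
  is_derive s 1 g0 d0 -> is_derive s 1 g1 d1 ->
  is_derive s 1 (fun z => (1 - z) *: g0 z + z *: g1 z)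
    ((1 - s) *: d0 + s *: d1 - (g0 s - g1 s)).
Proof.
move=> gd0 gd1; apply: is_derive_mx => i j.
rewrite (_ : (fun z => _) = (cst 1 - id) * (fun z => g0 z i j) + id * (fun z => g1 z i j)).
  have ? := is_derive_coord i j gd0; have ? := is_derive_coord i j gd1.
  apply: is_derive_eq; rewrite !mxE /GRing.scale/= !fctE.
  by move: (d0 i j) (d1 i j) (g0 s i j) (g1 s i j) => *; ring.
by apply/funext => z; rewrite !mxE.
Qed.

Lemma admissible_ends_le t0 (a b : R) : admissible_ends t0 a b ->
  [/\ 0 <= a, b <= 1, a < b & a <= t0 <= b].
Proof. by move=> [a0 b1 ab H]; split=> //; case: H => [|[]|[]]; lra. Qed.

Lemma interval_aroundP t0 (a b t : R) :
  interval_around t0 a b t <-> a < t < b \/ t = t0.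
Proof. by rewrite /interval_around /setU /= in_itv/=; split. Qed.

Lemma interval_around_segment t0 (a b s t : R) : admissible_ends t0 a b ->
  interval_around t0 a b t -> Num.min t t0 <= s <= Num.max t t0 ->
  interval_around t0 a b s.
Proof.
move=> /admissible_ends_le[_ _ _ t0ab] /interval_aroundP tab ss.
apply/interval_aroundP; have [->|st0] := eqVneq s t0; first by right.
left; case: tab ss => [tab|->]; last by rewrite minxx maxxx -eq_le => /eqP st; rewrite st eqxx in st0.
by move: st0; rewrite neq_lt; case: (leP t t0) => ? /orP[] ?; lra.
Qed.

Lemma interval_around01 t0 (a b : R) : admissible_ends t0 a b ->
  interval_around t0 a b `<=` `[0, 1]%classic.
Proof.
move=> /admissible_ends_le[a0 b1 ab t0ab] t /interval_aroundP tab.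
by rewrite /= in_itv/=; case: tab => [?|->]; lra.
Qed.

Lemma positive_regular t0 y0 (a b l u : R) (y : R -> 'cV[R]_n) :
  positive_solution J t0 y0 a b y -> l <= u ->
  `[l, u]%classic `<=` interval_around t0 a b -> regular_curve J l u y.
Proof.
move=> [adm ode pos] lu sub.
have in01 := interval_around01 adm.
have subI t : l <= t <= u -> interval_around t0 a b t by move=> tlu; apply: sub; rewrite /= in_itv.
have l01 : l <= l <= u by rewrite lexx.
have u01 : l <= u <= u by rewrite lexx lu.
split=> //.
- by have := in01 _ (subI _ l01); rewrite /= in_itv/= => /andP[].
- by have := in01 _ (subI _ u01); rewrite /= in_itv/= => /andP[].
- exact: wcont_sub sub (ode_wcont ode).
- by move=> t /subI /pos.
- move=> t tlu; apply: (ode_is_derive ode).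
  by apply: (filterS sub); exact: itv_nbhs.
Qed.

Lemma segment_sub t0 (a b t : R) : admissible_ends t0 a b ->
  interval_around t0 a b t ->
  `[Num.min t t0, Num.max t t0]%classic `<=` interval_around t0 a b.
Proof. by move=> adm tab s; rewrite /= in_itv; exact: interval_around_segment tab. Qed.

(** Gronwall's inequality around [y] on the segment between [t0] and [t]: with no perturbation and
    no initial distance, [gbound] vanishes, which confines [z] to the tube and then makes it equal
    to [y]. *)
Lemma positive_solution_unique t0 y0 (a b a' b' : R) (y z : R -> 'cV[R]_n) t :
  positive_solution J t0 y0 a b y -> positive_solution J t0 y0 a' b' z ->
  interval_around t0 a b t -> interval_around t0 a' b' t -> y t = z t.
Proof.
move=> yS zS tab tab'.
have [adm [_ yt0 _] _] := yS; have [adm' zO _] := zS; have [_ zt0 _] := zO.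
set l := Num.min t t0; set u := Num.max t t0.
have lu : l <= u by rewrite ge_min le_max lexx.
have yR : regular_curve J l u y by apply: positive_regular yS lu (segment_sub adm tab).
have zR : regular_curve J l u z by apply: positive_regular zS lu (segment_sub adm' tab').
have [delta dP] : exists delta, admissible_radius J y `[l, u] delta.
  by case: yR => *; exact: exists_admissible_radius.
have d0 : 0 < delta by case: dP.
have rd : delta / 2 < delta by rewrite ltr_pdivrMr// ltr_pMr// ltr1n.
have t0lu : l <= t0 <= u by rewrite ge_min le_max lexx !orbT.
have tlu : l <= t <= u by rewrite ge_min le_max lexx.
have zeta s : l < s < u -> enorm (z s - y s) <= delta / 2 ->
    enorm (rhs J (s, z s) - rhs J (s, z s)) <= 0.
  by move=> _ _; rewrite subrr enorm0.
have g0 d : gbound (L_f J y `[l, u] delta) 0 (enorm (z t0 - y t0)) d = 0.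
  by rewrite /gbound zt0 yt0 subrr enorm0 mul0r mulr0 addr0.
have stay s : l <= s <= u -> enorm (z s - y s) < delta / 2.
  move=> slu; apply: (perturbed_in_tube n_gt0 J_C2 J_lip yR dP rd (lexx 0) (rc_cont zR) (rc_der zR) zeta t0lu slu).
  by rewrite g0 divr_gt0.
have := perturbed_le n_gt0 J_C2 J_lip yR dP rd (lexx 0) (rc_cont zR) (rc_der zR) zeta stay t0lu tlu.
rewrite g0 => h; apply/esym/eqP; rewrite -subr_eq0 -enorm_eq0 eq_le h.
exact: enorm_ge0.
Qed.

(** The endpoints are the infimum of all left ends and the supremum of all right ends. Every time
    strictly between is reached by some solution, and uniqueness makes the values consistent. *)
Lemma exists_maximal_solution t0 y0 (a0 b0 : R) (w : R -> 'cV[R]_n) :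
  positive_solution J t0 y0 a0 b0 w ->
  exists a b y, maximal_solution J t0 y0 a b y.
Proof.
move=> wS.
pose A := [set a | exists b z, positive_solution J t0 y0 a b z].
pose B := [set b | exists a z, positive_solution J t0 y0 a b z].
have A0 : A !=set0 by exists a0, b0, w.
have B0 : B !=set0 by exists b0, a0, w.
have Alb : has_lbound A by exists 0 => a [b [z [[]]]].
have Bub : has_ubound B by exists 1 => b [a [z [[]]]].
set a := inf A; set b := sup B.
have ale a' b' z : positive_solution J t0 y0 a' b' z -> a <= a'.
  by move=> zS; apply: ge_inf => //; exists b', z.
have leb a' b' z : positive_solution J t0 y0 a' b' z -> b' <= b.
  by move=> zS; apply: ub_le_sup => //; exists a', z.
have a_ge0 : 0 <= a by apply: lb_le_inf => // ? [? [? [[]]]].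
have b_le1 : b <= 1 by apply: ge_sup => // ? [? [? [[]]]].
have adm : admissible_ends t0 a b.
  have a_a := ale _ _ _ wS; have b_b := leb _ _ _ wS.
  have [[ha hb hab H] _ _] := wS; split=> //; first lra.
  by case: H => H; [apply: Or31|apply: Or32|apply: Or33]; lra.
have t0ab : a <= t0 <= b by have [] := admissible_ends_le adm.
have piece t : interval_around t0 a b t -> exists a' b' z,
    positive_solution J t0 y0 a' b' z /\ interval_around t0 a' b' t.
  move=> /interval_aroundP[tab|->]; last first.
    by exists a0, b0, w; split=> //; apply/interval_aroundP; right.
  have [tt0|t0t|->] := ltgtP t t0; last first.
  - by exists a0, b0, w; split=> //; apply/interval_aroundP; right.
  - have [b' [a' [z zS]] tb'] : exists2 b', B b' & t < b'.
      by apply: (@sup_gt R B t B0); rewrite -/b; lra.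
    exists a', b', z; split=> //; apply/interval_aroundP; left.
    have [zadm _ _] := zS; have [? ? ? ?] := admissible_ends_le zadm; lra.
  - have [a' [b' [z zS]] ta'] : exists2 a', A a' & a' < t.
      by apply: (@inf_lt R A t A0); rewrite -/a; lra.
    exists a', b', z; split=> //; apply/interval_aroundP; left.
    have [zadm _ _] := zS; have [? ? ? ?] := admissible_ends_le zadm; lra.
pose P t v := exists a' b' z, [/\ positive_solution J t0 y0 a' b' z,
  interval_around t0 a' b' t & v = z t].
pose y t := get (P t).
have yE a' b' z t : positive_solution J t0 y0 a' b' z ->
    interval_around t0 a' b' t -> y t = z t.
  move=> zS tz; have : P t (y t) by apply: getPex; exists (z t), a', b', z.
  by move=> [a'' [b'' [z' [z'S tz' ->]]]]; exact: positive_solution_unique z'S zS tz' tz.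
exists a, b, y; split; last by move=> a' b' z zS; split; [exact: ale zS|exact: leb zS].
split=> //; last first.
  move=> t /piece[a' [b' [z [zS tz]]]]; rewrite (yE _ _ _ _ zS tz).
  by have [_ _] := zS; apply.
split; first by apply/interval_aroundP; right.
  have t0z : interval_around t0 a0 b0 t0 by apply/interval_aroundP; right.
  by rewrite (yE _ _ _ _ wS t0z); have [_ []] := wS.
move=> t tab; have [a' [b' [z [zS tz]]]] := piece t tab.
have [zadm [_ _ zD] _] := zS; have [domt zt] := zD t tz.
have [a'0 b'1 ab' t0ab'] := admissible_ends_le zadm.
(* The quotient limit is relative to the union, which is larger than the interval of the piece; near
   [t] the two coincide. If [t = t0] is 0 or 1, this is because neither has points beyond it. *)
have [e e0 near_sub] : exists2 e, 0 < e & forall s, `|t - s| < e ->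
    interval_around t0 a b s -> interval_around t0 a' b' s.
  move: (tz) => /interval_aroundP[tab'|tt0].
    exists (Num.min (t - a') (b' - t)); first by rewrite lt_min; apply/andP; split; lra.
    move=> s; rewrite lt_min !ltr_norml => h _; apply/interval_aroundP; left; lra.
  have [_ _ _ [tab'|[t00 a'00]|[t01 b'01]]] := zadm.
  - exists (Num.min (t - a') (b' - t)); first by rewrite lt_min; apply/andP; split; lra.
    move=> s; rewrite lt_min !ltr_norml => h _; apply/interval_aroundP; left; lra.
  - exists (b' - t); first lra.
    move=> s; rewrite ltr_norml => h /interval_aroundP[sab|->].
      by apply/interval_aroundP; left; lra.
    by apply/interval_aroundP; right.
  - exists (t - a'); first lra.
    move=> s; rewrite ltr_norml => h /interval_aroundP[sab|->].
      by apply/interval_aroundP; left; lra.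
    by apply/interval_aroundP; right.
rewrite (yE _ _ _ _ zS tz); split=> //.
move=> U /zt [e1 /= e10 HU]; exists (Num.min e e1); first by rewrite /= lt_min e0.
move=> s /=; rewrite lt_min => /andP[se se1] snt sab.
have sz := near_sub s se sab.
by rewrite (yE _ _ _ _ zS sz); exact: HU.
Qed.

(* The equation x' = f (t, x) says that the derivative of t |-> grad (Jw J t) (x t) vanishes. *)
Lemma grad_Jw_conserved t0 y0 (a b : R) (y : R -> 'cV[R]_n) t :
  positive_solution J t0 y0 a b y -> interval_around t0 a b t ->
  grad (Jw J t) (y t) = grad (Jw J t0) y0.
Proof.
move=> yS tab; have [adm yO pos] := yS; have [_ yt0 yD] := yO.
set l := Num.min t t0; set u := Num.max t t0.
have lu : l <= u by rewrite ge_min le_max lexx.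
have sub := segment_sub adm tab.
have yR : regular_curve J l u y by apply: positive_regular yS lu sub.
pose w s := (1 - s) *: grad (J 0) (y s) + s *: grad (J 1) (y s).
have wE s : grad (Jw J s) (y s) = w s by rewrite grad_Jw.
have wc : wcont `[l, u] w.
  move=> s sI; have FF : Filter (within `[l, u]%classic (nbhs s)) by exact: within_filter.
  have gc i : grad (J i) (y z) @[z --> within `[l, u] (nbhs s)] --> grad (J i) (y s).
    apply: (@cvg_comp _ _ _ y (grad (J i)) _ _ _ (rc_cont yR sI)).
    by apply: differentiable_continuous; have [] := J_C2 i.
  have tc : z @[z --> within `[l, u] (nbhs s)] --> s.
    by apply: cvg_within_filter; exact: cvg_id.
  apply: cvgD; apply: cvgZ; [|exact: gc|exact: tc|exact: gc].
  by apply: cvgB; [exact: cvg_cst|exact: tc].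
have wd s : l < s < u -> is_derive s 1 w 0.
  move=> slu; have yd := rc_der yR slu.
  have sI : `[l, u]%classic s by rewrite /= in_itv/=; lra.
  have [[_ /= Au] _] := yD s (sub _ sI).
  have gd i : is_derive s 1 (fun z => grad (J i) (y z)) (hess (J i) (y s) *m rhs J (s, y s)).
    have [_ dg _] := J_C2 i.
    by rewrite -diff_hess//; apply: is_derive_comp_diff.
  have := is_derive_lincomb (gd 0) (gd 1).
  (* The derivative is the Hessian of J_s applied to f, minus grad J_0 - grad J_1; the Hessian
     cancels its inverse in [rhs]. *)
  rewrite !scalemxAl -mulmxDl -hess_Jw// mulKVmx//.
  by rewrite subrr.
have ww : w l = w u by exact: constant_itv lu wc wd.
rewrite wE -yt0 wE /l /u in ww *.
by move: ww; case: (leP t t0).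
Qed.

End MaximalSolutions.

(** * Optimality and stability *)

Section Optimality.
Set Implicit Arguments.
Unset Strict Implicit.
Context {R : realType} {n : nat}.
Implicit Types (s t : R).

Lemma eventually_enorm_lt (y0_ : nat -> 'cV[R]_n) (y0 : 'cV[R]_n) (rho : R) :
  y0_ k @[k --> \oo] --> y0 -> 0 < rho ->
  \forall k \near \oo, enorm (y0_ k - y0) < rho.
Proof.
move=> yc rho0; have e0 : 0 < rho / n.+1%:R by rewrite divr_gt0.
have /cvgrPdist_lt /(_ _ e0) := yc; apply: filterS => k yk.
rewrite enorm_distC (le_lt_trans (enorm_le_norm _))//.
rewrite (@le_lt_trans _ _ (n.+1%:R * `|y0 - y0_ k|))//.
  by rewrite ler_wpM2r// ler_nat.
by rewrite mulrC -ltr_pdivlMr.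
Qed.

Variable J : 'I_2 -> 'cV[R]_n -> R.
Hypothesis n_gt0 : (0 < n)%N.
Hypothesis J_C2 : forall i, twice_continuously_differentiable (J i).
Hypothesis J_lip : forall i, locally_lipschitz setT (hess (J i)).

(** A point dominating [x] has a weighted value no larger than that of [x], whereas [x] is a strict
    local minimum. Strictness settles t = 0 and t = 1, where one weight vanishes. *)
Lemma strict_second_order_optimal t x : 0 <= t <= 1 -> strict_second_order J t x ->
  locally_optimal J t x /\ locally_Pareto_optimal J x.
Proof.
move=> t01 [g0 pd].
have H := strict_local_min n_gt0 (Jw_C2 J_C2 t) g0 pd.
split; apply: (@filterS _ _ (nbhs_filter x)) H => y Hy.
  by have [->//|/Hy/ltW] := eqVneq y x.
move=> [dom [i domi]]; have [yx|/Hy] := eqVneq y x.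
  by rewrite yx ltxx in domi.
apply/negP; rewrite -leNgt /Jw; have := dom 0; have := dom 1.
move: (J 0 y) (J 1 y) (J 0 x) (J 1 x) => p q p' q' ? ?; nra.
Qed.

Lemma positive_solution_optimal t0 y0 (a b : R) (y : R -> 'cV[R]_n) t :
  positive_solution J t0 y0 a b y -> grad (Jw J t0) y0 = 0 ->
  interval_around t0 a b t ->
  locally_optimal J t (y t) /\ locally_Pareto_optimal J (y t).
Proof.
move=> yS g0 tab; have [adm _ pos] := yS.
have := interval_around01 adm tab; rewrite /= in_itv/= => t01.
apply: strict_second_order_optimal => //; split.
  by rewrite (grad_Jw_conserved J_C2 yS tab).
exact/(posdefP (hess_Jw_sym J_C2 t (y t)) n_gt0)/pos.
Qed.

(* A solution on the larger interval forces a maximal solution to be defined on all of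
   [l, u], endpoints included. *)
Lemma enlarge_segment t0 (a b l u : R) : admissible_ends t0 a b -> l <= t0 <= u ->
  `[l, u]%classic `<=` interval_around t0 a b ->
  exists l' u', [/\ admissible_ends t0 l' u',
    `[l', u']%classic `<=` interval_around t0 a b &
    `[l, u]%classic `<=` interval_around t0 l' u'].
Proof.
move=> adm t0lu sub; have [a0 b1 ab t0ab] := admissible_ends_le adm.
have lI : interval_around t0 a b l by apply: sub; rewrite /= in_itv/=; lra.
have uI : interval_around t0 a b u by apply: sub; rewrite /= in_itv/=; lra.
have al : a <= l by move: lI => /interval_aroundP[?|->]; lra.
have ub : u <= b by move: uI => /interval_aroundP[?|->]; lra.
(* The new ends are midpoints. If [t0] is 0 and [a = 0], then also [l = 0] and the left midpoint
   stays at 0; likewise at 1. *)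
have lu' : (a + l) / 2 < (u + b) / 2 by rewrite ltr_pM2r ?invr_gt0//; lra.
have [_ _ _ H] := adm.
exists ((a + l) / 2), ((u + b) / 2); split.
- split; [lra|lra|lra|].
  case: H => H; first by apply: Or31; lra.
    by apply: Or32; move: lI => /interval_aroundP[?|?]; lra.
  by apply: Or33; move: uI => /interval_aroundP[?|?]; lra.
- move=> s; rewrite /= in_itv/= => slu; apply/interval_aroundP.
  have [->|st0] := eqVneq s t0; [by right|left].
  move: st0; rewrite neq_lt => st0.
  have h1 : a < s.
    move: lI => /interval_aroundP[?|?]; first lra.
    case: H => H; [lra| |]; last lra.
    by move: st0 => /orP[]; lra.
  have h2 : s < b.
    move: uI => /interval_aroundP[?|?]; first lra.
    case: H => H; [lra|lra|].
    by move: st0 => /orP[]; lra.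
  by rewrite h1.
- move=> s; rewrite /= in_itv/= => slu; apply/interval_aroundP.
  have [->|st0] := eqVneq s t0; [by right|left].
  have sab : a < s < b.
    have : interval_around t0 a b s by apply: sub; rewrite /= in_itv.
    by move=> /interval_aroundP[//|/eqP]; rewrite (negPf st0).
  by apply/andP; split; lra.
Qed.

(** The radius [rho] is r / exp (L_f D), D being the largest distance from [t0]: an initial error
    below it grows to less than [r]. In the tube [Lambda] is at least LambdaI - delta L_HI, so
    positivity persists. *)
Lemma nearby_positive_solution (x : R -> 'cV[R]_n) (l u t0 : R) :
  regular_curve J l u x -> admissible_ends t0 l u ->
  exists2 rho, 0 < rho & forall y0, enorm (y0 - x t0) < rho ->
    exists y, positive_solution J t0 y0 l u y.
Proof.
move=> xR adm; have [l0 u1 lu t0lu] := admissible_ends_le adm.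
have [delta dP] : exists delta, admissible_radius J x `[l, u] delta.
  by case: xR => *; exact: exists_admissible_radius.
have d0 : 0 < delta by case: dP.
pose r := delta / n.+1%:R.
have r0 : 0 < r by rewrite divr_gt0.
have rs : n%:R * r < delta.
  by rewrite /r mulrCA gtr_pMr// ltr_pdivrMr// mul1r ltr_nat.
have [L L0 LP] := rhs_closed_tube_lip n_gt0 J_C2 J_lip xR dP rs.
set Lf := L_f J x `[l, u] delta; set D := Num.max (t0 - l) (u - t0).
exists (r / expR (Lf * D)) => [|y0 y0r]; first by rewrite divr_gt0 ?expR_gt0.
have small : gbound Lf 0 (enorm (y0 - x t0)) D < r.
  by rewrite /gbound mulr0 addr0 -ltr_pdivlMr ?expR_gt0.
have eta p : closed_tube x l u r p -> enorm (rhs J p - rhs J p) <= 0.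
  by move=> _; rewrite subrr enorm0.
have [y [yt0 yd]] := solve_near n_gt0 J_C2 J_lip xR dP r0 rs L0 (lexx 0) t0lu LP eta small.
have sub s : interval_around t0 l u s -> l <= s <= u.
  by move=> /interval_aroundP[?|->]; lra.
have t0I : interval_around t0 l u t0 by apply/interval_aroundP; right.
exists y; split=> //.
- split=> // s /sub /yd[ys sT]; split.
    exact: (closed_tube_rhs_dom n_gt0 J_C2 J_lip xR dP rs).
  exact: is_derive_quotient.
- move=> s /sub /yd[_ sT].
  have := closed_tube_coercive n_gt0 J_C2 J_lip xR dP rs sT.
  move/(coercive_Lambda J_C2 _ _ n_gt0); apply: lt_le_trans.
  exact: (regular_m_gt0 n_gt0 J_C2 J_lip xR dP).
Qed.

(** A forbidden direction d would give <grad J_t, d> < - min (t, 1 - t) eps' |d| = - eps |d|,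
    against Cauchy-Schwarz. The inequality is strict because the second product is negative and has
    a positive weight. *)
Lemma eps_critical_Pareto eps t x : 0 < t < 1 -> eps_critical J eps t x ->
  eps_Pareto_critical J (eps / Num.min t (1 - t)) x.
Proof.
move=> t01 crit [d [i [j [ij di dj]]]].
have m0 : 0 < Num.min t (1 - t) by rewrite lt_min; apply/andP; split; lra.
have eps0 : 0 <= eps by apply: le_trans crit; exact: enorm_ge0.
have lower : - (eps * enorm d) <= (1 - t) * dotv (grad (J 0) x) d + t * dotv (grad (J 1) x) d.
  rewrite -!dotvZl -dotvDl -grad_Jw// lerNl -dotvNl.
  by rewrite (le_trans (dotv_CS _ _))// enormN ler_wpM2r ?enorm_ge0.
have c0 : 0 <= eps / Num.min t (1 - t) * enorm d.
  by rewrite mulr_ge0 ?enorm_ge0// divr_ge0// ltW.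
have cE : Num.min t (1 - t) * (eps / Num.min t (1 - t) * enorm d) = eps * enorm d.
  by rewrite mulrA mulrC [_ * (eps / _)]mulrC divfK ?gt_eqF// mulrC.
have m1 : Num.min t (1 - t) <= t by rewrite ge_min lexx.
have m2 : Num.min t (1 - t) <= 1 - t by rewrite ge_min lexx orbT.
rewrite mulNr in di.
move: (Num.min t (1 - t)) m0 m1 m2 di dj c0 cE => m m0 m1 m2.
move: ij lower; move: i j; apply: ord2P; apply: ord2P => //= _;
move: (dotv (grad (J 0) x) d) (dotv (grad (J 1) x) d) (enorm d) => p q e;
move: (eps / m * e) (eps * e) => w v; nra.
Qed.

End Optimality.

(** * Stability of exact and perturbed solutions *)

Section Stability.
Set Implicit Arguments.
Unset Strict Implicit.
Context {R : realType} {n : nat}.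
Implicit Types (s t : R).

Lemma le_gbound (L eta eta' c d d' : R) : 0 < L -> 0 <= c -> 0 <= eta <= eta' ->
  0 <= d <= d' -> gbound L eta c d <= gbound L eta' c d'.
Proof.
move=> L0 c0 /andP[eta0 ee] /andP[d0 dd].
apply: (le_trans (gbound_le L0 eta0 c0 dd)); rewrite /gbound lerD2l ler_wpM2l//.
rewrite divr_ge0 ?(ltW L0)// subr_ge0 -expR0 ler_expR mulr_ge0 ?(ltW L0)//.
exact: le_trans d0 dd.
Qed.

Lemma dist_le_max (l u s t : R) : l <= s <= u -> l <= t <= u ->
  0 <= `|t - s| <= Num.max (s - l) (u - s).
Proof.
move=> slu tlu; rewrite normr_ge0/= le_max.
by case: (leP s t) => ?; [rewrite ger0_norm|rewrite ltr0_norm]; lra.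
Qed.

Lemma supnorm_le (I : set R) (g : R -> 'cV[R]_n) (M : \bar R) :
  (forall t, I t -> ((enorm (g t))%:E <= M)%E) -> (supnorm I g <= M)%E.
Proof. by move=> gM; apply: ge_ereal_sup => _ [t It <-]; exact: gM. Qed.

Variable J : 'I_2 -> 'cV[R]_n -> R.
Hypothesis n_gt0 : (0 < n)%N.
Hypothesis J_C2 : forall i, twice_continuously_differentiable (J i).
Hypothesis J_lip : forall i, locally_lipschitz setT (hess (J i)).

Variables (x : R -> 'cV[R]_n) (l u t0 delta : R).
Hypothesis xR : regular_curve J l u x.
Hypothesis t0lu : l <= t0 <= u.
Local Notation I := `[l, u]%classic.
Hypothesis dP : admissible_radius J x I delta.
Local Notation Lf := (L_f J x I delta).
Local Notation D := (Num.max (t0 - l) (u - t0)).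

Lemma ode_itv_is_derive g y0 (y : R -> 'cV[R]_n) : ode_solution g (rhs_dom J) I t0 y0 y ->
  forall t, l < t < u -> is_derive t 1 y (g (t, y t)).
Proof. by move=> yS t tlu; apply: (ode_is_derive yS); exact: itv_nbhs. Qed.

(** Both times are free: s = t0 gives the upper bound on the distance, t = t0 the lower bound behind
    the convergence rate. *)
Lemma ode_stability : exists2 rho, 0 < rho & forall y0 (y : R -> 'cV[R]_n),
  ode_solution (rhs J) (rhs_dom J) I t0 y0 y -> enorm (y0 - x t0) < rho ->
  forall s t, l <= s <= u -> l <= t <= u ->
    enorm (y t - x t) <= enorm (y s - x s) * expR (Lf * `|t - s|).
Proof.
have d0 : 0 < delta by case: dP.
have rd : delta / 2 < delta by rewrite ltr_pdivrMr// ltr_pMr// ltr1n.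
exists (delta / 2 / expR (Lf * D)) => [|y0 y yS y0rho s t slu tlu].
  by rewrite !divr_gt0// expR_gt0.
have yt0 : y t0 = y0 by case: yS.
have eta z : l < z < u -> enorm (y z - x z) <= delta / 2 ->
    enorm (rhs J (z, y z) - rhs J (z, y z)) <= 0 by rewrite subrr enorm0.
have stay z : l <= z <= u -> enorm (y z - x z) < delta / 2.
  move=> zlu; apply: (perturbed_in_tube n_gt0 J_C2 J_lip xR dP rd (lexx 0)
    (ode_wcont yS) (ode_itv_is_derive yS) eta t0lu zlu).
  by rewrite /gbound mulr0 addr0 yt0 -ltr_pdivlMr ?expR_gt0.
have := perturbed_le n_gt0 J_C2 J_lip xR dP rd (lexx 0)
    (ode_wcont yS) (ode_itv_is_derive yS) eta stay slu tlu.
by rewrite /gbound mulr0 addr0.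
Qed.

Lemma tube_rhs_error (g : R * 'cV[R]_n -> 'cV[R]_n) r p : 0 <= r -> n%:R * r < delta ->
  closed_tube x l u r p -> ((enorm (g p - rhs J p))%:E <= rhs_error J x I g delta)%E.
Proof.
move=> r0 rs pT; apply: ereal_sup_ubound; exists p => //; split.
- by case: pT; rewrite /= in_itv.
- apply: subset_closure; exists p.1; first by case: pT; rewrite /= in_itv.
  exact: closed_tube_enorm pT.
- exact: (closed_tube_rhs_dom n_gt0 J_C2 J_lip xR dP rs pT).
Qed.

(** The error of [g] plays two roles. Smallness by [eta] on the compact tube, which uniform
    convergence on compact sets provides, confines the solution; the final bound then uses
    [rhs_error], a supremum over a larger set that may be infinite. *)
Lemma perturbed_ode_stability : exists r eta rho, [/\ 0 < r, 0 < eta, 0 < rho,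
  closed_tube x l u r `<=` rhs_dom J &
  forall (g : R * 'cV[R]_n -> 'cV[R]_n) y0, locally_lipschitz (rhs_dom J) g ->
  (forall p, closed_tube x l u r p -> enorm (g p - rhs J p) <= eta) ->
  enorm (y0 - x t0) < rho ->
  (exists y, ode_solution g (rhs_dom J) I t0 y0 y) /\
  forall y, ode_solution g (rhs_dom J) I t0 y0 y ->
    (supnorm I (fun t => x t - y t)%R <=
     (enorm (x t0 - y0) * expR (Lf * D))%:E +
     (1 / Lf * (expR (Lf * D) - 1))%:E * rhs_error J x I g delta)%E].
Proof.
have d0 : 0 < delta by case: dP.
pose r := delta / n.+1%:R.
have r0 : 0 < r by rewrite divr_gt0.
have rs : n%:R * r < delta.
  by rewrite /r mulrCA gtr_pMr// ltr_pdivrMr// mul1r ltr_nat.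
have rd : r < delta by rewrite (le_lt_trans _ rs)// ler_peMl ?ler1n// ltW.
have L0 : 0 < Lf by exact: (regular_L_f_gt0 n_gt0 J_C2 J_lip xR dP).
have D0 : 0 <= D by have := dist_le_max t0lu t0lu; rewrite subrr normr0 lexx.
set E := expR (Lf * D).
have E1 : 1 <= E by rewrite -expR0 ler_expR mulr_ge0 ?(ltW L0).
have E0 : 0 < E by exact: expR_gt0.
have c0 : 0 <= (E - 1) / Lf by rewrite divr_ge0 ?(ltW L0)// subr_ge0.
(* The radius is shared equally between the growth of the initial error and the effect of [eta]. The
   summand 1 keeps the denominator positive when E = 1. *)
pose eta := r / 2 / ((E - 1) / Lf + 1).
have eta0 : 0 < eta by rewrite !divr_gt0// ltr_wpDl.
have etar : (E - 1) / Lf * eta < r / 2.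
  rewrite /eta mulrA ltr_pdivrMr ?ltr_wpDl// mulrC ltr_pM2l ?divr_gt0//.
  by rewrite ltrDl.
have domT := closed_tube_rhs_dom n_gt0 J_C2 J_lip xR dP rs.
exists r, eta, (r / 2 / E); split=> // [|g y0 gL geta y0rho]; first by rewrite !divr_gt0.
have small : gbound Lf eta (enorm (y0 - x t0)) D < r.
  rewrite /gbound -/E; have : enorm (y0 - x t0) * E < r / 2 by rewrite -ltr_pdivlMr.
  by move: etar; lra.
split.
  have Tc : compact (closed_tube x l u r) by exact: (closed_tube_compact xR).
  have [L Lpos LP] := locally_lipschitz_compact gL Tc domT.
  have [y [yt0 yd]] := solve_near n_gt0 J_C2 J_lip xR dP r0 rs Lpos (ltW eta0) t0lu LP geta small.
  exists y; split=> //.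
  move=> t; rewrite /= in_itv => /yd[ys sT]; split; first exact: domT.
  exact: is_derive_quotient.
move=> y yS; have yt0 : y t0 = y0 by case: yS.
have inT t : l <= t <= u -> enorm (y t - x t) <= r -> closed_tube x l u r (t, y t).
  by move=> tlu yr; split=> //; rewrite (le_trans (norm_le_enorm _)).
have geta' t : l < t < u -> enorm (y t - x t) <= r ->
    enorm (g (t, y t) - rhs J (t, y t)) <= eta.
  by move=> tlu yr; apply: geta; apply: inT => //; lra.
have stay t : l <= t <= u -> enorm (y t - x t) < r.
  move=> tlu; apply: (perturbed_in_tube n_gt0 J_C2 J_lip xR dP rd (ltW eta0)
    (ode_wcont yS) (ode_itv_is_derive yS) geta' t0lu tlu).
  by rewrite yt0.
have bound eta1 : 0 <= eta1 -> (forall t, l < t < u -> enorm (y t - x t) <= r ->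
    enorm (g (t, y t) - rhs J (t, y t)) <= eta1) -> forall t, l <= t <= u ->
    enorm (x t - y t) <= enorm (x t0 - y0) * E + 1 / Lf * (E - 1) * eta1.
  move=> eta10 geta1 t tlu; rewrite enorm_distC (enorm_distC (x t0)).
  have := perturbed_le n_gt0 J_C2 J_lip xR dP rd eta10
    (ode_wcont yS) (ode_itv_is_derive yS) geta1 stay t0lu tlu.
  rewrite yt0 => /le_trans; apply.
  have ee : 0 <= eta1 <= eta1 by rewrite eta10 lexx.
  apply: (le_trans (le_gbound L0 (enorm_ge0 _) ee (dist_le_max t0lu tlu))).
  by rewrite /gbound -/E lerD2l// mulrC mul1r (mulrC Lf^-1) (mulrC _ eta1).
apply: supnorm_le => t; rewrite /= in_itv/= => tlu.
have err t' : l <= t' <= u -> enorm (y t' - x t') <= r ->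
    ((enorm (g (t', y t') - rhs J (t', y t')))%:E <= rhs_error J x I g delta)%E.
  by move=> t'lu yr; apply: (tube_rhs_error g (ltW r0) rs); exact: inT.
have e0 : (0 <= rhs_error J x I g delta)%E.
  by apply: le_trans (err t tlu (ltW (stay t tlu))); rewrite lee_fin enorm_ge0.
move: err e0; case: (rhs_error J x I g delta) => [e| |] //= err e0.
  rewrite -EFinM -EFinD lee_fin; apply: bound => //.
  by move=> z zlu yr; have zlu' : l <= z <= u by [lra|]; have := err z zlu' yr; rewrite lee_fin.
(* With an infinite error the right-hand side is +oo, except when E = 1: then its second term is 0
   times +oo, which is 0, and the finite bound with [eta] has the same vanishing factor. *)
have [c1|c1] := eqVneq E 1.
  rewrite c1 subrr mulr0 mul0e adde0 lee_fin.
  by have := bound eta (ltW eta0) geta' t tlu; rewrite c1 subrr mulr0 mul0r addr0.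
rewrite gt0_muley ?addey ?leey// lte_fin mulr_gt0 ?divr_gt0// subr_gt0.
by rewrite lt_neqAle eq_sym c1.
Qed.

End Stability.

Theorem proposition5 (R : realType) (n : nat) (n_gt0 : (0 < n)%N)
    (J : 'I_2 -> 'cV[R]_n -> R)
    (J_C2 : forall i, twice_continuously_differentiable (J i))
    (J_lip : forall i, locally_lipschitz setT (hess (J i)))
    (lam0 : R) (lam0_01 : 0 <= lam0 <= 1)
    (x0 : 'cV[R]_n) (x0_opt : strict_second_order J lam0 x0)
    (x0_ : nat -> 'cV[R]_n) (x0_cvg : x0_ k @[k --> \oo] --> x0)
    (a b : R) (x : R -> 'cV[R]_n)
    (x_sol : maximal_solution J lam0 x0 a b x) :
  (* (i) *)
  (forall eps : R, 0 < eps -> \forall k \near \oo,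
     (exists a_k b_k x_k, maximal_solution J lam0 (x0_ k) a_k b_k x_k) /\
     forall a_k b_k x_k, maximal_solution J lam0 (x0_ k) a_k b_k x_k ->
       interval_around lam0 a_k b_k `<=` `[0, 1]%classic /\
       forall lam, interval_around lam0 a_k b_k lam ->
         eps_critical J eps lam (x_k lam) /\
         (0 < lam < 1 ->
            eps_Pareto_critical J (eps / Num.min lam (1 - lam)) (x_k lam))) /\
  forall lam_l lam_u : R, lam_l <= lam0 <= lam_u ->
  let I : set R := `[lam_l, lam_u]%classic in
  I `<=` interval_around lam0 a b ->
  (* (ii) *)
  (exists delta, admissible_radius J x I delta) /\
  (forall delta, admissible_radius J x I delta ->
     let E := expR (L_f J x I delta * Num.max (lam0 - lam_l) (lam_u - lam0)) in
     forall (a_ b_ : nat -> R) (x_ : nat -> R -> 'cV[R]_n),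
       (\forall k \near \oo,
          maximal_solution J lam0 (x0_ k) (a_ k) (b_ k) (x_ k)) ->
       (\forall k \near \oo,
          I `<=` interval_around lam0 (a_ k) (b_ k) /\
          (supnorm I (fun lam => x lam - x_ k lam)%R
             <= (enorm (x0 - x0_ k) * E)%:E)%E) /\
       (forall lam, I lam ->
          [/\ x_ k lam @[k --> \oo] --> x lam,
              (fun k => enorm (x_ k lam - x lam))
                =Theta_\oo (fun k => enorm (x0_ k - x0)),
              locally_optimal J lam (x lam)
            & locally_Pareto_optimal J (x lam)]) /\
       locally_optimal J lam0 x0 /\ locally_Pareto_optimal J x0) /\
  (* (iii) *)
  (forall f_ : nat -> R * 'cV[R]_n -> 'cV[R]_n,
     (forall l, locally_lipschitz (rhs_dom J) (f_ l)) ->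
     (forall K : set (R * 'cV[R]_n), compact K -> K `<=` rhs_dom J ->
        {uniform K, f_ @ \oo --> rhs J}) ->
   forall delta, admissible_radius J x I delta ->
     let Lf := L_f J x I delta in
     let E := expR (Lf * Num.max (lam0 - lam_l) (lam_u - lam0)) in
     \forall k \near \oo & l \near \oo,
       (exists x_kl, ode_solution (f_ l) (rhs_dom J) I lam0 (x0_ k) x_kl) /\
       forall x_kl, ode_solution (f_ l) (rhs_dom J) I lam0 (x0_ k) x_kl ->
         (supnorm I (fun lam => x lam - x_kl lam)%R
            <= (enorm (x0 - x0_ k) * E)%:E
               + (1 / Lf * (E - 1))%:E * rhs_error J x I (f_ l) delta)%E).
Proof.
have [adm xode xpos] := x_sol.1.
have [_ xt0 _] := xode.
have xS := x_sol.1.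
have [a0 b1 ab t0ab] := admissible_ends_le adm.
have g0 : grad (Jw J lam0) x0 = 0 by case: x0_opt.
have [opt0 Par0] := strict_second_order_optimal n_gt0 J_C2 lam0_01 x0_opt.
(* One interval, independent of [k], that carries solutions for all large [k] and contains the
   segment with its endpoints. *)
have solvable lam_l lam_u : lam_l <= lam0 <= lam_u ->
    `[lam_l, lam_u]%classic `<=` interval_around lam0 a b ->
    exists l' u', `[lam_l, lam_u]%classic `<=` interval_around lam0 l' u' /\
      \forall k \near \oo, exists y, positive_solution J lam0 (x0_ k) l' u' y.
  move=> lu sub; have [l' [u' [adm' sub' subI]]] := enlarge_segment adm lu sub.
  have [_ _ lu' _] := admissible_ends_le adm'.
  have xR := positive_regular xS (ltW lu') sub'.
  have [rho rho0 rhoP] := nearby_positive_solution n_gt0 J_C2 J_lip xR adm'.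
  exists l', u'; split=> //.
  have := eventually_enorm_lt x0_cvg rho0; apply: filterS => k xk.
  by apply: rhoP; rewrite xt0.
split.
  move=> eps eps0.
  (* Only local existence is needed here, so the degenerate segment at [lam0] will do. *)
  have tt : lam0 <= lam0 <= lam0 by rewrite lexx.
  have [|l' [u' [_ exk]]] := solvable lam0 lam0 tt.
    by move=> t; rewrite /= in_itv/= -eq_le => /eqP <-; apply/interval_aroundP; right.
  (* The gradient is conserved along each solution, so it suffices that it is small at the initial
     point, where continuity applies. *)
  have gk : \forall k \near \oo, enorm (grad (Jw J lam0) (x0_ k) - 0) < eps.
    apply: eventually_enorm_lt => //; rewrite -g0.
    have [_ dg _] := Jw_C2 J_C2 lam0.
    have gc := differentiable_continuous (dg x0).
    exact: (@cvg_comp _ _ _ x0_ (grad (Jw J lam0)) _ _ _ x0_cvg gc).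
  near=> k.
  split.
    have [y yS] : exists y, positive_solution J lam0 (x0_ k) l' u' y by near: k.
    exact: (exists_maximal_solution n_gt0 J_C2 J_lip yS).
  move=> a_k b_k x_k [xkS _].
  have admk : admissible_ends lam0 a_k b_k by case: xkS.
  split; first exact: interval_around01.
  move=> lam lamI.
  have crit : eps_critical J eps lam (x_k lam).
    rewrite /eps_critical (grad_Jw_conserved J_C2 xkS lamI) -[grad _ _]subr0.
    by apply: ltW; near: k.
  by split=> // lam01; exact: eps_critical_Pareto.
move=> lam_l lam_u lu I sub.
have lu' : lam_l <= lam_u by lra.
have xR := positive_regular xS lu' sub.
split; first by case: xR => *; exact: exists_admissible_radius.
have t0I : I lam0 by rewrite /I /= in_itv.
split.
  move=> delta dP E a_ b_ x_ xk_max.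
  have [rho rho0 stab] := ode_stability n_gt0 J_C2 J_lip xR lu dP.
  have [l' [u' [subI exk]]] := solvable lam_l lam_u lu sub.
  have L0 := regular_L_f_gt0 n_gt0 J_C2 J_lip xR dP.
  have xk_sol : \forall k \near \oo,
      [/\ I `<=` interval_around lam0 (a_ k) (b_ k), enorm (x0_ k - x0) < rho &
       ode_solution (rhs J) (rhs_dom J) I lam0 (x0_ k) (x_ k)].
    near=> k.
    have xkM : maximal_solution J lam0 (x0_ k) (a_ k) (b_ k) (x_ k) by near: k.
    have [y yS] : exists y, positive_solution J lam0 (x0_ k) l' u' y by near: k.
    (* Maximality, tested against the solution on the common interval, pushes the ends of the k-th
       interval beyond it. *)
    have [ak bk] := xkM.2 _ _ _ yS.
    have subk : I `<=` interval_around lam0 (a_ k) (b_ k).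
      move=> t /subI /interval_aroundP[tlu|->]; apply/interval_aroundP; last by right.
      by left; lra.
    split=> //; last by have [_ xko _] := xkM.1; exact: ode_sub subk t0I xko.
    by near: k; exact: eventually_enorm_lt.
  have bound : \forall k \near \oo, x_ k lam0 = x0_ k /\
      forall s t, lam_l <= s <= lam_u -> lam_l <= t <= lam_u ->
      enorm (x_ k t - x t) <= enorm (x_ k s - x s) *
        expR (L_f J x I delta * `|t - s|).
    apply: filterS xk_sol => k [_ xk xko]; split; first by case: xko.
    by apply: (stab _ _ xko); rewrite xt0.
  have expE t : lam_l <= t <= lam_u -> expR (L_f J x I delta * `|t - lam0|) <= E.
    move=> tlu; rewrite ler_expR ler_pM2l//.
    by have /andP[] := dist_le_max lu tlu.
  have E0 : 0 < E by exact: expR_gt0.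
  split.
    near=> k; have [subk _ _] : [/\ I `<=` interval_around lam0 (a_ k) (b_ k), enorm (x0_ k - x0) < rho &
       ode_solution (rhs J) (rhs_dom J) I lam0 (x0_ k) (x_ k)] by near: k.
    split=> //; apply: supnorm_le => t; rewrite /I /= in_itv/= => tlu.
    have [xk0 bk] : x_ k lam0 = x0_ k /\
      forall s t, lam_l <= s <= lam_u -> lam_l <= t <= lam_u ->
      enorm (x_ k t - x t) <= enorm (x_ k s - x s) *
        expR (L_f J x I delta * `|t - s|) by near: k.
    rewrite lee_fin enorm_distC (enorm_distC x0); apply: (le_trans (bk lam0 t lu tlu)).
    by rewrite xk0 xt0 ler_wpM2l ?enorm_ge0// expE.
  split=> //; move=> lam; rewrite /I /= in_itv/= => lamI.
  have ub : \forall k \near \oo, enorm (x_ k lam - x lam) <= E * enorm (x0_ k - x0).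
    apply: filterS bound => k [xk0 bk]; apply: (le_trans (bk lam0 lam lu lamI)).
    by rewrite xk0 xt0 mulrC ler_wpM2r ?enorm_ge0// expE.
  (* Stability from [lam] back to [lam0]. With [ub] it gives the constants [E^-1] and [E] of the
     two-sided rate. *)
  have lb : \forall k \near \oo, E^-1 * enorm (x0_ k - x0) <= enorm (x_ k lam - x lam).
    apply: filterS bound => k [xk0 bk]; rewrite mulrC ler_pdivrMr//.
    have := bk lam lam0 lamI lu; rewrite xk0 xt0 distrC => /le_trans; apply.
    by rewrite ler_wpM2l ?enorm_ge0// expE.
  have [optl Parl] : locally_optimal J lam (x lam) /\ locally_Pareto_optimal J (x lam).
    by apply: (positive_solution_optimal n_gt0 J_C2 xS g0); apply: sub; rewrite /I /= in_itv.
  split=> //.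
    apply/cvgrPdist_lt => e e0; near=> k.
    rewrite distrC (le_lt_trans (norm_le_enorm _))//.
    apply: (@le_lt_trans _ _ (E * enorm (x0_ k - x0))); first by near: k.
    rewrite mulrC -ltr_pdivlMr//; near: k; apply: eventually_enorm_lt => //.
    by rewrite divr_gt0.
  rewrite eqThetaE qualifE; apply/asboolP; exists (E^-1, E) => /=.
    by rewrite invr_gt0 E0.
  by near=> k; rewrite !ger0_norm ?enorm_ge0//; split; near: k.
move=> f_ f_lip f_cvg delta dP Lf E.
have [r [eta [rho [r0 eta0 rho0 Tdom stab]]]] := perturbed_ode_stability n_gt0 J_C2 J_lip xR lu dP.
have Tc : compact (closed_tube x lam_l lam_u r) by exact: (closed_tube_compact xR).
have fl : \forall l \near \oo, forall p, closed_tube x lam_l lam_u r p ->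
    enorm (f_ l p - rhs J p) <= eta.
  (* The division by [n] pays for passing from the maximum norm of uniform convergence to the
     Euclidean norm. *)
  have e0 : 0 < eta / n%:R by rewrite divr_gt0// ltr0n.
  have := f_cvg _ Tc Tdom [set h | forall p, closed_tube x lam_l lam_u r p ->
    ball (rhs J p) (eta / n%:R) (h p)].
  case=> [|N _ HN].
    apply/uniform_nbhs; exists [set uv | ball uv.1 (eta / n%:R) uv.2]; split=> //.
    rewrite -entourage_ballE; exists (eta / n%:R) => //.
  exists N => // l Nl p pT; have := HN l Nl p pT; rewrite -ball_normE/= => /ltW h.
  rewrite (le_trans (enorm_le_norm _))// distrC.
  by rewrite mulrC -ler_pdivlMr ?ltr0n.
exists ([set k | enorm (x0_ k - x0) < rho], [set l | forall p, closed_tube x lam_l lam_u r p ->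
    enorm (f_ l p - rhs J p) <= eta]).
  by split=> //=; exact: eventually_enorm_lt.
move=> [k l] /= [xk fk].
have xk' : enorm (x0_ k - x lam0) < rho by rewrite xt0.
have [ex bd] := stab _ _ (f_lip l) fk xk'.
by split=> // y /bd; rewrite xt0.
Unshelve. all: by end_near.
Qed.
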